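(* The assignment $$X^-(u)\mapsto e_{-1,0}(u),\qquad X^+(u)\mapsto f_{0,-1}(u),\qquad H(u)\mapsto k_{-1}^{-1}(u)k_0(u)$$ (i.e. $x^-_k\mapsto e^{(k+1)}_{-1,0}$, $x^+_k\mapsto f^{(k+1)}_{0,-1}$, and $h_k\mapsto$ the coefficient of $u^{-k-1}$ in $k_{-1}^{-1}(u)k_0(u)$) extends to an algebra isomorphism $\Phi: Y(\mathfrak{so}_3)\to Y_R(\mathfrak{so}_3)$. Its inverse is determined by $e_{-1,0}(u)\mapsto X^-(u)$, $f_{0,-1}(u)\mapsto X^+(u)$, $k_{-1}(u)\mapsto H^{-1}(u-\frac12)$.
   Context: Let $e_{ij}$ ($i,j\in\{-1,0,1\}$) be the matrix units of $\mathrm{End}\,\mathbb{C}^3$, with rows and columns indexed by $-1,0,1$. Let $P=\sum_{i,j}e_{ij}\otimes e_{ji}$, $Q=\sum_{i,j}e_{ij}\otimes e_{-i,-j}$ and $R(u)=1-\frac{P}{u}+\frac{Q}{u-\frac12}$. Let $t$ be the transposition on $\mathrm{End}\,\mathbb{C}^3$ given by $(e_{ij})^t=e_{-j,-i}$. The algebra $Y_R(\mathfrak{so}_3)$ is the unital associative algebra over $\mathbb{C}$ generated by elements $t_{ij}^{(r)}$, $r\ge 1$, $i,j\in\{-1,0,1\}$; put $t_{ij}(u)=\delta_{ij}+\sum_{r\ge1}t^{(r)}_{ij}u^{-r}$, $T(u)=\sum_{i,j}t_{ij}(u)\otimes e_{ij}$, $T^t(u)=\sum_{i,j}t_{ij}(u)\otimes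 e_{-j,-i}$, $T_1(u)=\sum t_{ij}(u)\otimes e_{ij}\otimes 1$, $T_2(v)=\sum t_{ij}(v)\otimes 1\otimes e_{ij}$. The defining relations are $R(u-v)T_1(u)T_2(v)=T_2(v)T_1(u)R(u-v)$ and $T(u)T^t(u+\frac12)=T^t(u+\frac12)T(u)=1$. The Gauss generators are the unique series $k_i(u)\in 1+u^{-1}Y_R(\mathfrak{so}_3)[[u^{-1}]]$ ($i=-1,0,1$) and $e_{ij}(u),f_{ji}(u)\in u^{-1}Y_R(\mathfrak{so}_3)[[u^{-1}]]$ ($-1\le i<j\le1$) such that $T(u)=F(u)K(u)E(u)$, where $F(u)$ is the lower unitriangular matrix with below-diagonal entries $F_{0,-1}=f_{0,-1}(u)$, $F_{1,-1}=f_{1,-1}(u)$, $F_{1,0}=f_{1,0}(u)$, $K(u)=\mathrm{diag}(k_{-1}(u),k_0(u),k_1(u))$, and $E(u)$ is the upper unitriangular matrix with above-diagonal entries $E_{-1,0}=e_{-1,0}(u)$, $E_{-1,1}=e_{-1,1}(u)$, $E_{0,1}=e_{01}(u)$ (rows/columns indexed by $-1,0,1$); write $e_{-1,0}(u)=\sum_{r\ge1}e^{(r)}_{-1,0}u^{-r}$, $f_{0,-1}(u)=\sum_{r\ge1}f^{(r)}_{0,-1}u^{-r}$. $Y(\mathfrak{so}_3)$ (Drinfeld's new realization) is the unital associative algebra over $\mathbb{C}$ generated by $h_l, x^{\pm}_l$, $l=0,1,2,\dots$, subject to the relations, for all $k,l\ge0$: $[h_k,h_l]=0$, $[x^+_k,x^-_l]=h_{k+l}$,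 $[h_0,x^{\pm}_l]=\pm x^{\pm}_l$, $[h_{k+1},x^{\pm}_l]-[h_k,x^{\pm}_{l+1}]=\pm\frac12\{h_k,x^{\pm}_l\}$, $[x^{\pm}_{k+1},x^{\pm}_l]-[x^{\pm}_k,x^{\pm}_{l+1}]=\pm\frac12\{x^{\pm}_k,x^{\pm}_l\}$, where $\{a,b\}=ab+ba$. Generating series: $X^{\pm}(u)=\sum_{k\ge0}x^{\pm}_k u^{-k-1}$, $H(u)=1+\sum_{k\ge0}h_k u^{-k-1}$. *)

(* Defs.v *)
From HB Require Import structures.
From mathcomp Require Import all_boot all_order all_algebra.
Set Implicit Arguments. Unset Strict Implicit. Unset Printing Implicit Defensive.
Import Order.TTheory GRing.Theory Num.Theory.
Local Open Scope ring_scope.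

(* Indices -1, 0, 1 are encoded by the ordinals 0, 1, 2 of 'I_3         *)
(* (order-preserving), so  i <-> i - 1.  Negation -i is rev_ord i.     *)
Definition im1 : 'I_3 := @Ordinal 3 0 isT.
Definition i0  : 'I_3 := @Ordinal 3 1 isT.
Definition ip1 : 'I_3 := @Ordinal 3 2 isT.
Definition negI (i : 'I_3) : 'I_3 := rev_ord i.

(* Formal power series in u^{-1}: s : nat -> A, s n = coeff of u^{-n}. *)
Section Series.
Variable F : fieldType.
Variable A : algType F.

Definition sone : nat -> A := fun n => (n == 0%N)%:R.

Definition smul (s t : nat -> A) : nat -> A :=
  fun n => \sum_(k < n.+1) s k * t (n - k)%N.

(* s(u + c), expanded in u^{-1}:  (u+c)^{-r} = sum_k C(r+k-1,k) (-c)^k u^{-r-k} *)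
Definition sshift (c : F) (s : nat -> A) : nat -> A :=
  fun n => \sum_(r < n.+1) ((- c) ^+ (n - r) * ('C(n.-1, n - r))%:R) *: s r.

(* Series in two variables u, v with integer exponents:               *)
(* S m n = coefficient of u^m v^n.                                     *)
Definition coef2 (g : nat -> nat -> A) : int -> int -> A :=
  fun m n => if (m <= 0) && (n <= 0) then g `|m|%N `|n|%N else 0.

(* multiplication by (u - v) *)
Definition mulW (S : int -> int -> A) : int -> int -> A :=
  fun m n => S (m - 1) n - S m (n - 1).

(* action of a scalar polynomial p(w), w = u - v *)
Definition pevalW (p : {poly F}) (S : int -> int -> A) : int -> int -> A :=
  fun m n => \sum_(i < size p) p`_i *: (iter i mulW S) m n.

Definition comm (x y : A) : A := x * y - y * x.
Definition acomm (x y : A) : A := x * y + y * x.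
End Series.

Definition is_alg_hom (F : fieldType) (A B : algType F) (phi : A -> B) : Prop :=
  [/\ forall x y, phi (x + y) = phi x + phi y,
      forall (a : F) x, phi (a *: x) = a *: phi x,
      forall x y, phi (x * y) = phi x * phi y
    & phi 1 = 1].

Definition drinfeld_rel (F : fieldType) (A : algType F)
    (h xp xm : nat -> A) : Prop :=
  [/\ (forall k l, comm (h k) (h l) = 0),
      (forall k l, comm (xp k) (xm l) = h (k + l)%N),
      (forall l, comm (h 0%N) (xp l) = xp l /\ comm (h 0%N) (xm l) = - xm l),
      (forall k l,
          comm (h k.+1) (xp l) - comm (h k) (xp l.+1)
            = (2%:R : F)^-1 *: acomm (h k) (xp l)
       /\ comm (h k.+1) (xm l) - comm (h k) (xm l.+1)
            = - ((2%:R : F)^-1 *: acomm (h k) (xm l)))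
    & (forall k l,
          comm (xp k.+1) (xp l) - comm (xp k) (xp l.+1)
            = (2%:R : F)^-1 *: acomm (xp k) (xp l)
       /\ comm (xm k.+1) (xm l) - comm (xm k) (xm l.+1)
            = - ((2%:R : F)^-1 *: acomm (xm k) (xm l)))].

(* A, with elements h_l, x^+_l, x^-_l, is (a model of) the algebra     *)
(* presented by these generators and relations: the relations hold,    *)
(* and A has the universal property of the presented algebra.         *)
Definition is_Yso3 (F : fieldType) (A : algType F) (h xp xm : nat -> A) : Prop :=
  drinfeld_rel h xp xm /\
  forall (B : algType F) (h' xp' xm' : nat -> B),
    drinfeld_rel h' xp' xm' ->
    exists phi : A -> B,
      [/\ is_alg_hom phi,
          (forall l, phi (h l) = h' l),
          (forall l, phi (xp l) = xp' l),
          (forall l, phi (xm l) = xm' l)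
        & forall psi : A -> B, is_alg_hom psi ->
            (forall l, psi (h l) = h' l) ->
            (forall l, psi (xp l) = xp' l) ->
            (forall l, psi (xm l) = xm' l) -> psi = phi].

Definition Hser (F : fieldType) (A : algType F) (h : nat -> A) : nat -> A :=
  fun n => if n is k.+1 then h k else 1.
Definition Xser (F : fieldType) (A : algType F) (x : nat -> A) : nat -> A :=
  fun n => if n is k.+1 then x k else 0.

(* Generators: t i j r = t_{ij}^{(r+1)}.                               *)
Definition tser (F : fieldType) (A : algType F) (t : 'I_3 -> 'I_3 -> nat -> A)
    (i j : 'I_3) : nat -> A :=
  fun n => if n is r.+1 then t i j r else (i == j)%:R.

(* Entry ((a,b),(x,y)) of  w (w - 1/2) R(w) = w(w-1/2) 1 - (w-1/2) P + w Q *)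
(* (P_{(a,b),(x,y)} = d_{ay} d_{bx},  Q_{(a,b),(x,y)} = d_{b,-a} d_{y,-x}). *)
Definition Rpoly (F : fieldType) (a b x y : 'I_3) : {poly F} :=
    ('X * ('X - ((2%:R : F)^-1)%:P)) *+ ((a == x) && (b == y))
  - ('X - ((2%:R : F)^-1)%:P) *+ ((a == y) && (b == x))
  + 'X *+ ((b == negI a) && (y == negI x)).

Definition rtt_rel (F : fieldType) (A : algType F) (t : 'I_3 -> 'I_3 -> nat -> A) : Prop :=
  (* R(u-v) T_1(u) T_2(v) = T_2(v) T_1(u) R(u-v), both sides multiplied by *)
  (* the scalar polynomial (u-v)(u-v-1/2); entry ((a,b),(c,d)).            *)
  (forall (a b c d : 'I_3) (m n : int),
     \sum_(x < 3) \sum_(y < 3)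
        pevalW (Rpoly F a b x y)
          (coef2 (fun p q => tser t x c p * tser t y d q)) m n
   = \sum_(x < 3) \sum_(y < 3)
        pevalW (Rpoly F x y c d)
          (coef2 (fun p q => tser t b y q * tser t a x p)) m n)
  /\
  (* T(u) T^t(u+1/2) = T^t(u+1/2) T(u) = 1, with T^t_{ab}(u) = t_{-b,-a}(u) *)
  (forall (a c : 'I_3) (n : nat),
     \sum_(b < 3) smul (tser t a b) (sshift (2%:R : F)^-1 (tser t (negI c) (negI b))) n
       = ((a == c) && (n == 0%N))%:R
   /\ \sum_(b < 3) smul (sshift (2%:R : F)^-1 (tser t (negI b) (negI a))) (tser t b c) n
       = ((a == c) && (n == 0%N))%:R).

Definition is_YRso3 (F : fieldType) (A : algType F) (t : 'I_3 -> 'I_3 -> nat -> A) : Prop :=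
  rtt_rel t /\
  forall (B : algType F) (t' : 'I_3 -> 'I_3 -> nat -> B),
    rtt_rel t' ->
    exists phi : A -> B,
      [/\ is_alg_hom phi,
          (forall i j r, phi (t i j r) = t' i j r)
        & forall psi : A -> B, is_alg_hom psi ->
            (forall i j r, psi (t i j r) = t' i j r) -> psi = phi].

(* Gauss decomposition T(u) = F(u) K(u) E(u).                           *)
(* k i : series k_i(u); e i j (i<j) : e_{ij}(u); f j i (i<j) : f_{ji}(u). *)
Definition gauss_decomp (F : fieldType) (A : algType F)
    (t : 'I_3 -> 'I_3 -> nat -> A) (k : 'I_3 -> nat -> A)
    (e f : 'I_3 -> 'I_3 -> nat -> A) : Prop :=
  [/\ (forall i, k i 0%N = 1),
      (forall i j : 'I_3, (i < j)%N -> e i j 0%N = 0 /\ f j i 0%N = 0)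
    & (forall (i j : 'I_3) (n : nat),
        tser t i j n =
          \sum_(p < 3 | (p <= i)%N && (p <= j)%N)
             smul (if p == i then sone A else f i p)
                  (smul (k p) (if p == j then sone A else e p j)) n)].

(* Main.v *)
Require Import Defs.
From HB Require Import structures.
From mathcomp Require Import all_boot all_order all_algebra.
From mathcomp Require Import boolp zify ring.
Set Implicit Arguments. Unset Strict Implicit. Unset Printing Implicit Defensive.
Import Order.TTheory GRing.Theory Num.Theory.
Local Open Scope ring_scope.

(* All relations are written in A[[u^-1, v^-1]], where (u - v) / (u v) is not a *)
(* zero divisor, so that common factors cancel, and where the substitutions     *)
(* v = u + c are ring morphisms.                                               *)
(* RTT => Drinfeld. The first row of T gives the relations between k = k_{-1}    *)
(* and e = e_{-1,0}; at u - v = 1 it gives e_{-1,1} = - e^2 / 2, which turns the *)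
(* relation for t_{-1,0}(u) t_{-1,0}(v) into the Drinfeld relation for e.        *)
(* Transposition, an anti-automorphism, gives the relations for f. With          *)
(* H = k_{-1}^-1 k_0, the relation T^t(u + 1/2) T(u) = 1 makes H(u) k(u + 1/2)    *)
(* invariant under u := u - 1, hence equal to 1; therefore all entries of T are *)
(* determined by H, e and f.                                                   *)
(* Drinfeld => RTT. Define T by the formulas so obtained. The elements x^+_0 and *)
(* x^-_0 act on T by matrix commutators, so the defect D of the RTT relation is *)
(* sl_2-equivariant, and it vanishes on every pair of irreducible constituents *)
(* of V (x) V once one entry does. Three entries of the first row (and, by      *)
(* transposition, of the first column) and one minor are computed; the          *)
(* constituents involving the trivial one follow from crossing symmetry.        *)

(** * Normal forms in free algebras *)

(** Both maps are produced by universal properties, so the theorem rests on two constructions valid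
    in any algebra. [yr_dseries] derives the Drinfeld relations from the RTT relations and the Gauss
    decomposition. [yt_rtt] builds a solution of the RTT relations from a solution of the Drinfeld
    relations. The two maps are inverse to each other because both directions share one formula:
    [yT] writes $T(u)$ through $H$, $e=e_{-1,0}$, $f=f_{0,-1}$, and [r_T] shows that every solution
    has this form. The composites then fix the generators, and the uniqueness clauses conclude.

    The formula is $k_{-1}(u)=H(u-\frac12)^{-1}$, $k_0=k_{-1}H$, $k_1=H$, $e_{-1,1}=-\frac12e^2$,
    $e_{01}(u)=-e(u-\frac12)$, and the mirror image for $f$. The values of $e_{-1,1}$ and $f_{1,-1}$
    come from the degeneration of $R(u-v)$ at $u-v=1$ ([rtt_special_e13]). The rest comes from
    orthogonality ([r_last_row], [r_last_col]), and from the fact that in characteristic 0 a series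
    invariant under $u\mapsto u-1$ is constant ([fshift_fix], used in [r_HG]).

    The hard point is the vanishing of the 81 entries of the RTT defect of [yT]. On rows and on
    columns $\mathbb{C}^3\otimes\mathbb{C}^3$ splits as $V_2\oplus V_1\oplus V_0$ under
    $\mathfrak{sl}_2$, and equivariance ([rtt_defect_equivE], [rtt_defect_equivF]) spreads zeros
    inside each pair of constituents ([col_closure], [rtt_zero]). The seeds are the first-row
    entries [rtt_row1_1111], [rtt_row1_1112], [rtt_row1_1122], the minor [rtt_minor], and crossing
    symmetry [rtt_crossing] for the remaining pairs with trivial column part. Passing to the
    opposite ring exchanges $e$ with $f$ and rows with columns.

    Noncommutative identities are proved by certificates: an explicit two-sided combination of known
    relations is handed to [nc_by] and checked in the free algebra. *)

Inductive ncexpr :=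
  | NcVar of nat | NcW | NcP | NcConst of int
  | NcAdd of ncexpr & ncexpr | NcOpp of ncexpr | NcMul of ncexpr & ncexpr.

(* [(a, b, l)] stands for [w ^+ a * p ^+ b] times the word [l]. *)
Definition ncmono := (nat * nat * seq nat)%type.
Definition ncpoly := seq (ncmono * int).

(** Like terms are merged and cancelled terms removed on insertion, so an expression that vanishes
    in the free algebra normalizes to the empty list. *)
Fixpoint nc_add1 (m : ncmono) (c : int) (q : ncpoly) : ncpoly :=
  if q is (m', c') :: q' then
    if m == m' then (if c + c' == 0 then q' else (m, c + c') :: q')
    else (m', c') :: nc_add1 m c q'
  else if c == 0 then [::] else [:: (m, c)].

Definition nc_addp (q r : ncpoly) : ncpoly :=
  foldr (fun x acc => nc_add1 x.1 x.2 acc) r q.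

Definition nc_mulm (m m' : ncmono) : ncmono :=
  ((m.1.1 + m'.1.1)%N, (m.1.2 + m'.1.2)%N, m.2 ++ m'.2).

Definition nc_mulp (q r : ncpoly) : ncpoly :=
  foldr (fun x acc =>
    foldr (fun y acc' => nc_add1 (nc_mulm x.1 y.1) (x.2 * y.2) acc') acc r)
    [::] q.

Fixpoint nc_norm (e : ncexpr) : ncpoly :=
  match e with
  | NcVar i => [:: (0%N, 0%N, [:: i], 1)]
  | NcW => [:: (1%N, 0%N, [::], 1)]
  | NcP => [:: (0%N, 1%N, [::], 1)]
  | NcConst c => nc_add1 (0%N, 0%N, [::]) c [::]
  | NcAdd a b => nc_addp (nc_norm a) (nc_norm b)
  | NcOpp a => [seq (x.1, - x.2) | x <- nc_norm a]
  | NcMul a b => nc_mulp (nc_norm a) (nc_norm b)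
  end.

Definition central (S : pzRingType) (z : S) := forall x, z * x = x * z.

Section NcEval.
Variables (S : pzRingType) (w p : S) (env : seq S).
Hypotheses (cw : central w) (cp : central p).

Fixpoint nc_eval (e : ncexpr) : S :=
  match e with
  | NcVar i => nth 0 env i
  | NcW => w
  | NcP => p
  | NcConst c => c%:~R
  | NcAdd a b => nc_eval a + nc_eval b
  | NcOpp a => - nc_eval a
  | NcMul a b => nc_eval a * nc_eval b
  end.

Definition nc_evalm (m : ncmono) : S :=
  w ^+ m.1.1 * p ^+ m.1.2 * foldr (fun i acc => nth 0 env i * acc) 1 m.2.

Definition nc_evalp (q : ncpoly) : S :=
  foldr (fun x acc => nc_evalm x.1 *~ x.2 + acc) 0 q.

Lemma nc_evalp_add1 m c q :
  nc_evalp (nc_add1 m c q) = nc_evalm m *~ c + nc_evalp q.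
Proof.
elim: q => [|[m' c'] q IH] /=; first by case: eqP => [->|] /=; rewrite ?mulr0z ?addr0.
case: eqP => [<-|_] /=; last by rewrite IH addrCA.
case: eqP => [H|_] /=; last by rewrite mulrzDr addrA.
by rewrite addrA -mulrzDr H mulr0z add0r.
Qed.

Lemma nc_evalp_add q r : nc_evalp (nc_addp q r) = nc_evalp q + nc_evalp r.
Proof.
by elim: q => [|x q IH] /=; rewrite ?add0r // nc_evalp_add1 IH addrA.
Qed.

Lemma central_exp (z : S) n : central z -> central (z ^+ n).
Proof.
by move=> cz x; elim: n => [|n IH]; rewrite ?expr0 ?mul1r ?mulr1 // exprS -mulrA IH !mulrA cz.
Qed.

Lemma nc_evalm_mul m m' : nc_evalm (nc_mulm m m') = nc_evalm m * nc_evalm m'.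
Proof.
case: m m' => [[a b] l] [[a' b'] l']; rewrite /nc_evalm /=.
have -> : foldr (fun i acc => nth 0 env i * acc) 1 (l ++ l')
  = foldr (fun i acc => nth 0 env i * acc) 1 l
    * foldr (fun i acc => nth 0 env i * acc) 1 l'.
  by elim: l => [|i l IH] /=; rewrite ?mul1r // IH mulrA.
move: (foldr _ _ l) (foldr _ _ l') => x x'.
rewrite !exprD -!mulrA; congr (_ * _).
rewrite (mulrA x) -(central_exp a' cw x) -!mulrA (mulrA (p ^+ b) (w ^+ a')).
rewrite -(central_exp a' cw (p ^+ b)) -!mulrA; congr (_ * (_ * _)).
by rewrite !mulrA (central_exp b' cp x).
Qed.

Lemma nc_evalp_mul q r : nc_evalp (nc_mulp q r) = nc_evalp q * nc_evalp r.
Proof.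
elim: q => [|x q IH] /=; rewrite ?mul0r // mulrDl -IH.
move: (nc_mulp q r) => acc.
elim: r {IH} => [|y r IH] /=; first by rewrite mulr0 add0r.
rewrite nc_evalp_add1 IH mulrDr addrA nc_evalm_mul.
by rewrite mulrzAl [in RHS]mulrzAr [in RHS]mulrzAl mulrzA.
Qed.

Lemma nc_normP e : nc_evalp (nc_norm e) = nc_eval e.
Proof.
elim: e => [i|||c|a IHa b IHb|a IHa|a IHa b IHb] /=.
- by rewrite /nc_evalm /= !mulr1 mul1r addr0.
- by rewrite /nc_evalm /= !mulr1 addr0.
- by rewrite /nc_evalm /= !mulr1 mul1r addr0.
- by rewrite (nc_evalp_add1 (0%N, 0%N, [::]) c [::]) /nc_evalm /= !mulr1 addr0.
- by rewrite nc_evalp_add IHa IHb.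
- by rewrite -IHa; elim: (nc_norm a) => [|x q IH] /=; rewrite ?oppr0 // IH mulrNz opprD.
- by rewrite nc_evalp_mul IHa IHb.
Qed.

Lemma nc_eq0 e : nc_norm e = [::] -> nc_eval e = 0.
Proof. by rewrite -nc_normP => ->. Qed.
End NcEval.

Lemma central1 (S : pzRingType) : central (1 : S).
Proof. by move=> x; rewrite mul1r mulr1. Qed.

Ltac nc_insert x env :=
  match env with
  | [::] => constr:([:: x])
  | x :: _ => env
  | ?y :: ?env' => let r := nc_insert x env' in constr:(y :: r)
  end.

Ltac nc_index x env :=
  match env with
  | x :: _ => constr:(0%N)
  | _ :: ?env' => let n := nc_index x env' in constr:(n.+1)
  end.

Ltac nc_atoms w p env t :=
  match t with
  | w => env
  | p => env
  | 0 => env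
  | 1 => env
  | ?a + ?b => let env := nc_atoms w p env a in nc_atoms w p env b
  | ?a * ?b => let env := nc_atoms w p env a in nc_atoms w p env b
  | - ?a => nc_atoms w p env a
  | ?a *+ ?n => nc_atoms w p env a
  | _ => nc_insert t env
  end.

Ltac nc_reify w p env t :=
  match t with
  | 0 => constr:(NcConst 0%Z)
  | 1 => constr:(NcConst 1%Z)
  | w => constr:(NcW)
  | p => constr:(NcP)
  | ?a + ?b => let a' := nc_reify w p env a in let b' := nc_reify w p env b in
               constr:(NcAdd a' b')
  | ?a * ?b => let a' := nc_reify w p env a in let b' := nc_reify w p env b in
               constr:(NcMul a' b')
  | - ?a => let a' := nc_reify w p env a in constr:(NcOpp a')
  | ?a *+ ?n => let a' := nc_reify w p env a in constr:(NcMul (NcConst (Posz n)) a')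
  | _ => let i := nc_index t env in constr:(NcVar i)
  end.

(** Indexing the difference by the proof of the equation lets a certificate name hypotheses:
    [nc_gapE] makes it zero, while unfolding exposes its two sides to the normalizer. *)
Definition nc_gap (S : pzRingType) (l r : S) (H : l = r) : S := l - r.

Lemma nc_gapE (S : pzRingType) (l r : S) (H : l = r) : nc_gap H = 0.
Proof. by rewrite /nc_gap H subrr. Qed.

Lemma nc_transfer (S : pzRingType) (x y c : S) : c = 0 -> x - y - c = 0 -> x = y.
Proof. by move=> -> /eqP; rewrite subr0 subr_eq0 => /eqP. Qed.

Ltac nc_zero cw cp :=
  match type of cw with central ?w =>
  match type of cp with central ?p =>
  match goal with |- ?t = ?z =>
    let S := type of t in
    let env := nc_atoms w p (@nil S) t in
    let e := nc_reify w p env t in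
    transitivity (nc_eval w p env e);
    [ cbv beta iota delta [nc_eval nth]; rewrite ?mulr_natl; reflexivity
    | apply: (nc_eq0 env cw cp); vm_compute; reflexivity ]
  end end end.

(* [nc_by cw cp c]: the goal [x = y] holds since [x - y] equals [c], a       *)
(* two-sided combination of the vanishing elements [nc_gap H].              *)
Ltac nc_by cw cp c :=
  apply: (@nc_transfer _ _ _ c);
  [ rewrite ?nc_gapE ?(mulr0, mul0r, addr0, subr0, oppr0, mul0rn); reflexivity
  | rewrite /nc_gap; nc_zero cw cp ].


Ltac nc cw cp :=
  match goal with |- @eq ?S _ _ => nc_by cw cp (0 : S) end.

(** * Power series *)

(** A synonym of [nat -> A] that carries the algebra structure, so that the coefficient functions of
    the statement are series without any conversion. *)
Definition fps (F : fieldType) (A : algType F) := nat -> A.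

HB.instance Definition _ (F : fieldType) (A : algType F) := gen_eqMixin (fps A).
HB.instance Definition _ (F : fieldType) (A : algType F) := gen_choiceMixin (fps A).

Section FpsRing.
Variables (F : fieldType) (A : algType F).
Implicit Types x y z : fps A.

Definition fadd x y : fps A := fun n => x n + y n.
Definition fopp x : fps A := fun n => - x n.
Definition fzero : fps A := fun=> 0.
Definition fscale (a : F) x : fps A := fun n => a *: x n.
Definition fmul x y : fps A := smul x y.
Definition fone : fps A := sone A.

Fact faddA : associative fadd.
Proof. by move=> x y z; apply: funext => n; rewrite /fadd addrA. Qed.
Fact faddC : commutative fadd.
Proof. by move=> x y; apply: funext => n; rewrite /fadd addrC. Qed.
Fact fadd0 : left_id fzero fadd.
Proof. by move=> x; apply: funext => n; rewrite /fadd add0r. Qed.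
Fact faddN : left_inverse fzero fopp fadd.
Proof. by move=> x; apply: funext => n; rewrite /fadd addNr. Qed.
HB.instance Definition _ := GRing.isZmodule.Build (fps A) faddA faddC fadd0 faddN.

(** Truncation to polynomials makes associativity of the product a consequence of that of
    [{poly A}]. *)
Definition ftrunc N x : {poly A} := \poly_(i < N) x i.

Lemma coef_ftrunc_mul N x y n : (n < N)%N ->
  (ftrunc N x * ftrunc N y)`_n = fmul x y n.
Proof.
move=> nN; rewrite coefM; apply: eq_bigr => i _; rewrite !coef_poly.
by rewrite (leq_ltn_trans (leq_ord i) nN) (leq_ltn_trans (leq_subr _ _) nN).
Qed.

Fact fmulA : associative fmul.
Proof.
move=> x y z; apply: funext => n.
transitivity ((ftrunc n.+1 x * (ftrunc n.+1 y * ftrunc n.+1 z))`_n).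
  rewrite coefM; apply: eq_bigr => i _; rewrite coef_ftrunc_mul ?coef_poly ?ltn_ord //.
  by rewrite ltnS leq_subr.
rewrite mulrA coefM; apply: eq_bigr => i _.
by rewrite coef_ftrunc_mul ?coef_poly ?ltn_ord // ltnS leq_subr.
Qed.
Fact fmul1 : left_id fone fmul.
Proof.
move=> x; apply: funext => n; rewrite /fmul /smul big_ord_recl /fone /sone mul1r subn0.
by rewrite big1 ?addr0 // => i _; rewrite mul0r.
Qed.
Fact fmulr1 : right_id fone fmul.
Proof.
move=> x; apply: funext => n; rewrite /fmul /smul big_ord_recr /fone /sone /= subnn mulr1.
by rewrite big1 ?add0r // => i _; rewrite subn_eq0 leqNgt ltn_ord mulr0.
Qed.
Fact fmulDl : left_distributive fmul fadd.
Proof.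
move=> x y z; apply: funext => n; rewrite /fmul /smul /fadd -big_split /=.
by apply: eq_bigr => i _; rewrite mulrDl.
Qed.
Fact fmulDr : right_distributive fmul fadd.
Proof.
move=> x y z; apply: funext => n; rewrite /fmul /smul /fadd -big_split /=.
by apply: eq_bigr => i _; rewrite mulrDr.
Qed.
Fact fone_neq0 : fone != fzero.
Proof. by apply/eqP => /(congr1 (@^~ 0%N)) /eqP; rewrite oner_eq0. Qed.
HB.instance Definition _ :=
  GRing.Zmodule_isNzRing.Build (fps A) fmulA fmul1 fmulr1 fmulDl fmulDr fone_neq0.

Fact fscaleA (a b : F) x : fscale a (fscale b x) = fscale (a * b) x.
Proof. by apply: funext => n; rewrite /fscale scalerA. Qed.
Fact fscale1 : left_id 1 fscale.
Proof. by move=> x; apply: funext => n; rewrite /fscale scale1r. Qed.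
Fact fscaleDr : right_distributive fscale +%R.
Proof. by move=> a x y; apply: funext => n; rewrite /fscale scalerDr. Qed.
Fact fscaleDl x : {morph fscale^~ x : a b / a + b}.
Proof. by move=> a b; apply: funext => n; rewrite /fscale scalerDl. Qed.
HB.instance Definition _ :=
  GRing.Zmodule_isLmodule.Build F (fps A) fscaleA fscale1 fscaleDr fscaleDl.
Fact fscaleAl (a : F) x y : a *: (x * y) = a *: x * y.
Proof.
apply: funext => n; rewrite /GRing.scale /= /fscale /GRing.mul /= /fmul /smul.
by rewrite scaler_sumr; apply: eq_bigr => i _; rewrite scalerAl.
Qed.
HB.instance Definition _ := GRing.Lmodule_isLalgebra.Build F (fps A) fscaleAl.
Fact fscaleAr (a : F) x y : a *: (x * y) = x * (a *: y).
Proof.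
apply: funext => n; rewrite /GRing.scale /= /fscale /GRing.mul /= /fmul /smul.
by rewrite scaler_sumr; apply: eq_bigr => i _; rewrite scalerAr.
Qed.
HB.instance Definition _ := GRing.Lalgebra_isAlgebra.Build F (fps A) fscaleAr.

Lemma fpsP x y : (forall n, x n = y n) -> x = y.
Proof. exact: funext. Qed.
Lemma fpsD x y n : (x + y) n = x n + y n. Proof. by []. Qed.
Lemma fpsN x n : (- x) n = - x n. Proof. by []. Qed.
Lemma fpsB x y n : (x - y) n = x n - y n. Proof. by []. Qed.
Lemma fps0 n : (0 : fps A) n = 0. Proof. by []. Qed.
Lemma fps1 n : (1 : fps A) n = (n == 0%N)%:R. Proof. by []. Qed.
Lemma fpsZ (a : F) x n : (a *: x) n = a *: x n. Proof. by []. Qed.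
Lemma fpsM x y n : (x * y) n = \sum_(i < n.+1) x i * y (n - i)%N. Proof. by []. Qed.
Lemma fpsMn x m n : (x *+ m) n = x n *+ m.
Proof. by elim: m => [|m IH]; rewrite ?mulr0n // !mulrS fpsD IH. Qed.
Lemma fps_sum I (r : seq I) (P : pred I) (f : I -> fps A) n :
  (\sum_(i <- r | P i) f i) n = \sum_(i <- r | P i) f i n.
Proof. by elim/big_rec2: _ => // i a b _ <-. Qed.

Lemma fpsM0 x y : (x * y) 0%N = x 0%N * y 0%N.
Proof. by rewrite fpsM big_ord_recl big_ord0 addr0. Qed.

(** Multiplication by such a series is unitriangular on coefficients, so the coefficients of the
    other factor are recovered one after the other. *)
Lemma lreg_fps x : x 0%N = 1 -> GRing.lreg x.
Proof.
move=> x0; apply: mulrI0_lreg => y xy; apply: fpsP => n.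
elim/ltn_ind: n => n IH; have := congr1 (@^~ n) xy.
rewrite fpsM big_ord_recl x0 mul1r subn0 big1 ?addr0 // => i _.
by rewrite IH ?mulr0 // lift0 ltn_subrL; case: n i {IH} => [[]|].
Qed.

Lemma rreg_fps x : x 0%N = 1 -> GRing.rreg x.
Proof.
move=> x0; apply: mulIr0_rreg => y xy; apply: fpsP => n.
elim/ltn_ind: n => n IH; have := congr1 (@^~ n) xy.
rewrite fpsM big_ord_recr /= subnn x0 mulr1 big1 ?add0r // => i _.
by rewrite IH ?mul0r.
Qed.

Lemma fps_inv_comm x y : x 0%N = 1 -> x * y = 1 -> y * x = 1.
Proof. by move=> x0 xy; apply: (lreg_fps x0); rewrite mulrA xy mul1r mulr1. Qed.

Definition fX : fps A := fun n => (n == 1%N)%:R.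

Lemma fXM x n : (fX * x) n = if n is m.+1 then x m else 0.
Proof.
rewrite fpsM; case: n => [|n]; first by rewrite big_ord_recl big_ord0 mul0r addr0.
rewrite big_ord_recl mul0r add0r big_ord_recl mul1r subSS subn0 big1 ?addr0 //.
by move=> i _; rewrite mul0r.
Qed.
Lemma fMX x n : (x * fX) n = if n is m.+1 then x m else 0.
Proof.
rewrite fpsM; case: n => [|n].
  by rewrite big_ord_recl big_ord0 mulr0 addr0.
rewrite big_ord_recr /= subnn mulr0 addr0 big_ord_recr /= subSnn mulr1.
rewrite big1 ?add0r // => i _; rewrite /fX /= subSn 1?ltnW //.
by rewrite eqSS subn_eq0 leqNgt ltn_ord mulr0.
Qed.
Lemma fX_central : central fX.
Proof. by move=> x; apply: fpsP => n; rewrite fXM fMX. Qed.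
Lemma fX_lreg : GRing.lreg fX.
Proof.
apply: mulrI0_lreg => x xx; apply: fpsP => n.
by have := congr1 (@^~ n.+1) xx; rewrite fXM.
Qed.
End FpsRing.

Section Maps.
Variables (F : fieldType) (A : algType F).

Definition cst (a : A) : fps A := fun n => if n is 0%N then a else 0.

Lemma cstM_coef a (x : fps A) n : (cst a * x) n = a * x n.
Proof.
rewrite fpsM big_ord_recl subn0 big1 ?addr0 // => i _; exact: mul0r.
Qed.
Lemma Mcst_coef a (x : fps A) n : (x * cst a) n = x n * a.
Proof.
rewrite fpsM big_ord_recr /= subnn big1 ?add0r // => i _.
by case E : (n - i)%N => [|m]; rewrite ?mulr0 //; move: (ltn_ord i); rewrite -subn_gt0 E.
Qed.

Fact cst_zmod : zmod_morphism cst.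
Proof. by move=> a b; apply: fpsP => [[|n]] //; rewrite fpsB /= subr0. Qed.
Fact cst_monoid : monoid_morphism cst.
Proof.
split; first by apply: fpsP => [[|n]].
by move=> a b; apply: fpsP => n; rewrite cstM_coef; case: n => [|n] //=; rewrite mulr0.
Qed.
HB.instance Definition _ := GRing.isZmodMorphism.Build A (fps A) cst cst_zmod.
HB.instance Definition _ := GRing.isMonoidMorphism.Build A (fps A) cst cst_monoid.


Lemma cst_scale (c : F) a : cst (c *: a) = c *: cst a.
Proof. by apply: fpsP => [[|n]] //; rewrite fpsZ /= scaler0. Qed.

Lemma cst_central a : central a -> central (cst a).
Proof. by move=> ca x; apply: fpsP => n; rewrite cstM_coef Mcst_coef. Qed.

Lemma lreg_cst a : GRing.lreg a -> GRing.lreg (cst a).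
Proof.
move=> ra; apply: mulrI0_lreg => x ax; apply: fpsP => n; apply: ra.
by have := congr1 (@^~ n) ax; rewrite cstM_coef mulr0.
Qed.
End Maps.

Section Fmap.
Variables (F : fieldType) (A B : algType F).

Definition fmap (g : A -> B) (x : fps A) : fps B := fun n => g (x n).

Variable g : {rmorphism A -> B}.
Fact fmap_zmod : zmod_morphism (fmap g).
Proof. by move=> x y; apply: fpsP => n; rewrite /fmap !fpsB rmorphB. Qed.
Fact fmap_monoid : monoid_morphism (fmap g).
Proof.
split; first by apply: fpsP => n; rewrite /fmap !fps1 rmorph_nat.
move=> x y; apply: fpsP => n; rewrite /fmap !fpsM rmorph_sum.
by apply: eq_bigr => i _; rewrite rmorphM.
Qed.
HB.instance Definition _ := GRing.isZmodMorphism.Build (fps A) (fps B) (fmap g) fmap_zmod.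
HB.instance Definition _ := GRing.isMonoidMorphism.Build (fps A) (fps B) (fmap g) fmap_monoid.

Lemma fmap_cst a : fmap g (cst a) = cst (g a).
Proof. by apply: fpsP => [[|n]]; rewrite /fmap //= rmorph0. Qed.
Lemma fmap_fX : fmap g (fX A) = fX B.
Proof. by apply: fpsP => n; rewrite /fmap /fX rmorph_nat. Qed.
End Fmap.

(** * The substitutions $u:=u+c$ and $v:=u+c$ *)

Section Shift.
Variables (F : fieldType) (A : algType F).
Implicit Types (c d : F) (x y : fps A).

(* [u^-1] after [u := u + c] *)
Definition shX c : fps A := fun n => if n is m.+1 then ((- c) ^+ m)%:A else 0.

(** This is $(1+c/u)\cdot(u+c)^{-1}=u^{-1}$. Centrality, powers and shifts of [shX] are all drawn
    from it. *)
Lemma shX_eq c : (1 + c *: fX A) * shX c = fX A.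
Proof.
apply: fpsP => n; rewrite mulrDl mul1r -scalerAl fpsD fpsZ fXM.
case: n => [|[|n]] /=; rewrite ?scaler0 ?addr0 ?expr0 ?scale1r //.
by rewrite exprS scalerA -scalerDl mulNr addNr scale0r.
Qed.

Lemma scaled_central c x : central x -> central (c *: x).
Proof. by move=> cx y; rewrite -scalerAl -scalerAr cx. Qed.

Lemma fX1_lreg c : GRing.lreg (1 + c *: fX A).
Proof. by apply: lreg_fps; rewrite fpsD fpsZ /fX /= scaler0 addr0. Qed.

Lemma central_add x y : central x -> central y -> central (x + y).
Proof. by move=> cx cy z; rewrite mulrDl mulrDr cx cy. Qed.

Lemma fX1_central c : central (1 + c *: fX A).
Proof. exact: central_add (@central1 _) (scaled_central c (@fX_central _ A)). Qed.

Lemma shX_central c : central (shX c).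
Proof.
move=> x; apply: (@fX1_lreg c); rewrite mulrA shX_eq mulrA (fX1_central c x).
by rewrite -mulrA shX_eq fX_central.
Qed.

Lemma exp_low x k n : x 0%N = 0 -> (n < k)%N -> (x ^+ k) n = 0.
Proof.
move=> x0; elim: k n => [//|k IHk] n nk.
rewrite exprS fpsM big1 // => [[[|i] Hi]] _ /=; first by rewrite x0 mul0r.
by rewrite IHk ?mulr0 //; lia.
Qed.

(** By [shX_eq], coefficient $n+1$ of the power $r+1$ comes from coefficients $n$ of the powers $r$
    and $r+1$. This is Pascal's rule with signs, hence the binomials in [sshift]. *)
Lemma shX_pow c r n : (r <= n)%N ->
  (shX c ^+ r) n = ((- c) ^+ (n - r) * 'C(n.-1, n - r)%:R)%:A.
Proof.
elim: r n => [|r IHr] n rn.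
  rewrite expr0 fps1 subn0; case: n {rn} => [|n] /=; first by rewrite bin0 mulr1 scale1r.
  by rewrite bin_small // mulr0 scale0r.
have E : shX c ^+ r.+1 = fX A * shX c ^+ r - c *: (fX A * shX c ^+ r.+1).
  apply/eqP; rewrite eq_sym subr_eq; apply/eqP.
  by rewrite -[in LHS](shX_eq c) -mulrA -exprS mulrDl mul1r scalerAl.
elim: n rn => [//|n IHn] rn; rewrite E fpsB fpsZ !fXM IHr //= subSS.
move: rn; rewrite ltnS leq_eqVlt => /orP [/eqP <-|rn].
  by rewrite subnn !bin0 !mulr1 expr0 scale1r (exp_low (k := r.+1)) // scaler0 subr0.
rewrite IHn // scalerA -scalerBl; congr (_ *: _).
have [m ->] : exists m, n = (r + m.+1)%N by exists (n - r.+1)%N; lia.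
rewrite addKn (_ : (r + m.+1 - r.+1)%N = m); last by lia.
rewrite addnS /= binS natrD mulrDr exprS mulNr !mulrA; move: (_ ^+ m) => z.
by rewrite !mulNr -!mulrA; ring.
Qed.

Lemma sshift_coef c x n : sshift c x n = \sum_(r < n.+1) x r * (shX c ^+ r) n.
Proof.
apply: eq_bigr => r _; rewrite shX_pow ?leq_ord //.
by rewrite -scalerAr mulr1.
Qed.
End Shift.

Section Eval.
Variables (F : fieldType) (A : algType F) (c : F).
Implicit Types g h : fps (fps A).

(* substitution [v := u + c] in a series in [u] and [v] *)
Definition ev g : fps A := fun n => \sum_(q < n.+1) (g q * shX A c ^+ q) n.

(** Since [shX] has no constant term, coefficient $n$ of the value sees only the first $n+1$
    coefficients. Substitution into a power series thus reduces to evaluating a polynomial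
    truncation. *)
Lemma horner_shX (P Q : {poly fps A}) n : (forall i, (i <= n)%N -> P`_i = Q`_i) ->
  P.[shX A c] n = Q.[shX A c] n.
Proof.
move=> PQ; pose N := maxn (size P) (size Q).
rewrite (@horner_coef_wide _ N P) ?leq_maxl // (@horner_coef_wide _ N Q) ?leq_maxr //.
rewrite !fps_sum; apply: eq_bigr => i _.
have [/PQ -> //|ni] := leqP i n.
have H (x : fps A) : (x * shX A c ^+ i) n = 0.
  rewrite fpsM big1 // => j _; rewrite exp_low ?mulr0 //.
  exact: leq_ltn_trans (leq_subr _ _) ni.
by rewrite !H.
Qed.

Lemma evE g n N : (n < N)%N -> ev g n = (ftrunc N g).[shX A c] n.
Proof.
move=> nN; rewrite (@horner_shX _ (ftrunc n.+1 g)); last first.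
  by move=> i ni; rewrite !coef_poly ltnS ni (leq_ltn_trans ni nN).
rewrite (@horner_coef_wide _ n.+1) ?size_poly // fps_sum.
by apply: eq_bigr => i _; rewrite coef_poly ltn_ord.
Qed.

Fact ev_zmod : zmod_morphism ev.
Proof.
move=> g h; apply: fpsP => n; rewrite fpsB /ev -sumrB.
by apply: eq_bigr => i _; rewrite fpsB mulrBl fpsB.
Qed.

Fact ev_monoid : monoid_morphism ev.
Proof.
split.
  apply: fpsP => n; rewrite /ev big_ord_recl expr0 mulr1 big1 ?addr0 // => i _.
  by rewrite fps1 mul0r.
move=> g h; apply: fpsP => n.
rewrite (@evE _ n n.+1) // (@horner_shX _ (ftrunc n.+1 g * ftrunc n.+1 h)); last first.
  by move=> i ni; rewrite coef_ftrunc_mul ?ltnS // coef_poly ltnS ni.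
rewrite hornerM_comm; last first.
  by apply: commr_horner => // i; rewrite /GRing.comm shX_central.
rewrite fpsM; apply: eq_bigr => i _.
by rewrite -!evE ?ltn_ord // ltnS leq_subr.
Qed.
HB.instance Definition _ := GRing.isZmodMorphism.Build (fps (fps A)) (fps A) ev ev_zmod.
HB.instance Definition _ := GRing.isMonoidMorphism.Build (fps (fps A)) (fps A) ev ev_monoid.

Lemma ev_cst x : ev (cst x) = x.
Proof.
apply: fpsP => n; rewrite /ev big_ord_recl expr0 mulr1 big1 ?addr0 // => i _.
by rewrite mul0r.
Qed.

Lemma ev_fX : ev (fX (fps A)) = shX A c.
Proof.
apply: fpsP => n; rewrite /ev big_ord_recl mul0r add0r.
case: n => [|n]; first by rewrite big_ord0.
rewrite big_ord_recl expr1 mul1r big1 ?addr0 // => i _.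
by rewrite mul0r.
Qed.

Lemma ev_scale a g : ev (a *: g) = a *: ev g.
Proof.
apply: fpsP => n; rewrite fpsZ /ev scaler_sumr.
by apply: eq_bigr => i _; rewrite fpsZ -scalerAl fpsZ.
Qed.
End Eval.

Section SshiftMorphism.
Variables (F : fieldType) (A : algType F).
Implicit Types (c d : F) (x y : fps A).

(** The shift is the substitution $v:=u+c$ in $x(v)$, so it inherits multiplicativity from [ev]. *)
Lemma sshift_ev c x : sshift c x = ev c (fmap (@cst _ A) x).
Proof.
apply: fpsP => n; rewrite sshift_coef; apply: eq_bigr => i _.
by rewrite cstM_coef.
Qed.

Fact sshift_zmod c : zmod_morphism (sshift c : fps A -> fps A).
Proof. by move=> x y; rewrite !sshift_ev !rmorphB. Qed.
Fact sshift_monoid c : monoid_morphism (sshift c : fps A -> fps A).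
Proof. by split => [|x y]; rewrite !sshift_ev ?rmorph1 // !rmorphM. Qed.
Definition fshift c : fps A -> fps A := sshift c.
HB.instance Definition _ c := GRing.isZmodMorphism.Build (fps A) (fps A) (fshift c) (sshift_zmod c).
HB.instance Definition _ c := GRing.isMonoidMorphism.Build (fps A) (fps A) (fshift c) (sshift_monoid c).

Lemma fshift_scale c a x : fshift c (a *: x) = a *: fshift c x.
Proof.
apply: fpsP => n; rewrite fpsZ /fshift !sshift_coef scaler_sumr.
by apply: eq_bigr => i _; rewrite fpsZ scalerAl.
Qed.
Lemma fshift_fX c : fshift c (fX A) = shX A c.
Proof. by rewrite /fshift sshift_ev fmap_fX ev_fX. Qed.
Lemma fshift_cst c a : fshift c (cst a) = cst a.
Proof. by rewrite /fshift sshift_ev fmap_cst ev_cst. Qed.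

Lemma fshift0 c x : fshift c x 0%N = x 0%N.
Proof. by rewrite /fshift sshift_coef big_ord_recl big_ord0 addr0 expr0 mulr1. Qed.

Lemma fshift_shX c d : fshift c (shX A d) = shX A (c + d).
Proof.
have H1 : (1 + d *: shX A c) * fshift c (shX A d) = shX A c.
  have := congr1 (fshift c) (shX_eq A d).
  by rewrite rmorphM rmorphD rmorph1 /= fshift_scale fshift_fX.
apply: (@fX1_lreg _ _ (c + d)); rewrite shX_eq -{2}(shX_eq A c) -H1 mulrA.
congr (_ * _); rewrite mulrDr mulr1 -scalerAr shX_eq scalerDl addrA //.
Qed.

Lemma fshiftD c d x : fshift c (fshift d x) = fshift (c + d) x.
Proof.
apply: fpsP => n; rewrite /fshift (sshift_coef (c + d)) sshift_coef.
transitivity (\sum_(r < n.+1) \sum_(q < n.+1) x q * ((shX A d ^+ q) r * (shX A c ^+ r) n)).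
  apply: eq_bigr => r _; rewrite sshift_coef big_distrl /=.
  rewrite (big_ord_widen_cond n.+1 (fun=> true) (fun q => x q * (shX A d ^+ q) r * (shX A c ^+ r) n)) ?ltn_ord //.
  rewrite big_mkcond; apply: eq_bigr => q _ /=.
  case: ltnP => qr; first by rewrite mulrA.
  by rewrite exp_low ?mul0r ?mulr0.
rewrite exchange_big /=; apply: eq_bigr => q _; rewrite -mulr_sumr; congr (_ * _).
by rewrite -sshift_coef -[sshift c _]/(fshift c _) rmorphXn /= fshift_shX.
Qed.

Lemma fshift_0 x : fshift 0 x = x.
Proof.
apply: fpsP => n; rewrite /fshift /sshift big_ord_recr /= subnn bin0 expr0 mulr1 scale1r.
rewrite big1 ?add0r // => i _; rewrite oppr0 expr0n subn_eq0 leqNgt ltn_ord /=.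
by rewrite mul0r scale0r.
Qed.

Lemma fshiftK c x : fshift (- c) (fshift c x) = x.
Proof. by rewrite fshiftD addNr fshift_0. Qed.

(** In $x(u+c)-x(u)$ the coefficient of $u^{-n-2}$ is $-c(n+1)x_{n+1}$ plus terms in
    $x_1,\dots,x_n$; these vanish by induction, and $c(n+1)$ is invertible in characteristic 0. *)
Lemma fshift_fix c x : [pchar F] =i pred0 -> c != 0 -> fshift c x = x ->
  x = cst (x 0%N).
Proof.
move=> F0 c0 xx; apply: fpsP => n; elim/ltn_ind: n => [[|n]] IH //=.
have := congr1 (@^~ n.+2) xx; rewrite /fshift /sshift.
rewrite big_ord_recr /= subnn bin0 expr0 mulr1 scale1r -[RHS]add0r => /addIr.
rewrite big_ord_recr /= subSnn bin1 expr1 big1 => [|[[|i] Hi] _] /=; last first.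
- by rewrite (IH i.+1) ?scaler0.
- by rewrite bin_small // mulr0 scale0r.
move/eqP; rewrite add0r scaler_eq0 mulf_eq0 oppr_eq0 (negPf c0) /=.
by case/orP => [/natf0_pchar [] // p|/eqP //]; rewrite F0.
Qed.
End SshiftMorphism.

(* A series in [u^-1], [v^-1] is a series in [v^-1] over [fps A]; [iu x] and *)
(* [iv x] are [x(u)] and [x(v)].                                             *)
Notation iu := (@cst _ _).
Notation iv := (fmap (@cst _ _)).

(** * Series in two variables *)

Section TwoVar.
Variables (F : fieldType) (A : algType F).
Implicit Types (x y : fps A) (g h : fps (fps A)).

(* [fW = (u - v) / (u v)] and [fp = 1 / (2 u v)], so that a relation which is *)
(* homogeneous in [w, p] encodes one with [w = 2 (u - v)], [p = 1].           *)
Fact uv_key : unit. Proof. exact: tt. Qed.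
Definition fW : fps (fps A) := locked_with uv_key (fX (fps A) - iu (fX A)).
Definition fp : fps (fps A) :=
  locked_with uv_key ((2%:R : F)^-1 *: (iu (fX A) * fX (fps A))).
Lemma fW_def : fW = fX (fps A) - iu (fX A). Proof. by rewrite /fW unlock. Qed.
Lemma fp_def : fp = (2%:R : F)^-1 *: (iu (fX A) * fX (fps A)).
Proof. by rewrite /fp unlock. Qed.

Lemma fW_central : central fW.
Proof.
rewrite fW_def => g; rewrite mulrBl mulrBr fX_central; congr (_ - _).
exact: cst_central (@fX_central _ A) g.
Qed.
Lemma fp_central : central fp.
Proof.
rewrite fp_def; apply: scaled_central => g.
by rewrite -mulrA fX_central mulrA (cst_central (@fX_central _ A)) -mulrA.
Qed.

Lemma fWM_coef g n m : (fW * g) n m =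
  (if n is n'.+1 then g n' m else 0) - (if m is m'.+1 then g n m' else 0).
Proof.
rewrite fW_def mulrBl fpsB fpsB cstM_coef fXM fXM; congr (_ - _).
by case: n.
Qed.

Lemma fpM_coef g n m : (fp * g) n m =
  if n is n'.+1 then if m is m'.+1 then (2%:R : F)^-1 *: g n' m' else 0 else 0.
Proof.
rewrite fp_def -scalerAl -mulrA !fpsZ cstM_coef !fXM.
by case: n m => [|n] [|m]; rewrite ?fps0 ?scaler0.
Qed.

Lemma uv_coef x y n m : (iu x * iv y) n m = x m * y n.
Proof. by rewrite cstM_coef Mcst_coef. Qed.
Lemma vu_coef x y n m : (iv y * iu x) n m = y n * x m.
Proof. by rewrite Mcst_coef cstM_coef. Qed.
Lemma iu_coef x n m : iu x n m = if n is 0%N then x m else 0.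
Proof. by case: n. Qed.

Lemma iv_coef x n m : iv x n m = if m is 0%N then x n else 0.
Proof. by case: m. Qed.


(** Once the lower powers of $v^{-1}$ in [g] are known to vanish, [fW + c *: fp] acts on the next
    one as multiplication by $-u^{-1}$. *)
Lemma fWp_lreg (c : F) : GRing.lreg (fW + c *: fp).
Proof.
apply: mulrI0_lreg => g g0; apply: fpsP => n.
have H m : (fW * g + c *: (fp * g)) n m = 0 by rewrite scalerAl -mulrDl g0.
elim: n H => [|n IH] H; apply: fpsP => m.
  move: (H m.+1); rewrite fpsD fpsD !fpsZ fWM_coef fpM_coef sub0r scaler0 addr0.
  by move/eqP; rewrite oppr_eq0 => /eqP.
have Hn : g n = 0.
  apply: IH => k; rewrite -[X in X n k]/(_ + _).
  by rewrite scalerAl -mulrDl g0.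
move: (H m.+1); rewrite fpsD fpsD !fpsZ fWM_coef fpM_coef Hn fps0 !scaler0 addr0 sub0r.
by move/eqP; rewrite oppr_eq0 => /eqP.
Qed.

Lemma fW_lreg : GRing.lreg fW.
Proof. by have := @fWp_lreg 0; rewrite scale0r addr0. Qed.
Lemma fWpNn_lreg n : GRing.lreg (fW - fp *+ n).
Proof. by rewrite -scaler_nat -scaleNr; apply: fWp_lreg. Qed.

Hypothesis two0 : (2%:R : F) != 0.

Lemma scale_lreg (V : algType F) (c : F) (x : V) : c != 0 -> GRing.lreg x -> GRing.lreg (c *: x).
Proof.
move=> c0 xr; apply: mulrI0_lreg => y /eqP; rewrite -scalerAl scaler_eq0 (negPf c0) /=.
by move/eqP; rewrite -[RHS](mulr0 x) => /xr.
Qed.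


Lemma iuM x y : iu (x * y) = iu x * iu y. Proof. exact: rmorphM. Qed.
Lemma iuD x y : iu (x + y) = iu x + iu y. Proof. exact: rmorphD. Qed.
Lemma iuN x : iu (- x) = - iu x. Proof. exact: rmorphN. Qed.
Lemma iuMn x n : iu (x *+ n) = iu x *+ n. Proof. exact: rmorphMn. Qed.
Lemma iu1 : iu (1 : fps A) = 1. Proof. exact: rmorph1. Qed.
Lemma ivM x y : iv (x * y) = iv x * iv y. Proof. exact: rmorphM. Qed.
Lemma ivD x y : iv (x + y) = iv x + iv y. Proof. exact: rmorphD. Qed.
Lemma ivN x : iv (- x) = - iv x. Proof. exact: rmorphN. Qed.
Lemma ivMn x n : iv (x *+ n) = iv x *+ n. Proof. exact: rmorphMn. Qed.
Lemma iv1 : iv (1 : fps A) = 1. Proof. exact: rmorph1. Qed.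
Definition iuE := (iuM, iuD, iuN, iuMn, iu1).
Definition ivE := (ivM, ivD, ivN, ivMn, iv1).

Section EvalShift.
Variable c : F.

Lemma ev_iu x : ev c (iu x) = x. Proof. exact: ev_cst. Qed.
Lemma ev_iv x : ev c (iv x) = fshift c x. Proof. by rewrite /fshift sshift_ev. Qed.

Lemma shX_lreg : GRing.lreg (shX A c).
Proof. by apply: (@GRing.lregMl _ (1 + c *: fX A)); rewrite shX_eq; apply: fX_lreg. Qed.

Lemma ev_fp : ev c fp = (2%:R : F)^-1 *: (fX A * shX A c).
Proof. by rewrite fp_def ev_scale rmorphM /= ev_iu ev_fX. Qed.

Lemma ev_fp_lreg : GRing.lreg (ev c fp).
Proof.
rewrite ev_fp; apply: scale_lreg; rewrite ?invr_eq0 //.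
exact: lregM (@fX_lreg _ A) shX_lreg.
Qed.

Lemma ev_fp_central : central (ev c fp).
Proof.
rewrite ev_fp; apply: scaled_central => x.
by rewrite -mulrA shX_central mulrA fX_central -mulrA.
Qed.

(** At $v=u+c$ the ratio $2(u-v):1$ becomes $-2c:1$. At $c=0,-\frac12,-1,1$ the value of [fW] is
    thus $0$, $1$, $2$, $-2$ times that of [fp], which is how special relations between one-variable
    series are extracted. *)
Lemma ev_fW : ev c fW = - (2%:R * c) *: ev c fp.
Proof.
rewrite ev_fp scalerA mulNr mulrAC divff // mul1r scaleNr.
rewrite fW_def rmorphB /= ev_iu ev_fX -[in X in _ - X](shX_eq A c) mulrDl mul1r opprD.
by rewrite addrA subrr add0r -scalerAl.
Qed.

Let qu : fps (fps A) := iu (1 + c *: fX A).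
Let qv : fps (fps A) := 1 + c *: fX (fps A).

Lemma half_double (g : fps (fps A)) : (2%:R * c) *: ((2%:R : F)^-1 *: g) = c *: g.
Proof. by rewrite scalerA mulrAC divff // mul1r. Qed.

(** The factor [qu], that is $(u+c)/u$, restores the denominator $uv$ after $u:=u+c$; up to it, the
    shift replaces $2(u-v)$ by $2(u-v)+2c$ and fixes [fp]. The factor [qv] does the same for
    $v:=v+c$. *)
Lemma shu_fW : qu * fmap (fshift c) fW = fW + (2%:R * c) *: fp.
Proof.
rewrite fW_def rmorphB /= fmap_fX fmap_cst /= fshift_fX mulrBr -rmorphM shX_eq.
rewrite fp_def /qu rmorphD rmorph1 /= mulrDl mul1r cst_scale half_double -scalerAl.
by rewrite addrAC.
Qed.
Lemma shu_fp : qu * fmap (fshift c) fp = fp.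
Proof.
rewrite fp_def.
have -> : fmap (fshift c) ((2%:R : F)^-1 *: (iu (fX A) * fX (fps A))) = (2%:R : F)^-1 *: fmap (fshift c) (iu (fX A) * fX (fps A)).
  by apply: fpsP => n; rewrite fpsZ /fmap fshift_scale.
rewrite rmorphM /= fmap_fX fmap_cst /= fshift_fX -scalerAr mulrA -rmorphM shX_eq.
by [].
Qed.
Lemma shv_fW : qv * fshift c fW = fW - (2%:R * c) *: fp.
Proof.
rewrite fW_def fp_def rmorphB /= fshift_fX fshift_cst mulrBr shX_eq /qv.
by rewrite mulrDl mul1r half_double -scalerAl (fX_central (iu (fX A))) opprD addrA.
Qed.
Lemma shv_fp : qv * fshift c fp = fp.
Proof.
rewrite fp_def fshift_scale rmorphM /= fshift_fX fshift_cst -scalerAr mulrA.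
by rewrite (fX1_central c (iu (fX A))) -mulrA shX_eq.
Qed.
Lemma shu_iu x : fmap (fshift c) (iu x) = iu (fshift c x).
Proof. exact: fmap_cst. Qed.
Lemma shu_iv x : fmap (fshift c) (iv x) = iv x.
Proof. by apply: fpsP => n; rewrite /fmap fshift_cst. Qed.
Lemma shv_iu x : fshift c (iu x) = iu x.
Proof. exact: fshift_cst. Qed.
Lemma shv_iv x : fshift c (iv x) = iv (fshift c x).
Proof.
apply: fpsP => n; rewrite /fmap /fshift /sshift raddf_sum.
by apply: eq_bigr => r _; rewrite /= cst_scale.
Qed.
Lemma qv_central : central qv.
Proof. exact: fX1_central. Qed.
End EvalShift.
End TwoVar.

(** * The defect of the RTT relation *)

Lemma I3P (a : 'I_3) : [\/ a = im1, a = i0 | a = ip1].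
Proof.
by case: a => [[|[|[|//]]] Ha];
  [apply: Or31 | apply: Or32 | apply: Or33]; apply: val_inj.
Qed.

Ltac case_I3 a := case: (I3P a) => ->.

Section LowerRaise.
Variable V : zmodType.
Implicit Types (g : 'I_3 -> V) (a : 'I_3).
(* The action of [x^-_0] and [x^+_0] on the basis of [C^3]. *)
Definition lowI g a : V :=
  match val a with 0%N => 0 | 1%N => g im1 | _ => - g i0 end.
Definition raiseI g a : V :=
  match val a with 0%N => g i0 | 1%N => - g ip1 | _ => 0 end.
End LowerRaise.

(* Entry [(a, b), (c, d)] of [R(u - v) T_1(u) T_2(v) - T_2(v) T_1(u) R(u - v)],  *)
(* multiplied by the denominator of [R], where [w : p = 2 (u - v) : 1].      *)
Section RttDefect.
Variables (S : pzRingType) (w p : S).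
Implicit Types T : 'I_3 -> 'I_3 -> S.

Definition rtt_defect T T' (a b c d : 'I_3) : S :=
  w * (w - p) * (T a c * T' b d - T' b d * T a c)
  - p * (w - p) * (T b c * T' a d - T' b c * T a d) *+ 2
  + (if (a + b == 2)%N
     then p * w * (T im1 c * T' ip1 d + T i0 c * T' i0 d + T ip1 c * T' im1 d) *+ 2 else 0)
  - (if (c + d == 2)%N
     then p * w * (T' b im1 * T a ip1 + T' b i0 * T a i0 + T' b ip1 * T a im1) *+ 2 else 0).

(** Equivariance of $T$ under the zero mode $x^-_0$: rows carry the lowering operator, columns the
    dual action. [equivF] is the same for $x^+_0$. *)
Definition equivE (z : S) T := forall a c,
  z * T a c - T a c * z = lowI (T^~ c) a - raiseI (T a) c.
Definition equivF (z : S) T := forall a c,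
  z * T a c - T a c * z = raiseI (T^~ c) a - lowI (T a) c.

Hypotheses (cw : central w) (cp : central p).

(** Commutation with [z] is a derivation and the defect is bilinear in [T], [T'] with central
    coefficients, so [z] acts through its commutators with the entries. What remains is that $P$ and
    $Q$ commute with $\mathfrak{sl}_2$, checked entry by entry. *)
Lemma rtt_defect_equivE z T T' : equivE z T -> equivE z T' -> forall a b c d,
  z * rtt_defect T T' a b c d - rtt_defect T T' a b c d * z =
  lowI (fun x => rtt_defect T T' x b c d) a + lowI (fun x => rtt_defect T T' a x c d) b
  - raiseI (fun x => rtt_defect T T' a b x d) c - raiseI (fun x => rtt_defect T T' a b c x) d.
Proof.
move=> eT eT' a b c d.
pose C (U : 'I_3 -> 'I_3 -> S) a c := z * U a c - U a c * z.
pose X (U : 'I_3 -> 'I_3 -> S) a c := lowI (U^~ c) a - raiseI (U a) c.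
transitivity (rtt_defect (X T) T' a b c d + rtt_defect T (X T') a b c d).
  rewrite {1 2}/rtt_defect; transitivity (rtt_defect (C T) T' a b c d + rtt_defect T (C T') a b c d).
    rewrite /rtt_defect /C; case: ifP => _; case: ifP => _; nc cw cp.
  by rewrite /rtt_defect /C /X !eT !eT'.
case_I3 a; case_I3 b; case_I3 c; case_I3 d; rewrite /X /rtt_defect /lowI /raiseI /=.
all: nc cw cp.
Qed.
End RttDefect.

(** * Transposition and the opposite ring *)

Section Converse.
Variables (S : pzRingType).

Lemma converseM (x y : S^c) : x * y = (y : S) * (x : S) :> S.
Proof. by []. Qed.

Lemma central_converse (z : S) : central z -> central (z : S^c).
Proof. by move=> cz x; rewrite !converseM cz. Qed.

Variables (w p : S).
Hypotheses (cw : central w) (cp : central p).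
Implicit Types T : 'I_3 -> 'I_3 -> S.

Definition opT T : 'I_3 -> 'I_3 -> S^c := fun a c => T c a.

(** Rows and columns exchange their roles in the opposite ring, so each result on $e$ and rows
    yields one on $f$ and columns. *)
Lemma rtt_defect_converse T T' a b c d :
  rtt_defect (w : S^c) (p : S^c) (opT T) (opT T') a b c d = - rtt_defect w p T T' c d a b.
Proof.
rewrite /rtt_defect /opT; case: ifP => _; case: ifP => _; rewrite ?converseM.
all: nc cw cp.
Qed.

Lemma equivE_converse z T : equivF z T -> equivE (z : S^c) (opT T).
Proof.
move=> H a c; rewrite !converseM -[LHS]opprB H opprB /opT.
by [].
Qed.
Lemma equivF_converse z T : equivE z T -> equivF (z : S^c) (opT T).
Proof.
by move=> H a c; rewrite !converseM -[LHS]opprB H opprB.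
Qed.
End Converse.

(** * Spreading zeros by $\mathfrak{sl}_2$-equivariance *)

Section Closure.
Variables (S : pzRingType).
Implicit Types g : 'I_3 -> 'I_3 -> S.

Lemma lowI0 (V : zmodType) (h : 'I_3 -> V) a : (forall x, h x = 0) -> lowI h a = 0.
Proof. by move=> h0; rewrite /lowI !h0; case_I3 a => /=; rewrite ?oppr0. Qed.

Lemma lowIN (V : zmodType) (h : 'I_3 -> V) a : lowI (fun x => - h x) a = - lowI h a.
Proof. by rewrite /lowI; case_I3 a => /=; rewrite ?oppr0 ?opprK. Qed.
Lemma raiseIN (V : zmodType) (h : 'I_3 -> V) a : raiseI (fun x => - h x) a = - raiseI h a.
Proof. by rewrite /raiseI; case_I3 a => /=; rewrite ?oppr0 ?opprK. Qed.

Definition col_equiv (z : S) g := forall c d,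
  z * g c d - g c d * z = - (raiseI (g^~ d) c + raiseI (g c) d).

(** A vanishing entry forces the sum of its two raised neighbours to vanish. The entries at
    $(-1,-1)$, $(-1,0)$ and $(0,0)$ are the seeds for $V_2$, $V_1$ and $V_0$; until the last is
    known, the entries of weight 0 all agree. *)
Lemma col_closure z g : col_equiv z g ->
  g im1 im1 = 0 -> g im1 i0 = 0 ->
  g i0 im1 = 0 /\ (g im1 ip1 = g i0 i0 /\ g ip1 im1 = g i0 i0)
  /\ (g i0 i0 = 0 -> forall c d, g c d = 0).
Proof.
move=> H g11 g12.
have K c d : g c d = 0 -> raiseI (g^~ d) c + raiseI (g c) d = 0.
  by move=> E; apply/eqP; rewrite -oppr_eq0 -H E mulr0 mul0r subr0.
have g21 : g i0 im1 = 0 by have := K _ _ g11; rewrite /raiseI /= g12 addr0.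
have g13 : g im1 ip1 = g i0 i0.
  by have /eqP := K _ _ g12; rewrite /raiseI /= subr_eq0 => /eqP.
have g31 : g ip1 im1 = g i0 i0.
  by have /eqP := K _ _ g21; rewrite /raiseI /= addrC subr_eq0 => /eqP.
split=> //; split=> // g22.
have g23 : g i0 ip1 = 0.
  by have := K im1 ip1; rewrite g13 => /(_ g22); rewrite /raiseI /= addr0.
have g32 : g ip1 i0 = 0.
  by have := K ip1 im1; rewrite g31 => /(_ g22); rewrite /raiseI /= add0r.
have g33 : g ip1 ip1 = 0.
  by have /eqP := K _ _ g23; rewrite /raiseI /= addr0 oppr_eq0 => /eqP.
move=> c d; case_I3 c; case_I3 d; rewrite ?g13 ?g31 //.
Qed.

Variables (w p : S).
Hypotheses (cw : central w) (cp : central p).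
Implicit Types T : 'I_3 -> 'I_3 -> S.

Lemma rtt_defect_equivF z T T' : equivF z T -> equivF z T' -> forall a b c d,
  z * rtt_defect w p T T' a b c d - rtt_defect w p T T' a b c d * z =
  raiseI (fun x => rtt_defect w p T T' x b c d) a
  + raiseI (fun x => rtt_defect w p T T' a x c d) b
  - lowI (fun x => rtt_defect w p T T' a b x d) c
  - lowI (fun x => rtt_defect w p T T' a b c x) d.
Proof.
move=> /equivE_converse eT /equivE_converse eT' a b c d.
have := rtt_defect_equivE (central_converse cw) (central_converse cp) eT eT' c d a b.
have E : rtt_defect (w : S^c) (p : S^c) (opT T) (opT T')
    = fun a b c d => - rtt_defect w p T T' c d a b.
  by do 4![apply: funext => ?]; rewrite rtt_defect_converse.
rewrite E !converseM !lowIN !raiseIN mulNr mulrN !opprK addrC => ->.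
by rewrite -[LHS]addrA addrC addrA.
Qed.

Section Rows.
Variables (T T' : 'I_3 -> 'I_3 -> S) (e f : S).
Hypotheses (eT : equivE e T) (eT' : equivE e T') (fT : equivF f T) (fT' : equivF f T').
Local Notation D := (rtt_defect w p T T').

Hypotheses (D1111 : D im1 im1 im1 im1 = 0) (D1112 : D im1 im1 im1 i0 = 0)
  (D1122 : D im1 im1 i0 i0 = 0).

Lemma rtt_row11 c d : D im1 im1 c d = 0.
Proof.
have H : col_equiv e (D im1 im1).
  move=> x y; rewrite (rtt_defect_equivE cw cp eT eT') /lowI /= !add0r.
  by rewrite opprD.
by have [_ [_]] := col_closure H D1111 D1112; apply.
Qed.

Lemma rtt_row12_21 c d : D i0 im1 c d = - D im1 i0 c d.
Proof.
have := rtt_defect_equivF fT fT' im1 im1 c d.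
rewrite rtt_row11 mulr0 mul0r subr0 (lowI0 _ (fun x => rtt_row11 x d)).
rewrite (lowI0 _ (rtt_row11 c)) !subr0 /raiseI /= => /esym/eqP.
by rewrite addr_eq0 => /eqP.
Qed.

(* [y] is the last column of the inverse of [T']. *)
Variables (y : 'I_3 -> S).
Hypothesis y_rreg : GRing.rreg (y ip1).
(** One entry of the defect multiplied on the right by $T_2(v)^{-1}$. When its first two terms
    vanish, regularity of [y ip1] kills the entry of the trivial column constituent. *)
Definition row_crossing b :=
  D im1 b im1 im1 * y im1 + D im1 b im1 i0 * y i0 + D im1 b im1 ip1 * y ip1 = 0.

Hypotheses (D1211 : D im1 i0 im1 im1 = 0) (D1212 : D im1 i0 im1 i0 = 0).

Lemma rtt_row12 c d : row_crossing i0 -> D im1 i0 c d = 0.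
Proof.
rewrite /row_crossing D1211 D1212 !mul0r !add0r => cr.
have H : col_equiv e (D im1 i0).
  move=> {c d cr} x z; rewrite (rtt_defect_equivE cw cp eT eT') /lowI /= rtt_row11 !add0r.
  by rewrite opprD.
have [_ [[E13 E31]]] := col_closure H D1211 D1212; apply.
by rewrite -E13; apply: y_rreg; rewrite cr mul0r.
Qed.

(** Each of the row pairs $(-1,-1)$, $(-1,0)$, $(-1,1)$, one for each of $V_2,V_1,V_0$, vanishes by
    [col_closure]; raising with $x^+_0$ then reaches the other six. *)
Lemma rtt_zero : row_crossing i0 -> row_crossing ip1 ->
  (forall a b, D a b im1 im1 = 0) -> (forall a b, D a b im1 i0 = 0) ->
  forall a b c d, D a b c d = 0.
Proof.
move=> cr2 cr3 C11 C12.
have R11 := rtt_row11; have R12 c d := rtt_row12 c d cr2.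
have R21 c d : D i0 im1 c d = 0 by rewrite rtt_row12_21 R12 oppr0.
have up a b : (forall c d, D a b c d = 0) ->
    forall c d, raiseI (fun x => D x b c d) a + raiseI (fun x => D a x c d) b = 0.
  move=> ab c d; have := rtt_defect_equivF fT fT' a b c d.
  rewrite ab mulr0 mul0r subr0 (lowI0 _ (fun x => ab x d)) (lowI0 _ (ab c)) !subr0.
  by move=> <-.
have R13 c d : D im1 ip1 c d = 0.
  have H : col_equiv e (D im1 ip1).
    move=> {c d} x z; rewrite (rtt_defect_equivE cw cp eT eT') /lowI /= R12 oppr0 !add0r.
    by rewrite opprD.
  have [_ [[E13 _]]] := col_closure H (C11 _ _) (C12 _ _); apply.
  rewrite -E13; apply: y_rreg; rewrite mul0r; move: cr3; rewrite /row_crossing.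
  by rewrite C11 C12 !mul0r !add0r.
have R22 c d : D i0 i0 c d = 0.
  by have := up _ _ R12 c d; rewrite /raiseI /= R13 oppr0 addr0.
have R31 c d : D ip1 im1 c d = 0.
  have := up _ _ R21 c d; rewrite /raiseI /= R22 addr0 => /eqP.
  by rewrite oppr_eq0 => /eqP.
have R23 c d : D i0 ip1 c d = 0 by have := up _ _ R13 c d; rewrite /raiseI /= addr0.
have R32 c d : D ip1 i0 c d = 0 by have := up _ _ R31 c d; rewrite /raiseI /= add0r.
have R33 c d : D ip1 ip1 c d = 0.
  have := up _ _ R23 c d; rewrite /raiseI /= addr0 => /eqP.
  by rewrite oppr_eq0 => /eqP.
by move=> a b c d; case_I3 a; case_I3 b; rewrite ?R11 ?R12 ?R21 ?R13 ?R22 ?R31 ?R23 ?R32 ?R33.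
Qed.
End Rows.
End Closure.

(** * Seed entries: first row, minor and crossing *)

Section FirstRow.
Variables (S : pzRingType) (w p : S).
Hypotheses (cw : central w) (cp : central p).
Implicit Types T : 'I_3 -> 'I_3 -> S.

(** Unprimed letters are taken at $u$, primed ones at $v$. The third relation is the second with $u$
    and $v$ exchanged; the last is $2(u-v)[e(u),e(v)]=(e(u)-e(v))^2$. *)
Definition row1_rel (k e k' e' : S) :=
  [/\ k * k' = k' * k,
      (w - p *+ 2) * k * e' = w * e' * k - p * k * e *+ 2,
      w * e * k' = (w + p *+ 2) * k' * e - p * k' * e' *+ 2
    & w * (e * e' - e' * e) = p * (e - e') * (e - e')].

Definition row1_of (k e : S) T :=
  [/\ T im1 im1 = k, T im1 i0 = k * e & T im1 ip1 *+ 2 = - (k * e * e)].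

Variables (k e k' e' : S) (T T' : 'I_3 -> 'I_3 -> S).
Hypotheses (rel : row1_rel k e k' e') (T1 : row1_of k e T) (T1' : row1_of k' e' T').
Local Notation D := (rtt_defect w p T T').

Lemma rtt_row1_1111 : D im1 im1 im1 im1 = 0.
Proof.
rewrite /rtt_defect /=; case: rel T1 T1' => kk _ _ _ [-> _ _] [-> _ _].
nc_by cw cp ((w * (w - p) - p * (w - p) *+ 2) * nc_gap kk).
Qed.

Lemma rtt_row1_1112 : D im1 im1 im1 i0 = 0.
Proof.
rewrite /rtt_defect /=; case: rel T1 T1' => kk ke _ _ [-> -> _] [-> -> _].
nc_by cw cp ((w - p) * (k' * nc_gap ke + (w - p *+ 2) * nc_gap kk * e')).
Qed.

Local Notation c := ((w - p *+ 2) * e' + p * e *+ 2).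
Lemma rtt_row1_1122 : GRing.lreg w -> D im1 im1 i0 i0 = 0.
Proof.
(* The relations exchange $e$ and $e'$ only up to the factor [w], so the goal is multiplied by
   it. *)
move=> rw; apply: rw; rewrite mulr0 /rtt_defect /=.
case: rel T1 T1' => kk ke ke' ee [-> -> t13] [-> -> t13'].
nc_by cw cp ((w - p) * (w - p *+ 2) * (k * nc_gap ke' * e' + k' * nc_gap ke * e)
  - p * w * w * (k' * nc_gap t13 + nc_gap t13' * k)
  - p * (w * k' * e' * nc_gap ke + k' * nc_gap ke * c) + p * w * k' * nc_gap ke * e *+ 2
  + (w - p) * (w - p *+ 2) * nc_gap kk * ((w + p *+ 2) * e - p * e' *+ 2) * e'
  + (w - p *+ 2) * w * k' * k * nc_gap ee).
Qed.
End FirstRow.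

Section MinorCrossing.
Variables (S : pzRingType) (w p : S).
Hypotheses (cw : central w) (cp : central p).
Variables (T T' : 'I_3 -> 'I_3 -> S).
Local Notation D := (rtt_defect w p T T').

(** After the Gauss expansion of [T' i0 i0] only commutations with [k] are left; no relation between
    $e$ and $f$ enters. *)
Lemma rtt_minor (k e f k' e' f' H' : S) :
  k * k' = k' * k -> k * H' = H' * k ->
  (w - p *+ 2) * k * e' = w * e' * k - p * k * e *+ 2 ->
  w * k * f' = (w - p *+ 2) * f' * k + p * f * k *+ 2 ->
  T im1 im1 = k -> T im1 i0 = k * e -> T i0 im1 = f * k ->
  T' im1 i0 = k' * e' -> T' i0 im1 = f' * k' ->
  T' i0 i0 = f' * k' * e' + k' * H' ->
  D im1 i0 im1 i0 = 0.
Proof.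
move=> kk kH ke kf t11 t12 t21 t12' t21' t22'.
rewrite /rtt_defect /= t11 t12 t21 t12' t21' t22'.
nc_by cw cp ((w - p) * (nc_gap kf * k' * e' + f' * k' * nc_gap ke
  + (w - p *+ 2) * f' * nc_gap kk * e' + w * (nc_gap kk * H' + k' * nc_gap kH))).
Qed.

Variables (y : 'I_3 -> S) (T'' : 'I_3 -> 'I_3 -> S).
Hypothesis Y : forall b,
  T' b im1 * y im1 + T' b i0 * y i0 + T' b ip1 * y ip1 = (b == ip1)%:R.
Hypothesis T''y : forall c, T'' im1 c = y (negI c).
Hypothesis D11 : forall c, rtt_defect (p - w) p T'' T im1 im1 c im1 = 0.

(* Crossing symmetry: multiplying [R T_1(u) T_2(v) - T_2(v) T_1(u) R] by       *)
(* [T_2(v)^-1] on both sides and transposing the second factor yields the same *)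
(* expression for [T(v + 1/2)] and [T(u)], as [T^t(v + 1/2) = T(v)^-1].        *)
Lemma rtt_crossing b : b != im1 -> row_crossing w p T T' y b.
Proof.
have n1 : negI im1 = ip1 by apply: val_inj.
have n2 : negI i0 = i0 by apply: val_inj.
have n3 : negI ip1 = im1 by apply: val_inj.
have Y1 := Y im1; have Y2 := Y i0; have Y3 := Y ip1.
have G1 := D11 im1; have G2 := D11 i0; have G3 := D11 ip1; move: Y1 Y2 Y3 G1 G2 G3.
rewrite /row_crossing /rtt_defect /= !T''y n1 n2 n3 => Y1 Y2 Y3 G1 G2 G3.
case_I3 b => // _ /=.
- nc_by cw cp (T' i0 im1 * nc_gap G3 + T' i0 i0 * nc_gap G2 + T' i0 ip1 * nc_gap G1
  + w * (w - p) * T im1 im1 * nc_gap Y2 - p * (w - p) * T i0 im1 * nc_gap Y1 *+ 2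
  - (w * (w - p) + p * w *+ 2) * nc_gap Y2 * T im1 im1).
- nc_by cw cp (T' ip1 im1 * nc_gap G3 + T' ip1 i0 * nc_gap G2 + T' ip1 ip1 * nc_gap G1
  + w * (w - p) * T im1 im1 * nc_gap Y3 - p * (w - p) * T ip1 im1 * nc_gap Y1 *+ 2
  - (w * (w - p) + p * w *+ 2) * nc_gap Y3 * T im1 im1
  + p * w * (T im1 im1 * nc_gap Y3 + T i0 im1 * nc_gap Y2 + T ip1 im1 * nc_gap Y1) *+ 2).
Qed.
End MinorCrossing.

(** * The Gauss decomposition of T *)

(* [T = F K E] with [K = diag(k, k H, H)]; [em], [fm] stand for [e(u - 1/2)],  *)
(* [f(u - 1/2)].                                                             *)
Definition gaussT (S : pzRingType) (k H e f em fm e13 f31 : S) (a c : 'I_3) : S :=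
  match val a, val c with
  | 0%N, 0%N => k
  | 0%N, 1%N => k * e
  | 0%N, _ => k * e13
  | 1%N, 0%N => f * k
  | 1%N, 1%N => f * k * e + k * H
  | 1%N, _ => f * k * e13 - k * H * em
  | _, 0%N => f31 * k
  | _, 1%N => f31 * k * e - fm * k * H
  | _, _ => f31 * k * e13 + fm * k * H * em + H
  end.

Section OneVariable.
Variable S : pzRingType.

(** Here [Hm] stands for $H(u-\frac12)$, so that [k] is its inverse. The relations for [em] and [fm]
    are the Drinfeld relations at $v=u-\frac12$. *)
Record shift_rel (k H Hm e f em fm e13 f31 : S) : Prop := ShiftRel {
  rel_kH : k * H = H * k;
  rel_Hmk : Hm * k = 1;
  rel_kHm : k * Hm = 1;
  rel_Hem : H * em *+ 2 = H * e + e * H;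
  rel_fmH : fm * H *+ 2 = f * H + H * f;
  rel_e13 : e13 *+ 2 = - (e * e);
  rel_f31 : f31 *+ 2 = - (f * f) }.

Record e0_rel (e0 k H Hm e f fm : S) : Prop := E0Rel {
  rel_e0k : e0 * k - k * e0 = - (k * e);
  rel_e0H : (e0 * H - H * e0) *+ 2 = H * e + e * H;
  rel_e0e : (e0 * e - e * e0) *+ 2 = e * e;
  rel_e0f : e0 * f - f * e0 = 1 - H;
  rel_e0fm : e0 * fm - fm * e0 = 1 - Hm }.

(** The Leibniz rule builds the commutators of [e0] with the products occurring in [gaussT]. Factors
    2 and 4 are cancelled because [e13], [f31], [em], [fm] are controlled only through their
    doubles. *)
Lemma gaussT_equivE e0 k H Hm e f em fm e13 f31 :
  (forall x : S, x *+ 2 = 0 -> x = 0) ->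
  shift_rel k H Hm e f em fm e13 f31 -> e0_rel e0 k H Hm e f fm ->
  equivE e0 (gaussT k H e f em fm e13 f31).
Proof.
move=> two_reg [kH Hmk kHm Hem fmH E13 F31] [e0k e0H e0e e0f e0fm].
have c1 := @central1 S.
have cancel2 (x y : S) : (x - y) *+ 2 = 0 -> x = y.
  by move/two_reg/eqP; rewrite subr_eq0 => /eqP.
have cancel4 (x y : S) : (x - y) *+ 4 = 0 -> x = y.
  by rewrite (mulrnA _ 2 2) => /two_reg /cancel2.
have e0ee : e0 * (e * e) - e * e * e0 = e * e * e.
  apply: cancel2; nc_by c1 c1 (nc_gap e0e * e + e * nc_gap e0e).
have e0e13 : (e0 * e13 - e13 * e0) *+ 2 = - (e * e * e).
  nc_by c1 c1 (e0 * nc_gap E13 - nc_gap E13 * e0 - nc_gap e0ee).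
have e0ke : e0 * (k * e) - k * e * e0 = k * e13.
  apply: cancel2; nc_by c1 c1 (nc_gap e0k * e *+ 2 + k * nc_gap e0e - k * nc_gap E13).
have e0ke13 : e0 * (k * e13) - k * e13 * e0 = 0.
  apply: cancel2.
  nc_by c1 c1 (nc_gap e0k * e13 *+ 2 + k * nc_gap e0e13 - k * e * nc_gap E13).
have e0kH : e0 * (k * H) - k * H * e0 = k * H * em - k * e * H.
  apply: cancel2; nc_by c1 c1 (nc_gap e0k * H *+ 2 + k * nc_gap e0H - k * nc_gap Hem).
have e0kHem : e0 * (k * H * em) - k * H * em * e0 = - (k * H * e13).
  apply: cancel4.
  nc_by c1 c1 (e0 * k * nc_gap Hem *+ 2 - k * nc_gap Hem * e0 *+ 2
    + nc_gap e0k * (H * e + e * H) *+ 2 + k * nc_gap e0H * e + k * H * nc_gap e0e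
    + k * nc_gap e0e * H + k * e * nc_gap e0H + k * H * nc_gap E13 *+ 2).
have e0f31 : (e0 * f31 - f31 * e0) *+ 2 = H * f + f * H - f *+ 2.
  nc_by c1 c1 (e0 * nc_gap F31 - nc_gap F31 * e0 - nc_gap e0f * f - f * nc_gap e0f).
have e0f31k : e0 * (f31 * k) - f31 * k * e0 = - (f * k) - f31 * k * e + fm * k * H.
  apply: cancel2.
  nc_by c1 c1 (nc_gap e0f31 * k + f31 * nc_gap e0k *+ 2 - nc_gap fmH * k - fm * nc_gap kH *+ 2).
have e0fmkH : e0 * (fm * k * H) - fm * k * H * e0 = k * H - H + fm * (k * H * em - k * e * H).
  nc_by c1 c1 (nc_gap e0fm * k * H + fm * nc_gap e0kH - nc_gap Hmk * H).
move=> a c; rewrite /gaussT /lowI /raiseI; case_I3 a; case_I3 c => /=.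
- nc_by c1 c1 (nc_gap e0k).
- nc_by c1 c1 (nc_gap e0ke).
- nc_by c1 c1 (nc_gap e0ke13).
- nc_by c1 c1 (nc_gap e0f * k + f * nc_gap e0k + nc_gap kH).
- nc_by c1 c1 (nc_gap e0f * k * e + f * nc_gap e0ke + nc_gap e0kH + nc_gap kH * e
    + k * nc_gap Hem).
- nc_by c1 c1 (nc_gap e0f * k * e13 + f * nc_gap e0ke13 - nc_gap e0kHem + nc_gap kH * e13).
- nc_by c1 c1 (nc_gap e0f31k).
- apply: cancel2.
  nc_by c1 c1 (nc_gap e0f31 * k * e + f31 * nc_gap e0ke *+ 2 - nc_gap e0fmkH *+ 2
    - nc_gap fmH * k * e - fm * nc_gap kH * e *+ 2 - fm * k * nc_gap Hem *+ 2).
- apply: cancel2.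
  nc_by c1 c1 (nc_gap e0f31 * k * e13 + f31 * nc_gap e0ke13 *+ 2
    + nc_gap e0fm * k * H * em *+ 2 + fm * nc_gap e0kHem *+ 2 + nc_gap e0H
    - nc_gap Hmk * H * em *+ 2 - nc_gap fmH * k * e13 - fm * nc_gap kH * e13 *+ 2
    - nc_gap Hem).
Qed.
End OneVariable.

Lemma negI_m1 : negI im1 = ip1. Proof. exact: val_inj. Qed.
Lemma negI_0 : negI i0 = i0. Proof. exact: val_inj. Qed.
Lemma negI_p1 : negI ip1 = im1. Proof. exact: val_inj. Qed.
Definition negIE := (negI_m1, negI_0, negI_p1).

(** * The relation $T(u)T^t(u+\frac12)=1$ *)

Section Orthogonality.
Variable S : pzRingType.
Implicit Types T U : 'I_3 -> 'I_3 -> S.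

Definition prod3 T U a c : S :=
  T a im1 * U im1 c + T a i0 * U i0 c + T a ip1 * U ip1 c.
Definition transT T a c : S := T (negI c) (negI a).

Lemma equivF_trans z T : equivF z T -> equivF z (transT T).
Proof.
move=> H a c; rewrite /transT H /lowI /raiseI.
case_I3 a; case_I3 c; rewrite /= ?negIE ?oppr0 ?opprK ?sub0r ?subr0 ?add0r ?addr0 ?opprK // addrC //.
Qed.

Lemma equivF_prod z T U : equivF z T -> equivF z U -> equivF z (prod3 T U).
Proof.
have c1 := @central1 S.
move=> HT HU a c; rewrite /prod3 -[RHS]addr0.
transitivity ((z * T a im1 - T a im1 * z) * U im1 c + T a im1 * (z * U im1 c - U im1 c * z)
  + ((z * T a i0 - T a i0 * z) * U i0 c + T a i0 * (z * U i0 c - U i0 c * z))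
  + ((z * T a ip1 - T a ip1 * z) * U ip1 c + T a ip1 * (z * U ip1 c - U ip1 c * z))).
  by nc c1 c1.
by rewrite !HT !HU /lowI /raiseI; case_I3 a; case_I3 c => /=; nc c1 c1.
Qed.

(** The commutator with [z] lowers the column index, so the last column determines the middle one,
    and the middle one the first. *)
Lemma equivF_col_closure z T : equivF z T ->
  (forall a, T a ip1 = (a == ip1)%:R) -> forall a c, T a c = (a == c)%:R.
Proof.
move=> H T3.
have c1 := @central1 S.
have T2 a : T a i0 = (a == i0)%:R.
  have := H a ip1; rewrite /lowI /raiseI; case_I3 a; rewrite !T3 /= => E.
  - nc_by c1 c1 (- nc_gap E).
  - nc_by c1 c1 (- nc_gap E).
  - nc_by c1 c1 (- nc_gap E).
have T1 a : T a im1 = (a == im1)%:R.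
  have := H a i0; rewrite /lowI /raiseI; case_I3 a; rewrite !T2 /= => E.
  - nc_by c1 c1 (nc_gap E).
  - nc_by c1 c1 (nc_gap E).
  - nc_by c1 c1 (nc_gap E).
by move=> a c; case_I3 c.
Qed.
Section Gauss.
Variables (f0 k H Hm e f em fm e13 f31 kp Hp ep fp e13p f31p : S).
Hypotheses (rel : shift_rel k H Hm e f em fm e13 f31)
  (relp : shift_rel kp Hp H ep fp e f e13p f31p).
Let T := gaussT k H e f em fm e13 f31.
Let Tp := gaussT kp Hp ep fp e f e13p f31p.
Hypotheses (two_reg : forall x : S, x *+ 2 = 0 -> x = 0)
  (kep : kp * ep = em * kp) (eem : e * em *+ 2 = e * e + em * em).

Lemma gaussT_last_col a : prod3 T (transT Tp) a ip1 = (a == ip1)%:R.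
Proof.
have c1 := @central1 S.
have Hkp : H * kp = 1 := rel_Hmk relp.
have ke13p : kp * e13p *+ 2 = - (em * em * kp).
  nc_by c1 c1 (kp * nc_gap (rel_e13 relp) - nc_gap kep * ep - em * nc_gap kep).
have top : kp * e13p + e * kp * ep + e13 * kp = 0.
  apply: two_reg.
  nc_by c1 c1 (nc_gap ke13p + e * nc_gap kep *+ 2 + nc_gap eem * kp + nc_gap (rel_e13 rel) * kp).
rewrite /prod3 /transT !negIE /T /Tp /gaussT; case_I3 a => /=.
- nc_by c1 c1 (k * nc_gap top).
- nc_by c1 c1 (f * k * nc_gap top + k * H * nc_gap kep).
- nc_by c1 c1 (f31 * k * nc_gap top - fm * k * H * nc_gap kep + nc_gap Hkp).
Qed.

(** Products and transposes of equivariant matrices are equivariant, so the last column computed in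
    [gaussT_last_col] suffices. *)
Lemma gaussT_orth : equivF f0 T -> equivF f0 Tp ->
  forall a c, prod3 T (transT Tp) a c = (a == c)%:R.
Proof.
move=> HT HTp; apply: equivF_col_closure gaussT_last_col.
exact: equivF_prod HT (equivF_trans HTp).
Qed.
End Gauss.
End Orthogonality.

(** * Relations read off from RTT entries *)

Section RowRelations.
Variables (S : pzRingType) (w p : S).
Hypotheses (cw : central w) (cp : central p).
Variables (T T' : 'I_3 -> 'I_3 -> S) (k e k' e' : S).
Hypotheses (T11 : T im1 im1 = k) (T12 : T im1 i0 = k * e).
Hypotheses (T11' : T' im1 im1 = k') (T12' : T' im1 i0 = k' * e').
Local Notation D := (rtt_defect w p T T').

Lemma lreg_eq (a x y : S) : GRing.lreg a -> a * (x - y) = 0 -> x = y.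
Proof. by move=> ra; rewrite -[RHS](mulr0 a) => /ra /eqP; rewrite subr_eq0 => /eqP. Qed.

Lemma rreg_eq (a x y : S) : GRing.rreg a -> (x - y) * a = 0 -> x = y.
Proof. by move=> ra; rewrite -[RHS](mul0r a) => /ra /eqP; rewrite subr_eq0 => /eqP. Qed.

(** The first-row computations read backwards: each entry is the wanted relation times regular
    elements, plus multiples of relations already obtained. *)
Lemma row1_rel_of_rtt :
  GRing.lreg w -> GRing.lreg (w - p) -> GRing.lreg (w - p *+ 2) ->
  GRing.lreg k -> GRing.lreg k' ->
  T im1 ip1 *+ 2 = - (k * e * e) -> T' im1 ip1 *+ 2 = - (k' * e' * e') ->
  (forall c d, D im1 im1 c d = 0) -> row1_rel w p k e k' e'.
Proof.
move=> rw rwp rw2p rk rk' t13 t13' D0.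
have kk : k * k' = k' * k.
  apply: (lreg_eq rwp); apply: rw2p; rewrite mulr0.
  have := D0 im1 im1; rewrite /rtt_defect /= T11 T11' => E.
  nc_by cw cp (nc_gap E).
have ke : (w - p *+ 2) * k * e' = w * e' * k - p * k * e *+ 2.
  apply: (lreg_eq rk'); apply: rwp; rewrite mulr0.
  have := D0 im1 i0; rewrite /rtt_defect /= T11 T12 T11' T12' => E.
  nc_by cw cp (nc_gap E - (w - p) * (w - p *+ 2) * nc_gap kk * e').
have ke' : w * e * k' = (w + p *+ 2) * k' * e - p * k' * e' *+ 2.
  apply: (lreg_eq rk); apply: rw2p; apply: rwp; rewrite !mulr0.
  have := D0 i0 im1; rewrite /rtt_defect /= T11 T12 T11' T12' => E.
  nc_by cw cp (w * nc_gap E + (w - p) * (p * k' * nc_gap ke *+ 2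
    + (w - p *+ 2) * nc_gap kk * (p * e' *+ 2 - (w + p *+ 2) * e))).
have ee : w * (e * e' - e' * e) = p * (e - e') * (e - e').
  apply: (lreg_eq rk); apply: rk'; apply: rw2p; apply: rw; rewrite !mulr0.
  have := D0 i0 i0; rewrite /rtt_defect /= T11 T12 T11' T12' => E.
  nc_by cw cp (w * nc_gap E
  - ((w - p) * (w - p *+ 2) * (k * nc_gap ke' * e' + k' * nc_gap ke * e)
  - p * w * w * (k' * nc_gap t13 + nc_gap t13' * k)
  - p * (w * k' * e' * nc_gap ke + k' * nc_gap ke * ((w - p *+ 2) * e' + p * e *+ 2))
  + p * w * k' * nc_gap ke * e *+ 2
  + (w - p) * (w - p *+ 2) * nc_gap kk * ((w + p *+ 2) * e - p * e' *+ 2) * e')).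
by split.
Qed.

(* The RTT relation at [u - v = 1], where [R(u - v)] has a simple zero on the *)
(* symmetric traceless part.                                                  *)
Lemma rtt_special_e13 (x x' : S) :
  (forall y : S, y *+ 2 = 0 -> y = 0) ->
  GRing.lreg p -> GRing.lreg k -> GRing.lreg k' -> w = p *+ 2 ->
  T im1 ip1 = k * x -> T' im1 ip1 = k' * x' ->
  (forall c d, D im1 im1 c d = 0) -> x *+ 2 = - (e * e) /\ e' * k = k * e.
Proof.
move=> two rp rk rk' wp T13 T13' D0.
have E12 := D0 im1 i0; have E22 := D0 i0 i0; have E13 := D0 im1 ip1.
move: E12 E22 E13; rewrite /rtt_defect /= T11 T12 T13 T11' T12' T13' wp => E12 E22 E13.
have two_r (a : S) : GRing.lreg a -> forall y, a * y *+ 2 = 0 -> y = 0.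
  by move=> ra y /two; rewrite -[RHS](mulr0 a) => /ra.
have ek : k' * (k * e - e' * k) = 0.
  by apply: (two_r p rp); apply: rp; rewrite mulr0; nc_by cp cp (nc_gap E12).
have {}ek : e' * k = k * e by apply/esym; exact: (lreg_eq rk' ek).
have L : k' * x' * k + k' * e' * k * e + k' * k * x = 0.
  apply: (two_r p rp); apply: two; apply: rp; rewrite mulr0.
  nc_by cp cp (- nc_gap E22).
have X : k' * k * x - k' * x' * k = 0.
  apply: (two_r p rp); apply: rp; rewrite mulr0.
  nc_by cp cp (nc_gap E13 + p * p * nc_gap L *+ 4).
split=> //; apply: (lreg_eq rk); apply: rk'; rewrite mulr0.
nc_by cp cp (nc_gap L + nc_gap X - k' * nc_gap ek * e).
Qed.
End RowRelations.

Section CartanRelations.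
Variables (S : pzRingType) (w p : S).
Hypotheses (cw : central w) (cp : central p).
Variables (T T' : 'I_3 -> 'I_3 -> S) (k e f H k' e' f' H' : S).
Hypotheses (T11 : T im1 im1 = k) (T12 : T im1 i0 = k * e) (T21 : T i0 im1 = f * k)
  (T22 : T i0 i0 = f * k * e + k * H).
Hypotheses (T11' : T' im1 im1 = k') (T12' : T' im1 i0 = k' * e') (T21' : T' i0 im1 = f' * k')
  (T22' : T' i0 i0 = f' * k' * e' + k' * H').
Hypotheses (rw : GRing.lreg w) (rwp : GRing.lreg (w - p)).
Hypotheses (rk : GRing.lreg k) (rk' : GRing.lreg k') (rrk' : GRing.rreg k').
Hypotheses (kk : k * k' = k' * k)
  (ke : (w - p *+ 2) * k * e' = w * e' * k - p * k * e *+ 2)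
  (ke' : w * e * k' = (w + p *+ 2) * k' * e - p * k' * e' *+ 2)
  (kf : w * k * f' = (w - p *+ 2) * f' * k + p * f * k *+ 2).
Local Notation D := (rtt_defect w p T T').

(** The certificate of [rtt_minor] solved for its only unknown relation. *)
Lemma kH_of_rtt : D im1 i0 im1 i0 = 0 -> k * H' = H' * k.
Proof.
rewrite /rtt_defect /= T11 T12 T21 T12' T21' T22' => E.
apply: (lreg_eq rk'); apply: rwp; apply: rw; rewrite !mulr0.
nc_by cw cp (nc_gap E - (w - p) * (nc_gap kf * k' * e' + f' * k' * nc_gap ke
  + (w - p *+ 2) * f' * nc_gap kk * e' + w * nc_gap kk * H')).
Qed.

Lemma ef_of_rtt : k * H' = H' * k -> k' * H' = H' * k' -> D im1 i0 i0 im1 = 0 ->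
  w * (e * f' - f' * e) = p * (H - H') *+ 2.
Proof.
move=> kH kH'; rewrite /rtt_defect /= T11 T12 T22 T11' T21' T22' => E.
apply: (lreg_eq rk); apply: (rreg_eq rrk'); apply: rwp; apply: rw; rewrite !(mulr0, mul0r).
nc_by cw cp (w * nc_gap E
  + (w - p) * (p * f' * k' * nc_gap ke *+ 2 - w * nc_gap kf * e * k'
    - (w - p *+ 2) * f' * k * nc_gap ke' - w * w * f' * nc_gap kk * e
    + p * f' * nc_gap kk * ((w - p *+ 2) * e' + p * e *+ 2) *+ 2
    + p * w * (nc_gap kH * k' - nc_gap kH' * k + H' * nc_gap kk) *+ 2)).
Qed.
End CartanRelations.

(** * Series form of the Drinfeld relations *)

Section Swap.
Variables (F : fieldType) (A : algType F).
Implicit Types g h : fps (fps A).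

Definition swapuv g : fps (fps A) := fun n m => g m n.
Fact swapuv_zmod : zmod_morphism swapuv. Proof. by []. Qed.
Lemma fps2M g h n m :
  (g * h) n m = \sum_(i < n.+1) \sum_(j < m.+1) g i j * h (n - i)%N (m - j)%N.
Proof. by rewrite fpsM fps_sum; apply: eq_bigr => i _; rewrite fpsM. Qed.
Fact swapuv_monoid : monoid_morphism swapuv.
Proof.
split.
  by apply: fpsP => n; apply: fpsP => m; rewrite /swapuv !fps1; case: n m => [|n] [|m].
move=> g h; apply: fpsP => n; apply: fpsP => m.
by rewrite /swapuv fps2M fps2M exchange_big.
Qed.
HB.instance Definition _ := GRing.isZmodMorphism.Build _ _ swapuv swapuv_zmod.
HB.instance Definition _ := GRing.isMonoidMorphism.Build _ _ swapuv swapuv_monoid.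

Lemma swapuv_iu (x : fps A) : swapuv (iu x) = iv x.
Proof. by apply: fpsP => n; apply: fpsP => m; rewrite /swapuv iu_coef iv_coef. Qed.
Lemma swapuv_iv (x : fps A) : swapuv (iv x) = iu x.
Proof. by apply: fpsP => n; apply: fpsP => m; rewrite /swapuv iu_coef iv_coef. Qed.
Lemma iv_fX : iv (fX A) = fX (fps A).
Proof. by rewrite fmap_fX. Qed.
Lemma swapuv_fW : swapuv (fW A) = - fW A.
Proof. by rewrite fW_def rmorphB /= -iv_fX swapuv_iv swapuv_iu opprB. Qed.
Lemma swapuv_fp : swapuv (fp A) = fp A.
Proof.
rewrite fp_def.
have -> : swapuv ((2%:R : F)^-1 *: (iu (fX A) * fX (fps A))) = (2%:R : F)^-1 *: swapuv (iu (fX A) * iv (fX A)) by rewrite iv_fX.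
rewrite rmorphM /= swapuv_iv swapuv_iu iv_fX; congr (_ *: _).
by rewrite fX_central.
Qed.
End Swap.

Section Series.
Variables (F : fieldType) (A : algType F).
Hypothesis two0 : (2%:R : F) != 0.
Implicit Types (a b : fps A).
Local Notation W := (fW A).
Local Notation P := (fp A).

Definition bracket a b : fps (fps A) := iu a * iv b - iv b * iu a.
Definition abracket a b : fps (fps A) := iu a * iv b + iv b * iu a.

Lemma fps_two_reg (x : fps A) : x *+ 2 = 0 -> x = 0.
Proof.
move=> x0; apply: fpsP => n; have := congr1 (@^~ n) x0; rewrite fpsMn fps0.
by move/eqP; rewrite -scaler_nat scaler_eq0 (negPf two0) => /eqP.
Qed.

Lemma fps_two_inj (x y : fps A) : x *+ 2 = y *+ 2 -> x = y.
Proof.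
by move=> xy; apply/eqP; rewrite -subr_eq0; apply/eqP/fps_two_reg; rewrite mulrnBl xy subrr.
Qed.

Lemma bracket_coef a b n m : bracket a b n m = comm (a m) (b n).
Proof. by rewrite /bracket fpsB fpsB uv_coef vu_coef. Qed.
Lemma abracket_coef a b n m : abracket a b n m = acomm (a m) (b n).
Proof. by rewrite /abracket fpsD fpsD uv_coef vu_coef. Qed.

(* [ca], [cb] collect the coefficients at the boundary powers of [u], [v]. *)
Lemma bracket_modes (s : F) a b (ca cb : fps A) :
  (forall m, comm (a m) (b 0%N) = 0) -> (forall n, comm (a 0%N) (b n) = 0) ->
  (forall m n, comm (a m.+1) (b n) - comm (a m) (b n.+1)
     + (s / 2%:R) *: acomm (a m) (b n)
   = (if n is 0%N then ca m else 0) + (if m is 0%N then cb n else 0)) ->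
  W * bracket a b + s *: (P * abracket a b) = P * (iu ca + iv cb) *+ 2.
Proof.
move=> a0 b0 H; apply: fpsP => n; apply: fpsP => m.
rewrite fpsD fpsD !fpsZ !fpsMn fWM_coef !fpM_coef.
case: n => [|n]; first by case: m => [|m]; rewrite ?bracket_coef ?a0 !scaler0 mul0rn ?subr0 ?addr0.
case: m => [|m]; first by rewrite !bracket_coef b0 !scaler0 mul0rn ?subr0 ?addr0.
rewrite !bracket_coef abracket_coef fpsD fpsD iu_coef iv_coef scalerA.
by rewrite -scaler_nat scalerA divff // scale1r -H.
Qed.

Lemma modes_bracket (s : F) a b (ca cb : fps A) :
  W * bracket a b + s *: (P * abracket a b) = P * (iu ca + iv cb) *+ 2 ->
  forall m n, comm (a m.+1) (b n) - comm (a m) (b n.+1)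
     + (s / 2%:R) *: acomm (a m) (b n)
   = (if n is 0%N then ca m else 0) + (if m is 0%N then cb n else 0).
Proof.
move=> H m n; have := congr1 (fun g => g n.+1 m.+1) H.
rewrite fpsD fpsD !fpsZ !fpsMn fWM_coef !fpM_coef !bracket_coef abracket_coef fpsD fpsD.
rewrite iu_coef iv_coef scalerA => ->.
by rewrite -scaler_nat scalerA divff // scale1r.
Qed.

(** The coefficient of $v^{-1}$ isolates the first mode of [b]; this turns series relations into
    commutators with $x^\pm_0$. *)
Lemma bracket_first a b (z : fps (fps A)) : b 0%N = 0 ->
  W * bracket a b = P * z -> (cst (b 1%N) * a - a * cst (b 1%N)) *+ 2 = z 0%N.
Proof.
move=> b0 H; apply: fpsP => m; have := congr1 (fun g => g 1%N m.+1) H.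
rewrite fWM_coef fpM_coef !bracket_coef b0 /comm mul0r mulr0 subrr sub0r fpsMn fpsB cstM_coef Mcst_coef.
by rewrite opprB => ->; rewrite -scaler_nat scalerA divff // scale1r.
Qed.

(** Generating-series form of Drinfeld's relations; for instance [ds_ef] is
    $(u-v)[e(u),f(v)]=H(u)-H(v)$. The one-variable terms on the right of the other relations collect
    the boundary modes. *)
Record dseries (H e f : fps A) : Prop := DSeries {
  ds_H0 : H 0%N = 1;
  ds_e0 : e 0%N = 0;
  ds_f0 : f 0%N = 0;
  ds_HH : iu H * iv H = iv H * iu H;
  ds_ef : W * bracket e f = P * (iu H - iv H) *+ 2;
  ds_He : W * bracket H e = P * (iu (H * e + e * H) - abracket H e);
  ds_Hf : W * bracket H f = P * (abracket H f - iu (H * f + f * H));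
  ds_ee : W * bracket e e = P * ((iu e - iv e) * (iu e - iv e));
  ds_ff : W * bracket f f = - (P * ((iu f - iv f) * (iu f - iv f))) }.

Lemma ev0_fW : ev (0 : F) W = 0.
Proof. by rewrite ev_fW // mulr0 oppr0 scale0r. Qed.
Lemma ev0_fp_inj (x y : fps A) : ev (0 : F) P * x = ev 0 P * y -> x = y.
Proof. exact: ev_fp_lreg. Qed.
Lemma ev0_iv (x : fps A) : ev (0 : F) (iv x) = x.
Proof. by rewrite ev_iv fshift_0. Qed.

Lemma dseries_of_drinfeld (h xp xm : nat -> A) :
  drinfeld_rel h xp xm -> dseries (Hser h) (Xser xm) (Xser xp).
Proof.
case=> hh xx h0 hx xx2; pose H : fps A := Hser h; pose e : fps A := Xser xm; pose f : fps A := Xser xp.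
have com1 x : comm (1 : A) x = 0 by rewrite /comm mul1r mulr1 subrr.
have comx1 x : comm x (1 : A) = 0 by rewrite /comm mul1r mulr1 subrr.
have com0 x : comm (0 : A) x = 0 by rewrite /comm mul0r mulr0 subrr.
have comx0 x : comm x (0 : A) = 0 by rewrite /comm mul0r mulr0 subrr.
have acom0 x : acomm (0 : A) x = 0 by rewrite /acomm mul0r mulr0 addr0.
have acomx0 x : acomm x (0 : A) = 0 by rewrite /acomm mul0r mulr0 addr0.
have acom1 x : acomm (1 : A) x = x *+ 2 by rewrite /acomm mul1r mulr1.
have half2 (x : A) : (2%:R : F)^-1 *: (x *+ 2) = x.
  by rewrite -scaler_nat scalerA mulVf // scale1r.
have commN (x y : A) : comm x y = - comm y x by rewrite /comm opprB.
have Hh (x : nat -> A) (s : F) :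
    (forall l, comm (h 0%N) (x l) = - (s *: x l)) ->
    (forall k l, comm (h k.+1) (x l) - comm (h k) (x l.+1) = - ((s / 2%:R) *: acomm (h k) (x l))) ->
    let X : fps A := Xser x in
    W * bracket H X + s *: (P * abracket H X) = s *: (P * iu (H * X + X * H)).
  move=> hx0 hxk X.
  (* The boundary modes form an unknown series [C]; at $v=u$ the factor [fW] vanishes and the
     relation itself determines [C]. *)
  pose C : fps A := fun m => - comm (H m) (x 0%N).
  have E : W * bracket H X + s *: (P * abracket H X) = P * iu C *+ 2.
    have -> : iu C = iu C + iv (0 : fps A) by rewrite rmorph0 addr0.
    apply: bracket_modes => [m|n|m n]; rewrite ?comx0 ?com1 //.
    case: m n => [|m] [|n] /=.
    - by rewrite com1 subr0 comx0 acomx0 scaler0 /C com1 oppr0 !addr0.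
    - by rewrite com1 subr0 acom1 hx0 -scalerA half2 addNr addr0.
    - by rewrite comx0 acomx0 scaler0 /C sub0r !addr0.
    - by rewrite hxk addNr addr0.
  have := congr1 (ev 0) E.
  rewrite rmorphD rmorphM /= ev0_fW mul0r add0r ev_scale !rmorphM /= rmorphMn rmorphM /= ev_iu.
  rewrite rmorphD !rmorphM /= !ev_iu ev0_iv scalerAr -mulrnAr => /ev0_fp_inj E2.
  rewrite E -mulrnAr -rmorphMn -E2 /= cst_scale scalerAr //.
have Xx (x : nat -> A) (s : F) :
    let X : fps A := Xser x in
    (forall k l, comm (x k.+1) (x l) - comm (x k) (x l.+1) = - ((s / 2%:R) *: acomm (x k) (x l))) ->
    W * bracket X X + s *: (P * abracket X X) = s *: (P * (iu (X * X) + iv (X * X))).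
  move=> X xk; pose C : fps A := fun n => comm (x 0%N) (X n).
  have E : W * bracket X X + s *: (P * abracket X X) = P * (iu C + iv C) *+ 2.
    apply: bracket_modes => [m|n|m n]; rewrite ?comx0 ?com0 //.
    case: m n => [|m] [|n] /=.
    + by rewrite /C comx0 com0 acom0 scaler0 subr0 addr0.
    + by rewrite com0 acom0 scaler0 subr0 addr0 add0r.
    + by rewrite comx0 acomx0 scaler0 sub0r !addr0 commN opprK.
    + by rewrite xk addNr addr0.
  have XC : s *: (X * X) = C *+ 2.
    have := congr1 (ev (0 : F)) E.
    rewrite rmorphD rmorphM /= ev0_fW mul0r add0r ev_scale !rmorphM /= rmorphMn rmorphM /=.
    rewrite !rmorphD !rmorphM /= !ev_iu !ev0_iv scalerAr -mulrnAr => /ev0_fp_inj.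
    move=> H2; apply: (scalerI two0).
    by rewrite !scaler_nat !mulr2n -scalerDr H2 mulr2n.
  rewrite E -mulrnAr scalerAr; congr (_ * _).
  have -> : iv (X * X) = swapuv (iu (X * X)) by rewrite swapuv_iu.
  have -> : iv C = swapuv (iu C) by rewrite swapuv_iu.
  have C2 : iu C *+ 2 = s *: iu (X * X) by rewrite -rmorphMn -XC /= cst_scale.
  rewrite scalerDr mulrnDl C2; congr (_ + _).
  by rewrite -[LHS](rmorphMn (@swapuv _ A)) C2.
split=> //.
- apply: fpsP => n; apply: fpsP => m; rewrite uv_coef vu_coef.
  case: n m => [|n] [|m] /=; rewrite ?mul1r ?mulr1 //.
  by apply/eqP; rewrite -subr_eq0; apply/eqP; apply: hh.
- rewrite -[LHS]addr0 -(scale0r (P * abracket e f)).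
  rewrite -rmorphN; apply: bracket_modes => [m|n|m n]; rewrite ?comx0 ?com0 //.
  rewrite mul0r scale0r addr0.
  case: m n => [|m] [|n] /=; rewrite ?comx0 ?com0 ?sub0r ?subr0 ?addr0 ?add0r.
  + by rewrite fpsN /= subrr oppr0.
  + by rewrite commN xx addn0.
  + by rewrite commN xx opprK.
  + by rewrite commN (commN (xm m)) !xx addnS addSn opprK addNr.
- have E : W * bracket H e + 1 *: (P * abracket H e) = 1 *: (P * iu (H * e + e * H)).
    apply: Hh => [l|k l]; rewrite ?scale1r ?mul1r; first by case: (h0 l).
    by case: (hx k l).
  by rewrite !scale1r in E; rewrite -[LHS](addrK (P * abracket H e)) E -mulrBr.
- have E : W * bracket H f + (-1) *: (P * abracket H f) = (-1) *: (P * iu (H * f + f * H)).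
    apply: Hh => [l|k l]; rewrite ?scaleN1r ?mulN1r ?opprK; first by case: (h0 l).
    by rewrite scaleNr opprK; case: (hx k l).
  by rewrite !scaleN1r in E; rewrite -[LHS](subrK (P * abracket H f)) E addrC -mulrBr.
- have E : W * bracket e e + 1 *: (P * abracket e e) = 1 *: (P * (iu (e * e) + iv (e * e))).
    by apply: Xx => k l; rewrite mul1r; case: (xx2 k l).
  rewrite !scale1r in E; rewrite -[LHS](addrK (P * abracket e e)) E -mulrBr /abracket.
  by rewrite [iu (e * e)]rmorphM [iv (e * e)]rmorphM /=; congr (_ * _); rewrite -/e; nc (@fW_central _ A) (@fp_central _ A).
- have E : W * bracket f f + (-1) *: (P * abracket f f) = (-1) *: (P * (iu (f * f) + iv (f * f))).
    by apply: Xx => k l; rewrite mulN1r scaleNr opprK; case: (xx2 k l).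
  rewrite !scaleN1r in E; rewrite -[LHS](subrK (P * abracket f f)) E addrC -mulrBr /abracket -mulrN.
  by rewrite [iu (f * f)]rmorphM [iv (f * f)]rmorphM /=; congr (_ * _); rewrite -/f; nc (@fW_central _ A) (@fp_central _ A).
Qed.

Lemma drinfeld_of_dseries (H e f : fps A) : dseries H e f ->
  drinfeld_rel (fun l => H l.+1) (fun l => f l.+1) (fun l => e l.+1).
Proof.
case=> H0 e0 f0 HH ef He Hf ee ff.
have com1 x : comm (1 : A) x = 0 by rewrite /comm mul1r mulr1 subrr.
have com0 x : comm (0 : A) x = 0 by rewrite /comm mul0r mulr0 subrr.
have comx0 x : comm x (0 : A) = 0 by rewrite /comm mul0r mulr0 subrr.
have commN (x y : A) : comm x y = - comm y x by rewrite /comm opprB.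
have acom1 x : acomm (1 : A) x = x *+ 2 by rewrite /acomm mul1r mulr1.
have half2 (x : A) : (2%:R : F)^-1 *: (x *+ 2) = x.
  by rewrite -scaler_nat scalerA mulVf // scale1r.
have halfu (c : fps A) : iu ((2%:R : F)^-1 *: c) *+ 2 = iu c.
  by rewrite -rmorphMn -scaler_nat scalerA divff // scale1r.
have halfv (c : fps A) : iv ((2%:R : F)^-1 *: c) *+ 2 = iv c.
  by rewrite -rmorphMn -scaler_nat scalerA divff // scale1r.
have modes (s : F) (a b ca cb : fps A) :
    W * bracket a b + s *: (P * abracket a b) = P * (iu ca + iv cb) ->
    forall m n, comm (a m.+1) (b n.+1) - comm (a m) (b n.+2) + (s / 2%:R) *: acomm (a m) (b n.+1)
    = (if m is 0%N then (2%:R : F)^-1 *: cb n.+1 else 0).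
  move=> E m n; have := @modes_bracket s a b ((2%:R : F)^-1 *: ca) ((2%:R : F)^-1 *: cb).
  by rewrite E -mulrnAr mulrnDl halfu halfv => /(_ erefl m n.+1) ->; rewrite add0r.
have iv0 : iv (0 : fps A) = 0 by rewrite rmorph0.
have PH : W * bracket H e + 1 *: (P * abracket H e) = P * (iu (H * e + e * H) + iv 0).
  by rewrite He iv0 addr0 scale1r -mulrDr subrK.
have PHf : W * bracket H f + (-1) *: (P * abracket H f) = P * (iu (- (H * f + f * H)) + iv 0).
  by rewrite Hf rmorphN /= iv0 addr0 scaleN1r -mulrBr addrAC subrr add0r.
have Pe : W * bracket e e + 1 *: (P * abracket e e) = P * (iu (e * e) + iv (e * e)).
  rewrite ee scale1r !rmorphM /abracket /=; nc (@fW_central _ A) (@fp_central _ A).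
have Pf : W * bracket f f + (-1) *: (P * abracket f f) = P * (iu (- (f * f)) + iv (- (f * f))).
  rewrite ff scaleN1r !rmorphN !rmorphM /abracket /=; nc (@fW_central _ A) (@fp_central _ A).
split.
- move=> m n; apply/eqP; rewrite subr_eq0; apply/eqP.
  by have := congr1 (fun g => g n.+1 m.+1) HH; rewrite uv_coef vu_coef.
(* [E1] moves one degree from $e$ to $f$, so the bracket depends only on the total degree; [E0]
   gives its value. *)
- have E0 m : comm (e m.+1) (f 1%N) = - H m.+1.
    have := @modes_bracket 0 e f H (- H); rewrite scale0r addr0 rmorphN ef => /(_ erefl m.+1 0%N).
    by rewrite f0 comx0 sub0r mul0r scale0r !addr0 => /eqP; rewrite eqr_oppLR => /eqP.
  have E1 m n : comm (e m.+2) (f n.+1) = comm (e m.+1) (f n.+2).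
    have := @modes_bracket 0 e f H (- H); rewrite scale0r addr0 rmorphN ef => /(_ erefl m.+1 n.+1).
    by rewrite mul0r scale0r !addr0 => /eqP; rewrite subr_eq0 => /eqP.
  move=> m n; rewrite commN; elim: m n => [|m IH] n; first by rewrite E0 opprK.
  by rewrite -E1 IH addnS addSn.
- move=> l; split.
  + have := modes _ _ _ _ _ PHf 0%N l; rewrite H0 com1 acom1 subr0 mulN1r scaleNr half2 fps0 scaler0.
    by move/eqP; rewrite subr_eq0 => /eqP.
  + have := modes _ _ _ _ _ PH 0%N l; rewrite H0 com1 acom1 subr0 mul1r half2 fps0 scaler0.
    by move/eqP; rewrite addr_eq0 => /eqP.
- move=> k l; split.
  + have := modes _ _ _ _ _ PHf k.+1 l; rewrite mulN1r scaleNr.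
    by move/eqP; rewrite subr_eq0 => /eqP.
  + have := modes _ _ _ _ _ PH k.+1 l; rewrite mul1r.
    by move/eqP; rewrite addr_eq0 => /eqP.
- move=> k l; split.
  + have := modes _ _ _ _ _ Pf k.+1 l; rewrite mulN1r scaleNr.
    by move/eqP; rewrite subr_eq0 => /eqP.
  + have := modes _ _ _ _ _ Pe k.+1 l; rewrite mul1r.
    by move/eqP; rewrite addr_eq0 => /eqP.
Qed.
End Series.

(** * From the Drinfeld relations to RTT *)

Section Morph.
Variables (R S : pzRingType) (phi : {rmorphism R -> S}).

Lemma commr_inv (x y z : R) : x * y = y * x -> z * x = 1 -> x * z = 1 -> z * y = y * z.
Proof.
by move=> xy zx xz; rewrite -[LHS]mulr1 -xz mulrA -(mulrA z) -xy mulrA zx mul1r.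
Qed.

Lemma gaussT_morph k H e f em fm e13 f31 a c :
  phi (gaussT k H e f em fm e13 f31 a c) =
  gaussT (phi k) (phi H) (phi e) (phi f) (phi em) (phi fm) (phi e13) (phi f31) a c.
Proof.
rewrite /gaussT; case_I3 a; case_I3 c => /=; by rewrite ?(rmorphD, rmorphN, rmorphM).
Qed.

Lemma shift_rel_morph k H Hm e f em fm e13 f31 :
  shift_rel k H Hm e f em fm e13 f31 ->
  shift_rel (phi k) (phi H) (phi Hm) (phi e) (phi f) (phi em) (phi fm) (phi e13) (phi f31).
Proof.
case=> *; split; rewrite -?rmorphM -?rmorphMn -?rmorphD -?rmorphN -?(rmorph1 phi) /=;
  by congr (phi _).
Qed.

Lemma equivE_morph z T : equivE z T -> equivE (phi z) (fun a c => phi (T a c)).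
Proof.
move=> H a c; rewrite -!rmorphM -rmorphB H rmorphB /lowI /raiseI; case_I3 a; case_I3 c => /=;
  by rewrite ?rmorphN ?rmorph0.
Qed.
Lemma equivF_morph z T : equivF z T -> equivF (phi z) (fun a c => phi (T a c)).
Proof.
move=> H a c; rewrite -!rmorphM -rmorphB H rmorphB /lowI /raiseI; case_I3 a; case_I3 c => /=;
  by rewrite ?rmorphN ?rmorph0.
Qed.
Lemma rtt_defect_morph w p T T' a b c d :
  phi (rtt_defect w p T T' a b c d) =
  rtt_defect (phi w) (phi p) (fun a c => phi (T a c)) (fun a c => phi (T' a c)) a b c d.
Proof.
rewrite /rtt_defect !rmorphB rmorphD rmorphB; congr (_ - _ + _ - _).
- by rewrite !rmorphM !rmorphB !rmorphM.
- by rewrite rmorphMn !rmorphM !rmorphB !rmorphM.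
- by case: ifP => _; rewrite ?rmorph0 // rmorphMn !rmorphM !rmorphD !rmorphM.
- by case: ifP => _; rewrite ?rmorph0 // rmorphMn !rmorphM !rmorphD !rmorphM.
Qed.
End Morph.

Section YSide.
Variables (F : fieldType) (A : algType F) (H e f G : fps A).
Hypotheses (two0 : (2%:R : F) != 0) (ds : dseries H e f) (HG : H * G = 1).
Local Notation W := (fW A).
Local Notation P := (fp A).
Local Notation hf := ((2%:R : F)^-1).
Let cW := @fW_central F A.
Let cP := @fp_central F A.

Lemma y_GH : G * H = 1. Proof. exact: fps_inv_comm (ds_H0 ds) HG. Qed.

Definition yk : fps A := fshift (- hf) G.
Definition yHm : fps A := fshift (- hf) H.
Definition yem : fps A := fshift (- hf) e.
Definition yfm : fps A := fshift (- hf) f.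
Definition ye13 : fps A := - (hf *: (e * e)).
Definition yf31 : fps A := - (hf *: (f * f)).

Lemma two_hf : 2%:R * hf = 1. Proof. by rewrite divff. Qed.

Lemma y_uG_vH : iu G * iv H = iv H * iu G.
Proof.
by apply: commr_inv (ds_HH ds) _ _; rewrite -rmorphM ?HG ?y_GH rmorph1.
Qed.
Lemma y_uk_vH : iu yk * iv H = iv H * iu yk.
Proof. by have := congr1 (fmap (fshift (- hf))) y_uG_vH; rewrite !rmorphM /= shu_iu shu_iv. Qed.
Lemma y_uk_vk : iu yk * iv yk = iv yk * iu yk.
Proof.
have E : iu yk * iv yHm = iv yHm * iu yk.
  by have := congr1 (fshift (- hf)) y_uk_vH; rewrite !rmorphM /= shv_iu shv_iv.
apply/esym; apply: commr_inv (esym E) _ _; rewrite -rmorphM /yk /yHm -rmorphM ?HG ?y_GH !rmorph1 //.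
Qed.
Lemma y_k_H : yk * H = H * yk.
Proof. by have := congr1 (ev (0 : F)) y_uk_vH; rewrite !rmorphM /= ev_iu ev0_iv. Qed.

Lemma y_quW : iu (1 + - hf *: fX A) * fmap (fshift (- hf)) W = W - P.
Proof. by rewrite shu_fW // mulrN two_hf scaleN1r. Qed.
Lemma y_quP : iu (1 + - hf *: fX A) * fmap (fshift (- hf)) P = P.
Proof. exact: shu_fp. Qed.
Let qu := iu (1 + - hf *: fX A).

Lemma y_iuGH : iu G * iu H = 1. Proof. by rewrite -rmorphM y_GH rmorph1. Qed.
Lemma y_iuHG : iu H * iu G = 1. Proof. by rewrite -rmorphM HG rmorph1. Qed.

(** Multiplying the $H$-$e$ relation by $G=H^{-1}$ on both sides gives one between $G$ and $e$; then
    $u:=u-\frac12$ turns [W + P], [W - P] into [W], [W - P *+ 2] and $G$ into $k$. *)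
Lemma y_ke_pre : W * iv e * iu yk = (W - P *+ 2) * iu yk * iv e
   + P * (iu yem * iu yk + iu yk * iu yem).
Proof.
have He := ds_He ds; rewrite /bracket /abracket rmorphD !rmorphM /= in He.
have E : (W + P) * iv e * iu G = (W - P) * iu G * iv e + P * (iu e * iu G + iu G * iu e).
  nc_by cW cP (iu G * nc_gap He * iu G - (W + P) * nc_gap y_iuGH * iv e * iu G
     + (W - P) * iu G * iv e * nc_gap y_iuHG
     + P * (nc_gap y_iuGH * iu e * iu G + iu G * iu e * nc_gap y_iuHG)).
have := congr1 (fmap (fshift (- hf))) E.
rewrite ?(rmorphD, rmorphN, rmorphM) /= !shu_iu !shu_iv -/yk -/yem => {}E.
have E1 : qu * _ = _ := y_quW; have E2 : qu * _ = _ := y_quP.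
nc_by cW cP (qu * nc_gap E - nc_gap E1 * (iv e * iu yk - iu yk * iv e)
  - nc_gap E2 * (iv e * iu yk + iu yk * iv e - (iu yem * iu yk + iu yk * iu yem))).
Qed.
Lemma y_kf_pre : W * iu yk * iv f = (W - P *+ 2) * iv f * iu yk
   + P * (iu yfm * iu yk + iu yk * iu yfm).
Proof.
have Hf := ds_Hf ds; rewrite /bracket /abracket rmorphD !rmorphM /= in Hf.
have E : (W + P) * iu G * iv f = (W - P) * iv f * iu G + P * (iu f * iu G + iu G * iu f).
  nc_by cW cP (- (iu G * nc_gap Hf * iu G)
     + (W - P) * nc_gap y_iuGH * iv f * iu G - (W + P) * iu G * iv f * nc_gap y_iuHG
     + P * (nc_gap y_iuGH * iu f * iu G + iu G * iu f * nc_gap y_iuHG)).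
have := congr1 (fmap (fshift (- hf))) E.
rewrite ?(rmorphD, rmorphN, rmorphM) /= !shu_iu !shu_iv -/yk -/yfm => {}E.
have E1 : qu * _ = _ := y_quW; have E2 : qu * _ = _ := y_quP.
nc_by cW cP (qu * nc_gap E - nc_gap E1 * (iu yk * iv f - iv f * iu yk)
  - nc_gap E2 * (iv f * iu yk + iu yk * iv f - (iu yfm * iu yk + iu yk * iu yfm))).
Qed.

(** The case $v=u$ of [y_ke_pre]; it serves to eliminate $e(u-\frac12)$ from that relation. *)
Lemma y_emk : yem * yk + yk * yem = yk * e *+ 2.
Proof.
have := congr1 (ev (0 : F)) y_ke_pre.
rewrite ?(rmorphD, rmorphN, rmorphM, rmorphMn) /= !ev_iu !ev0_iv ev0_fW // => E.
apply: (ev0_fp_inj two0).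
by nc_by (@ev_fp_central F A 0) (@ev_fp_central F A 0) (- nc_gap E).
Qed.
Lemma y_fmk : yfm * yk + yk * yfm = f * yk *+ 2.
Proof.
have := congr1 (ev (0 : F)) y_kf_pre.
rewrite ?(rmorphD, rmorphN, rmorphM, rmorphMn) /= !ev_iu !ev0_iv ev0_fW // => E.
apply: (ev0_fp_inj two0).
by nc_by (@ev_fp_central F A 0) (@ev_fp_central F A 0) (- nc_gap E).
Qed.

Lemma y_ke : (W - P *+ 2) * iu yk * iv e = W * iv e * iu yk - P * iu yk * iu e *+ 2.
Proof.
have E1 := y_ke_pre.
have E2 : iu yem * iu yk + iu yk * iu yem = iu yk * iu e *+ 2.
  by rewrite -!iuM -iuD y_emk iuMn.
nc_by cW cP (- nc_gap E1 - P * nc_gap E2).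
Qed.
Lemma y_kf : W * iu yk * iv f = (W - P *+ 2) * iv f * iu yk + P * iu f * iu yk *+ 2.
Proof.
have E1 := y_kf_pre.
have E2 : iu yfm * iu yk + iu yk * iu yfm = iu f * iu yk *+ 2.
  by rewrite -!iuM -iuD y_fmk iuMn.
nc_by cW cP (nc_gap E1 + P * nc_gap E2).
Qed.

Lemma y_evh_fW : ev (- hf) W = ev (- hf) P.
Proof. by rewrite ev_fW // mulrN opprK two_hf scale1r. Qed.
Lemma y_evh_fp_inj x y : ev (- hf) P * x = ev (- hf) P * y -> x = y.
Proof. exact: ev_fp_lreg. Qed.
Let ch := @ev_fp_central F A (- hf).

Lemma y_H_em : H * yem *+ 2 = H * e + e * H.
Proof.
have := congr1 (ev (- hf)) (ds_He ds); rewrite /bracket /abracket.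
rewrite ?(rmorphD, rmorphN, rmorphM, rmorphMn) /= !ev_iu !ev_iv -/yem y_evh_fW => E.
apply: y_evh_fp_inj; nc_by ch ch (nc_gap E).
Qed.
Lemma y_fm_H : yfm * H *+ 2 = f * H + H * f.
Proof.
have := congr1 (ev (- hf)) (ds_Hf ds); rewrite /bracket /abracket.
rewrite ?(rmorphD, rmorphN, rmorphM, rmorphMn) /= !ev_iu !ev_iv -/yfm y_evh_fW => E.
apply: y_evh_fp_inj; nc_by ch ch (- nc_gap E).
Qed.
Lemma y_e_em : e * yem *+ 2 = e * e + yem * yem.
Proof.
have := congr1 (ev (- hf)) (ds_ee ds); rewrite /bracket.
rewrite ?(rmorphD, rmorphN, rmorphM, rmorphMn) /= !ev_iu !ev_iv -/yem y_evh_fW => E.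
apply: y_evh_fp_inj; nc_by ch ch (nc_gap E).
Qed.
Lemma y_fm_f : yfm * f *+ 2 = f * f + yfm * yfm.
Proof.
have := congr1 (ev (- hf)) (ds_ff ds); rewrite /bracket.
rewrite ?(rmorphD, rmorphN, rmorphM, rmorphMn) /= !ev_iu !ev_iv -/yfm y_evh_fW => E.
apply: y_evh_fp_inj; nc_by ch ch (- nc_gap E).
Qed.

Definition yep : fps A := fshift hf e.
Definition yfp : fps A := fshift hf f.
Lemma ev1_fW : ev (-1 : F) W = ev (-1 : F) P *+ 2.
Proof. by rewrite ev_fW // mulrN mulr1 opprK scaler_nat. Qed.
Lemma half_half : hf + -1 = - hf :> F.
Proof.
have E : hf + hf = 1 by rewrite -(mulr2n hf) -(mulr_natl hf 2) two_hf.
by rewrite (_ : -1 = - hf - hf) ?addrA ?subrr ?sub0r // -opprD E.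
Qed.

(** At $v=u-1$ the factor [W - P *+ 2] vanishes, which leaves $e(u-1)k(u)=k(u)e(u)$; then $u$ is
    shifted by $\frac12$. *)
Lemma y_em_kp : yem * G = G * yep.
Proof.
have E : fshift (-1 : F) e * yk = yk * e.
  have := congr1 (ev (-1 : F)) y_ke.
  rewrite ?(rmorphD, rmorphN, rmorphM, rmorphMn) /= !ev_iu !ev_iv ev1_fW // => E.
  apply: (ev_fp_lreg two0 (c := -1)); apply: (fps_two_inj two0).
  by nc_by (@ev_fp_central F A (-1)) (@ev_fp_central F A (-1)) (- nc_gap E).
have := congr1 (fshift hf) E; rewrite !rmorphM /= fshiftD half_half.
by rewrite /yk fshiftD subrr fshift_0.
Qed.
Lemma y_kp_fm : G * yfm = yfp * G.
Proof.
have E : yk * fshift (-1 : F) f = f * yk.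
  have := congr1 (ev (-1 : F)) y_kf.
  rewrite ?(rmorphD, rmorphN, rmorphM, rmorphMn) /= !ev_iu !ev_iv ev1_fW // => E.
  apply: (ev_fp_lreg two0 (c := -1)); apply: (fps_two_inj two0).
  by nc_by (@ev_fp_central F A (-1)) (@ev_fp_central F A (-1)) (nc_gap E).
have := congr1 (fshift hf) E; rewrite !rmorphM /= fshiftD half_half.
by rewrite /yk fshiftD subrr fshift_0.
Qed.

Definition ye0 : fps A := cst (e 1%N).
Definition yf0 : fps A := cst (f 1%N).

Lemma y_shift_rel : shift_rel yk H yHm e f yem yfm ye13 yf31.
Proof.
have two13 (x : fps A) : - (hf *: x) *+ 2 = - x.
  by rewrite mulNrn -scaler_nat scalerA two_hf scale1r.
split; rewrite ?two13 //.
- exact: y_k_H.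
- by rewrite /yHm /yk -rmorphM HG rmorph1.
- by rewrite /yHm /yk -rmorphM y_GH rmorph1.
- exact: y_H_em.
- exact: y_fm_H.
Qed.

Lemma iv_coef0 (x : fps A) : iv x 0%N = cst (x 0%N). Proof. by []. Qed.
Lemma iu_coef0 (x : fps A) : iu x 0%N = x. Proof. by []. Qed.

Lemma y_e0_rel : e0_rel ye0 yk H yHm e f yfm.
Proof.
have Hm1 : yHm = fshift (- hf) H by [].
have e0f : ye0 * f - f * ye0 = 1 - H.
  have E : W * bracket f e = P * (iv H - iu H) *+ 2.
    have := congr1 (@swapuv _ A) (ds_ef ds); rewrite /bracket.
    rewrite ?(rmorphD, rmorphN, rmorphM, rmorphMn) /= swapuv_fW swapuv_fp !swapuv_iu !swapuv_iv => E.
    nc_by cW cP (nc_gap E).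
  rewrite -mulrnAr in E; have := bracket_first two0 (ds_e0 ds) E.
  rewrite fpsMn fpsB iv_coef0 iu_coef0 (ds_H0 ds) rmorph1 => /(fps_two_inj two0).
  exact.
split=> //.
- have E : W * bracket yk e = P * (iu yk * iv e - iu yk * iu e) *+ 2.
    rewrite /bracket; have E := y_ke; nc_by cW cP (nc_gap E).
  rewrite -mulrnAr in E; have := bracket_first two0 (ds_e0 ds) E.
  rewrite fpsMn fpsB !fpsM0 iv_coef0 !iu_coef0 (ds_e0 ds) rmorph0 mulr0 sub0r => /(fps_two_inj two0).
  exact.
- have := bracket_first two0 (ds_e0 ds) (ds_He ds); rewrite fpsB iu_coef0.
  rewrite /abracket fpsD !fpsM0 iv_coef0 !iu_coef0 (ds_e0 ds) rmorph0 mulr0 mul0r addr0 subr0.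
  exact.
- have := bracket_first two0 (ds_e0 ds) (ds_ee ds); rewrite !fpsM0 fpsB iu_coef0 iv_coef0.
  by rewrite (ds_e0 ds) rmorph0 subr0.
- have := congr1 (fshift (- hf)) e0f.
  by rewrite !rmorphB !rmorphM rmorph1 /= fshift_cst.
Qed.

(** Stated in the opposite ring, so that [gaussT_equivE] applies with $e$ and $f$ exchanged. *)
Lemma y_f0_rel : e0_rel (yf0 : (fps A)^c) yk H yHm f e yem.
Proof.
have f0e : yf0 * e - e * yf0 = H - 1.
  have E := ds_ef ds; rewrite -mulrnAr in E; have := bracket_first two0 (ds_f0 ds) E.
  rewrite fpsMn fpsB iv_coef0 iu_coef0 (ds_H0 ds) rmorph1 => /(fps_two_inj two0).
  exact.
have flip2 (x y z : fps A) : (x - y) *+ 2 = z -> (y - x) *+ 2 = - z.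
  by move=> <-; rewrite -mulNrn opprB.
split; rewrite !converseM.
- have E : W * bracket yk f = P * (iu f * iu yk - iv f * iu yk) *+ 2.
    rewrite /bracket; have E := y_kf; nc_by cW cP (nc_gap E).
  rewrite -mulrnAr in E; have := bracket_first two0 (ds_f0 ds) E.
  rewrite fpsMn fpsB !fpsM0 iv_coef0 !iu_coef0 (ds_f0 ds) rmorph0 mul0r subr0 => /(fps_two_inj two0) E1.
  by rewrite -E1 opprB.
- have := bracket_first two0 (ds_f0 ds) (ds_Hf ds); rewrite fpsB iu_coef0.
  rewrite /abracket fpsD !fpsM0 iv_coef0 !iu_coef0 (ds_f0 ds) rmorph0 mulr0 mul0r addr0 sub0r.
  by move/flip2 => E1; apply: etrans E1 _; rewrite opprK addrC.
- have E := ds_ff ds; rewrite -mulrN in E; have := bracket_first two0 (ds_f0 ds) E; rewrite fpsN !fpsM0 fpsB iu_coef0 iv_coef0.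
  rewrite (ds_f0 ds) rmorph0 subr0 => /flip2 E1.
  by apply: etrans E1 _; rewrite opprK.
- by rewrite -[LHS]opprB f0e opprB.
- have := congr1 (fshift (- hf)) f0e.
  rewrite !rmorphB !rmorphM rmorph1 /= fshift_cst => E1.
  by rewrite -[LHS]opprB E1 opprB.
Qed.
End YSide.

Section ConverseGauss.
Variable S : pzRingType.

Lemma shift_rel_converse (k H Hm e f em fm e13 f31 : S) :
  shift_rel k H Hm e f em fm e13 f31 ->
  shift_rel (k : S^c) (H : S^c) Hm f e fm em f31 e13.
Proof.
case=> kH Hmk kHm Hem fmH E13 F31; split; rewrite ?converseM //.
Qed.

Lemma gaussT_converse (k H e f em fm e13 f31 : S) : k * H = H * k ->
  opT (gaussT k H e f em fm e13 f31) = gaussT (k : S^c) (H : S^c) f e fm em f31 e13.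
Proof.
move=> kH; apply: funext => a; apply: funext => c; rewrite /opT /gaussT.
case_I3 a; case_I3 c => //=; rewrite ?converseM ?mulrA //.
- by rewrite kH.
- by rewrite -(mulrA fm k) kH mulrA.
- by rewrite kH.
- by rewrite -(mulrA fm k) kH mulrA.
Qed.

Lemma equivF_of_converse (z : S) T : equivE (z : S^c) (opT T) -> equivF z T.
Proof.
move=> H a c; have := H c a; rewrite !converseM /opT => E.
rewrite -[LHS]opprB.
by apply: etrans (congr1 -%R E) _; exact: opprB.
Qed.

Lemma gaussT_equivF (f0 k H Hm e f em fm e13 f31 : S) :
  (forall x : S, x *+ 2 = 0 -> x = 0) ->
  shift_rel k H Hm e f em fm e13 f31 -> e0_rel (f0 : S^c) k H Hm f e em ->
  equivF f0 (gaussT k H e f em fm e13 f31).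
Proof.
move=> two rel f0r; apply: equivF_of_converse; rewrite (gaussT_converse _ _ _ _ _ _ (rel_kH rel)).
exact: (gaussT_equivE (S := S^c) two (shift_rel_converse rel) f0r).
Qed.
End ConverseGauss.

Section Cross.
Variables (F : fieldType) (A : algType F).
Hypothesis two0 : (2%:R : F) != 0.
Local Notation W := (fW A).
Local Notation P := (fp A).
Local Notation hf := ((2%:R : F)^-1).
Let cW := @fW_central F A.
Let cP := @fp_central F A.

Lemma rtt_defect_scale (S : pzRingType) (q w p : S) T T' a b c d : central q ->
  q * q * rtt_defect w p T T' a b c d = rtt_defect (q * w) (q * p) T T' a b c d.
Proof.
by move=> cq; rewrite /rtt_defect; case: ifP => _; case: ifP => _; nc cq cq.
Qed.

(** Exchanging $u$ and $v$ and then setting $v:=v+\frac12$ sends $2(u-v)$ to $1-2(u-v)$, the crossed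
    parameter. The denominators are absorbed because the defect is homogeneous of degree 2 in [w],
    [p]. *)
Lemma rtt_defect_cross (T : 'I_3 -> 'I_3 -> fps A) a b c d :
  rtt_defect W P (fun x y => iu (T x y)) (fun x y => iv (T x y)) a b c d = 0 ->
  rtt_defect (P - W) P (fun x y => iv (fshift hf (T x y))) (fun x y => iu (T x y)) a b c d = 0.
Proof.
have Tpv : (fun x y => iv (fshift hf (T x y))) = (fun x y => fshift hf (swapuv (iu (T x y)))).
  by apply: funext => x; apply: funext => y; rewrite swapuv_iu shv_iv.
have Tu : (fun x y => iu (T x y)) = (fun x y => fshift hf (swapuv (iv (T x y)))).
  by apply: funext => x; apply: funext => y; rewrite swapuv_iv shv_iu.
pose q := 1 + hf *: fX (fps A).
have qW : q * fshift hf W = W - P by rewrite shv_fW // divff // scale1r.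
have qP : q * fshift hf P = P by exact: shv_fp.
move=> /(congr1 (@swapuv _ A)) E; rewrite rtt_defect_morph rmorph0 /= swapuv_fW swapuv_fp in E.
have {}E := congr1 (fshift hf) E; rewrite rtt_defect_morph rmorph0 rmorphN /= in E.
have {}E := congr1 (fun x => q * q * x) E.
rewrite /= rtt_defect_scale ?mulr0 ?mulrN ?qW ?qP ?opprB in E; last exact: qv_central.
by rewrite Tpv [X in rtt_defect _ _ _ X]Tu; apply: E.
Qed.
End Cross.

Section YRtt.
Variables (F : fieldType) (A : algType F) (H e f G : fps A).
Hypotheses (two0 : (2%:R : F) != 0) (ds : dseries H e f) (HG : H * G = 1).
Local Notation W := (fW A).
Local Notation P := (fp A).
Local Notation hf := ((2%:R : F)^-1).
Local Notation k := (yk G).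
Let cW := @fW_central F A.
Let cP := @fp_central F A.

Definition yT : 'I_3 -> 'I_3 -> fps A :=
  gaussT k H e f (yem e) (yfm f) (ye13 e) (yf31 f).
Definition yTp : 'I_3 -> 'I_3 -> fps A := fun a c => fshift hf (yT a c).

Let rel := y_shift_rel two0 ds HG.
Let two := fps_two_reg two0 (A := A).

Lemma yT_equivE : equivE (ye0 e) yT.
Proof. exact: gaussT_equivE two rel (y_e0_rel two0 ds HG). Qed.
Lemma yT_equivF : equivF (yf0 f) yT.
Proof. exact: gaussT_equivF two rel (y_f0_rel two0 ds HG). Qed.

Lemma yTpE : yTp = gaussT G (fshift hf H) (yep e) (yfp f) e f
  (fshift hf (ye13 e)) (fshift hf (yf31 f)).
Proof.
apply: funext => a; apply: funext => c; rewrite /yTp /yT gaussT_morph /=.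
by rewrite /yk /yem /yfm !fshiftD !subrr !fshift_0.
Qed.
Lemma y_shift_relp : shift_rel G (fshift hf H) H (yep e) (yfp f) e f
  (fshift hf (ye13 e)) (fshift hf (yf31 f)).
Proof.
have := shift_rel_morph (fshift hf) rel.
by rewrite /yk /yHm /yem /yfm /= !fshiftD !subrr !fshift_0.
Qed.

Lemma yTp_equivE : equivE (ye0 e) yTp.
Proof. by have := equivE_morph (fshift hf) yT_equivE; rewrite /= fshift_cst. Qed.
Lemma yTp_equivF : equivF (yf0 f) yTp.
Proof. by have := equivF_morph (fshift hf) yT_equivF; rewrite /= fshift_cst. Qed.

Lemma yT_orth a c : prod3 yT (transT yTp) a c = (a == c)%:R.
Proof.
have H1 := @gaussT_orth _ (yf0 f) _ _ _ _ _ _ _ _ _ _ _ _ _ _ _ rel y_shift_relp two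
  (esym (y_em_kp two0 ds HG)) (y_e_em two0 ds) yT_equivF.
by have := yTp_equivF; rewrite yTpE => /H1 ->.
Qed.

Lemma yT_orth' a c : prod3 (transT yTp) yT a c = (a == c)%:R.
Proof.
have relc := shift_rel_converse rel; have relpc := shift_rel_converse y_shift_relp.
have ec := equivF_converse yT_equivE; have epc := equivF_converse yTp_equivE.
rewrite /yT (gaussT_converse _ _ _ _ _ _ (rel_kH rel)) in ec.
rewrite yTpE (gaussT_converse _ _ _ _ _ _ (rel_kH y_shift_relp)) in epc.
have := @gaussT_orth ((fps A)^c) (ye0 e) _ _ _ _ _ _ _ _ _ _ _ _ _ _ _ relc relpc two
  (esym (y_kp_fm two0 ds HG)) (y_fm_f two0 ds) ec epc c a.
rewrite -(gaussT_converse _ _ _ _ _ _ (rel_kH rel)).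
rewrite -(gaussT_converse _ _ _ _ _ _ (rel_kH y_shift_relp)) -yTpE.
rewrite /prod3 /transT /opT !converseM eq_sym => E.
by apply: etrans E.
Qed.
Local Notation Tu := (fun a c => iu (yT a c)).
Local Notation Tv := (fun a c => iv (yT a c)).
Local Notation Tpv := (fun a c => iv (yTp a c)).

Lemma iu_yT_equivE : equivE (iu (ye0 e)) Tu.
Proof. have := @equivE_morph _ _ (@cst _ _) _ _ yT_equivE; exact. Qed.
Lemma iu_yT_equivF : equivF (iu (yf0 f)) Tu.
Proof. have := @equivF_morph _ _ (@cst _ _) _ _ yT_equivF; exact. Qed.
Lemma iv_yT_equivE : equivE (iu (ye0 e)) Tv.
Proof. by have := equivE_morph (fmap (@cst _ A)) yT_equivE; rewrite /= fmap_cst. Qed.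
Lemma iv_yT_equivF : equivF (iu (yf0 f)) Tv.
Proof. by have := equivF_morph (fmap (@cst _ A)) yT_equivF; rewrite /= fmap_cst. Qed.

Lemma y_row1_rel : row1_rel W P (iu k) (iu e) (iv k) (iv e).
Proof.
have ke := y_ke two0 ds HG; split=> //.
- exact: (y_uk_vk ds HG).
- have := congr1 (@swapuv _ A) ke.
  rewrite ?(rmorphD, rmorphN, rmorphM, rmorphMn) /= swapuv_fW swapuv_fp !swapuv_iu !swapuv_iv => E.
  nc_by cW cP (nc_gap E).
- have := ds_ee ds; rewrite /bracket => E; nc_by cW cP (nc_gap E).
Qed.

Lemma y_col1_rel : row1_rel (W : (fps (fps A))^c) (P : (fps (fps A))^c) (iu k) (iu f) (iv k) (iv f).
Proof.
have kf := y_kf two0 ds HG; split; rewrite ?converseM.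
- by apply: esym; apply: y_uk_vk ds HG.
- nc_by cW cP (- nc_gap kf).
- have := congr1 (@swapuv _ A) kf.
  rewrite ?(rmorphD, rmorphN, rmorphM, rmorphMn) /= swapuv_fW swapuv_fp !swapuv_iu !swapuv_iv => E.
  nc_by cW cP (- nc_gap E).
- have := ds_ff ds; rewrite /bracket => E; nc_by cW cP (- nc_gap E).
Qed.

Lemma half_double2 (x : fps A) : - (hf *: x) *+ 2 = - x.
Proof. by rewrite mulNrn -scaler_nat scalerA two_hf // scale1r. Qed.

Lemma y_row1_of : row1_of k e yT.
Proof.
split=> //; rewrite /yT /gaussT /= /ye13.
by rewrite -mulrnAr half_double2 mulrN mulrA.
Qed.
Lemma y_col1_of : row1_of (k : (fps A)^c) f (opT yT).
Proof.
have E : yf31 f * k *+ 2 = - (f * f * k) by rewrite /yf31 -mulrnAl half_double2 mulNr.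
by split=> //; apply: etrans E _; rewrite !converseM mulrA.
Qed.

Lemma row1_of_morph (R S : pzRingType) (phi : {rmorphism R -> S}) x y T :
  row1_of x y T -> row1_of (phi x) (phi y) (fun a c => phi (T a c)).
Proof.
case=> t1 t2 t3; split; rewrite ?t1 ?t2 ?rmorphM //.
by rewrite -rmorphMn t3 rmorphN !rmorphM.
Qed.
Lemma row1_of_morph_converse (R S : pzRingType) (phi : {rmorphism R -> S}) x y T :
  row1_of (x : R^c) y (opT T) -> row1_of (phi x : S^c) (phi y) (opT (fun a c => phi (T a c))).
Proof.
case; rewrite /opT !converseM => t1 t2 t3; split; rewrite ?converseM /= ?t1 ?t2 ?rmorphM //.
by apply: etrans (esym (rmorphMn phi _ _)) _; rewrite (congr1 phi t3) rmorphN !rmorphM.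
Qed.

Theorem yT_rtt a b c d : rtt_defect W P Tu Tv a b c d = 0.
Proof.
have eT := iu_yT_equivE; have eT' := iv_yT_equivE.
have fT := iu_yT_equivF; have fT' := iv_yT_equivF.
have r1 := row1_of_morph (@cst _ _) y_row1_of; have r1' := row1_of_morph (fmap (@cst _ A)) y_row1_of.
have rl := y_row1_rel.
have D1 : rtt_defect W P Tu Tv im1 im1 im1 im1 = 0 := rtt_row1_1111 cW cP rl r1 r1'.
have D2 : rtt_defect W P Tu Tv im1 im1 im1 i0 = 0 := rtt_row1_1112 cW cP rl r1 r1'.
have D3 : rtt_defect W P Tu Tv im1 im1 i0 i0 = 0 := rtt_row1_1122 cW cP rl r1 r1' (@fW_lreg _ A).
(* All entries with row pair $(-1,-1)$ vanish; the opposite ring then gives the column pair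
   $(-1,-1)$. *)
have row11 := rtt_row11 cW cP eT eT' D1 D2 D3.
have cWc := central_converse cW; have cPc := central_converse cP.
have eTc := equivE_converse fT; have eTc' := equivE_converse fT'.
have fTc := equivF_converse eT; have fTc' := equivF_converse eT'.
have c1 := row1_of_morph_converse (@cst _ _) y_col1_of.
have c1' := row1_of_morph_converse (fmap (@cst _ A)) y_col1_of.
have rc := y_col1_rel.
have D1c := rtt_row1_1111 cWc cPc rc c1 c1'.
have D2c := rtt_row1_1112 cWc cPc rc c1 c1'.
have rW : GRing.lreg (W : (fps (fps A))^c).
  by move=> x y; rewrite !converseM -!cW => /(@fW_lreg _ A).
have D3c := rtt_row1_1122 cWc cPc rc c1 c1' rW.
have row11c := rtt_row11 cWc cPc eTc eTc' D1c D2c D3c.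
have flip a' b' c' d' : rtt_defect (W : (fps (fps A))^c) P (opT Tu) (opT Tv) a' b' c' d' = 0 ->
    rtt_defect W P Tu Tv c' d' a' b' = 0.
  by rewrite (rtt_defect_converse cW cP) => /eqP; rewrite oppr_eq0 => /eqP.
have flop a' b' c' d' : rtt_defect W P Tu Tv c' d' a' b' = 0 ->
    rtt_defect (W : (fps (fps A))^c) P (opT Tu) (opT Tv) a' b' c' d' = 0.
  by rewrite (rtt_defect_converse cW cP) => ->; exact: oppr0.
have col11 a' b' : rtt_defect W P Tu Tv a' b' im1 im1 = 0 by apply: flip; apply: row11c.
have M : rtt_defect W P Tu Tv im1 i0 im1 i0 = 0.
  apply: (rtt_minor cW cP (k := iu k) (e := iu e) (f := iu f)
    (k' := iv k) (e' := iv e) (f' := iv f) (H' := iv H)).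
  - exact: y_uk_vk ds HG.
  - exact: y_uk_vH ds HG.
  - exact: y_ke two0 ds HG.
  - exact: y_kf two0 ds HG.
  - by [].
  - exact: iuM.
  - exact: iuM.
  - exact: ivM.
  - exact: ivM.
  - by rewrite /yT /gaussT /= !ivE.
pose Tpu := fun x y => iv (yTp x y).
(* By orthogonality the last column of $T(v)^{-1}$ is that of $T^t(v+\frac12)$; [yc] is its analogue
   in the opposite ring. *)
pose y d' := iv (yTp im1 (negI d')); pose yc d' : (fps (fps A))^c := iv (yTp (negI d') im1).
have negK x : negI (negI x) = x by exact: rev_ordK.
have Y b' : iv (yT b' im1) * y im1 + iv (yT b' i0) * y i0 + iv (yT b' ip1) * y ip1 = (b' == ip1)%:R.
  have := congr1 (fmap (@cst _ A)) (yT_orth b' ip1).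
  by rewrite rmorph_nat /prod3 /transT negI_p1 !ivE.
have Yc b' : (opT Tv b' im1 : (fps (fps A))^c) * yc im1 + opT Tv b' i0 * yc i0
    + opT Tv b' ip1 * yc ip1 = (b' == ip1)%:R.
  have := congr1 (fmap (@cst _ A)) (yT_orth' ip1 b').
  by rewrite rmorph_nat /prod3 /transT negI_p1 !ivE eq_sym.
have X c' : rtt_defect (P - W) P Tpu Tu im1 im1 c' im1 = 0.
  exact: rtt_defect_cross (row11 c' im1).
have Xc c' : rtt_defect ((P - W) : (fps (fps A))^c) P (opT Tpu) (opT Tu) im1 im1 c' im1 = 0.
  rewrite rtt_defect_converse //; last first.
    by move=> x; rewrite mulrBl mulrBr cW cP.
  by apply/eqP; rewrite oppr_eq0; apply/eqP; apply: rtt_defect_cross (col11 c' im1).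
have cr b' : b' != im1 -> row_crossing W P Tu Tv y b'.
  apply: (rtt_crossing cW cP (T'' := Tpu)) => // c'; by rewrite /y negK.
have crc b' : b' != im1 -> row_crossing (W : (fps (fps A))^c) P (opT Tu) (opT Tv) yc b'.
  apply: (rtt_crossing cWc cPc (T'' := opT Tpu)) => // c'; by rewrite /yc negK.
have y3 : y ip1 = iv G by rewrite /y negI_p1 yTpE.
have yc3 : yc ip1 = iv G by rewrite /yc negI_p1 yTpE.
have G0 : iv G 0%N = 1.
  have := congr1 (fun x : fps A => x 0%N) HG; rewrite fpsM0 (ds_H0 ds) mul1r fps1 => G0.
  by rewrite iv_coef0 G0 rmorph1.
have yr : GRing.rreg (y ip1) by rewrite y3; apply: rreg_fps.
have ycr : GRing.rreg (yc ip1).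
  by rewrite yc3 => x z; rewrite !converseM => /(@lreg_fps _ _ (iv G) G0).
(* Row pair $(-1,0)$ of the transposed problem, that is, column pair $(-1,0)$ of the original
   one. *)
have row12c c' d' := rtt_row12 cWc cPc eTc eTc' D1c D2c D3c ycr
   (flop _ _ _ _ D2) (flop _ _ _ _ M) c' d' (crc i0 isT).
apply: (rtt_zero cW cP eT eT' fT fT' D1 D2 D3 yr (col11 im1 i0) M (cr i0 isT) (cr ip1 isT)) => a' b'.
- exact: col11.
- by apply: flip; apply: row12c.
Qed.
End YRtt.

(** * Comparison with the Laurent coefficients *)

Section LaurentCoefficients.
Variables (F : fieldType) (A : algType F).
Hypothesis two0 : (2%:R : F) != 0.
Implicit Types g h : fps (fps A).
Local Notation W := (fW A).
Local Notation P := (fp A).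

(** The arguments are swapped because the outer index of a double series counts powers of
    $v^{-1}$. *)
Definition bigc g : int -> int -> A := coef2 (fun p q => g q p).

Lemma bigcD g h m n : bigc (g + h) m n = bigc g m n + bigc h m n.
Proof. by rewrite /bigc /coef2; case: ifP; rewrite ?addr0. Qed.
Lemma bigcZ (c : F) g m n : bigc (c *: g) m n = c *: bigc g m n.
Proof. by rewrite /bigc /coef2; case: ifP; rewrite ?scaler0. Qed.
Lemma bigc_sum I (r : seq I) (f : I -> fps (fps A)) m n :
  bigc (\sum_(i <- r) f i) m n = \sum_(i <- r) bigc (f i) m n.
Proof.
elim/big_rec2: _ => [|i x y _ <-]; last exact: bigcD.
by rewrite /bigc /coef2; case: ifP.
Qed.

Lemma bigc_inj g h : (forall m n, bigc g m n = bigc h m n) -> g = h.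
Proof.
move=> H; apply: fpsP => n; apply: fpsP => m; have := H (- (m%:Z)) (- (n%:Z)).
by rewrite /bigc /coef2 !oppr_le0 /= !abszN.
Qed.

(** Since [fW] is $(u-v)/(uv)$, it differs from $u-v$ by a shift of both exponents. The boundary
    cases are $m=1$ or $n=1$, where the product may have a coefficient although the series has
    none. *)
Lemma mulW_bigc g m n : mulW (bigc g) m n = bigc (W * g) (m - 1) (n - 1).
Proof.
rewrite /mulW /bigc /coef2 fWM_coef.
case: (lerP (m - 1) 0) => m1; case: (lerP (n - 1) 0) => n1 /=.
- rewrite !andbT; congr (_ - _).
  + case: (lerP n 0) => n0; last by have -> : `|n - 1|%N = 0%N by lia.
    by have -> : `|n - 1|%N = `|n|%N.+1 by lia.
  + case: (lerP m 0) => m0; last by have -> : `|m - 1|%N = 0%N by lia.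
    by have -> : `|m - 1|%N = `|m|%N.+1 by lia.
- have -> : (n <= 0) = false by lia.
  by rewrite !andbF subrr.
- have -> : (m <= 0) = false by lia.
  by rewrite subr0.
- by rewrite andbF subrr.
Qed.

Lemma bigc_fp g m n : bigc (P * g *+ 2) (m - 1) (n - 1) = bigc g m n.
Proof.
rewrite /bigc /coef2 fpsMn fpsMn fpM_coef.
case: (lerP (m - 1) 0) => m1; case: (lerP (n - 1) 0) => n1 /=.
- case: (lerP m 0) => m0; last first.
    have -> : `|m - 1|%N = 0%N by lia.
    by case: `|n - 1|%N => [|?]; rewrite /= mul0rn.
  case: (lerP n 0) => n0; last first.
    have -> : `|n - 1|%N = 0%N by lia.
    by rewrite /= mul0rn.
  have -> : `|m - 1|%N = `|m|%N.+1 by lia.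
  have -> : `|n - 1|%N = `|n|%N.+1 by lia.
  by rewrite -scaler_nat scalerA divff // scale1r.
- have -> : (n <= 0) = false by lia.
  by rewrite !andbF.
- by have -> : (m <= 0) = false by lia.
- have -> : (n <= 0) = false by lia.
  by rewrite andbF.
Qed.

(* The value at [w = 2 (u - v) : p = 1], homogenized to degree 2. *)
Definition homog (q : {poly F}) : fps (fps A) :=
  (q`_0 *+ 4) *: (P * P) + (q`_1 *+ 2) *: (P * W) + q`_2 *: (W * W).

Lemma pevalW_bigc (q : {poly F}) g m n : (size q <= 3)%N ->
  pevalW q (bigc g) m n = bigc (homog q * g) (m - 1 - 1) (n - 1 - 1).
Proof.
move=> sq.
transitivity (\sum_(i < 3) q`_i *: iter i (@mulW F A) (bigc g) m n).
  rewrite /pevalW (big_ord_widen _ (fun i => q`_i *: iter i (@mulW F A) (bigc g) m n) sq).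
  rewrite big_mkcond; apply: eq_bigr => i _; case: ltnP => // si.
  by rewrite nth_default // scale0r.
rewrite !big_ord_recl big_ord0 addr0 /= !addrA.
have E2 : mulW (mulW (bigc g)) m n = bigc (W * (W * g)) (m - 1 - 1) (n - 1 - 1).
  by rewrite {1}/mulW !mulW_bigc -[RHS]mulW_bigc.
have E1 : mulW (bigc g) m n = bigc (P * (W * g) *+ 2) (m - 1 - 1) (n - 1 - 1).
  by rewrite bigc_fp mulW_bigc.
have E0 : bigc g m n = bigc (P * (P * g) *+ 4) (m - 1 - 1) (n - 1 - 1).
  have -> : P * (P * g) *+ 4 = P * (P * g *+ 2) *+ 2 by rewrite !mulrnAr -mulrnA.
  by rewrite !bigc_fp.
rewrite E2 E1 E0 -!bigcZ -!bigcD; congr (bigc _ _ _).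
by rewrite /homog !mulrDl -!scalerAl -!mulrA -!scalerMnl !scalerMnr.
Qed.
Lemma homogD q r : homog (q + r) = homog q + homog r.
Proof.
rewrite /homog !coefD !mulrnDl !scalerDl.
by rewrite [RHS]addrACA; congr (_ + _); rewrite [RHS]addrACA.
Qed.
Lemma homogN q : homog (- q) = - homog q.
Proof. by rewrite /homog !coefN !mulNrn !scaleNr !opprD. Qed.
Lemma homog0 : homog 0 = 0.
Proof. by rewrite /homog !coef0 !mul0rn !scale0r !addr0. Qed.

Local Notation half := ((2%:R : F)^-1).

Lemma homog_Rpoly a b x y : homog (Rpoly F a b x y) =
  (W * (W - P)) *+ ((a == x) && (b == y))
  - (P * (W - P) *+ 2) *+ ((a == y) && (b == x))
  + (P * W *+ 2) *+ ((b == negI a) && (y == negI x)).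
Proof.
have h2 : half *+ 2 = 1 by rewrite -(mulr_natl half 2) divff.
have hX : homog (polyX F) = P * W *+ 2.
  by rewrite /homog !coefX /= mul0rn !scale0r add0r addr0 -scalerMnl scale1r.
have hL : homog ('X - half%:P) = P * (W - P) *+ 2.
  rewrite homogD homogN hX /homog !coefC /= mul0rn !scale0r !addr0 (mulrnA _ 2 2) h2.
  by rewrite mulrBr mulrnBl -scalerMnl scale1r.
have hQ : homog ('X * ('X - half%:P)) = W * (W - P).
  rewrite /homog !coefXM !coefB !coefX !coefC /= mul0rn scale0r add0r sub0r subr0.
  by rewrite mulNrn h2 scaleN1r scale1r addrC mulrBr (@fp_central _ A W).
have hn (q : {poly F}) (c : bool) : homog (q *+ c) = homog q *+ c.
  by case: c; rewrite ?mulr1n // !mulr0n homog0.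
by rewrite /Rpoly homogD homogD homogN !hn hX hL hQ.
Qed.

Lemma size_Rpoly a b x y : (size (Rpoly F a b x y) <= 3)%N.
Proof.
have sl : (size ('X - half%:P)%R <= 2)%N by rewrite size_XsubC.
have sq : (size ('X * ('X - half%:P))%R <= 3)%N.
  by rewrite (leq_trans (size_polyMleq _ _)) // size_polyX size_XsubC.
have sb (q : {poly F}) (c : bool) : (size q <= 3)%N -> (size (q *+ c)%R <= 3)%N.
  by case: c; rewrite ?mulr1n // mulr0n size_poly0.
rewrite /Rpoly (leq_trans (size_polyD _ _)) // geq_max; apply/andP; split.
  rewrite (leq_trans (size_polyD _ _)) // geq_max size_polyN; apply/andP; split; apply: sb => //.
  by rewrite (leq_trans sl).
by apply: sb; rewrite size_polyX.
Qed.
End LaurentCoefficients.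

Section RttRelation.
Variables (F : fieldType) (A : algType F).
Hypothesis two0 : (2%:R : F) != 0.
Local Notation W := (fW A).
Local Notation P := (fp A).

Lemma sum_delta2 (S : pzRingType) (c : S) (a b : 'I_3) (g : 'I_3 -> 'I_3 -> S) :
  \sum_(x < 3) \sum_(y < 3) (c *+ ((a == x) && (b == y))) * g x y = c * g a b.
Proof.
rewrite (bigD1 a) //= [X in _ + X]big1 ?addr0; last first.
  by move=> x xa; rewrite big1 // => y _; rewrite eq_sym (negPf xa) mul0r.
rewrite (bigD1 b) //= !eqxx mulr1n big1 ?addr0 // => y yb.
by rewrite [b == y]eq_sym (negPf yb) andbF mul0r.
Qed.

Lemma sum3 (V : zmodType) (g : 'I_3 -> V) : \sum_(x < 3) g x = g im1 + g i0 + g ip1.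
Proof.
rewrite !big_ord_recl big_ord0 addr0 addrA.
by congr (g _ + g _ + g _); apply: val_inj.
Qed.

Lemma negI_sum (a b : 'I_3) : (b == negI a) = (a + b == 2)%N.
Proof. by case_I3 a; case_I3 b. Qed.

Lemma sum_deltaQ (S : pzRingType) (c : S) (a b : 'I_3) (g : 'I_3 -> 'I_3 -> S) :
  \sum_(x < 3) \sum_(y < 3) (c *+ ((b == negI a) && (y == negI x))) * g x y
  = if (a + b == 2)%N then c * (g im1 ip1 + g i0 i0 + g ip1 im1) else 0.
Proof.
rewrite -negI_sum; case: ifP => _; last first.
  by rewrite big1 // => x _; rewrite big1 // => y _; rewrite mul0r.
rewrite !sum3 /= !mulr0n !mulr1n !mul0r !addr0 !add0r.
by rewrite !mulrDr.
Qed.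

Variable T : 'I_3 -> 'I_3 -> fps A.
Local Notation G x c y d := (iu (T x c) * iv (T y d)).
Local Notation G' x c y d := (iv (T y d) * iu (T x c)).

Lemma rtt_defectE a b c d :
  \sum_(x < 3) \sum_(y < 3) homog A (Rpoly F a b x y) * G x c y d
  - \sum_(x < 3) \sum_(y < 3) homog A (Rpoly F x y c d) * G' a x b y
  = rtt_defect W P (fun a c => iu (T a c)) (fun a c => iv (T a c)) a b c d.
Proof.
transitivity ((W * (W - P) * G a c b d - P * (W - P) *+ 2 * G b c a d
  + (if (a + b == 2)%N then P * W *+ 2 * (G im1 c ip1 d + G i0 c i0 d + G ip1 c im1 d) else 0))
  - (W * (W - P) * G' a c b d - P * (W - P) *+ 2 * G' a d b c
  + (if (c + d == 2)%N then P * W *+ 2 * (G' a im1 b ip1 + G' a i0 b i0 + G' a ip1 b im1) else 0))).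
  congr (_ - _).
  - rewrite -(sum_delta2 (W * (W - P)) a b (fun x y => G x c y d)).
    rewrite -(sum_delta2 (P * (W - P) *+ 2) b a (fun x y => G x c y d)).
    rewrite -(sum_deltaQ (P * W *+ 2) a b (fun x y => G x c y d)) -sumrB -big_split /=.
    apply: eq_bigr => x _; rewrite -sumrB -big_split /=; apply: eq_bigr => y _.
    by rewrite homog_Rpoly // -mulrBl -mulrDl [(a == y) && _]andbC.
  - rewrite -(sum_delta2 (W * (W - P)) c d (fun x y => G' a x b y)).
    rewrite -(sum_delta2 (P * (W - P) *+ 2) d c (fun x y => G' a x b y)).
    rewrite -(sum_deltaQ (P * W *+ 2) c d (fun x y => G' a x b y)) -sumrB -big_split /=.
    apply: eq_bigr => x _; rewrite -sumrB -big_split /=; apply: eq_bigr => y _.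
    rewrite homog_Rpoly // -mulrBl -mulrDl; congr (_ * _).
    rewrite [x == c]eq_sym [y == d]eq_sym [x == d]eq_sym [y == c]eq_sym.
    by rewrite [(y == negI x) && _]andbC.
have cW := @fW_central F A; have cP := @fp_central F A.
rewrite /rtt_defect; case: ifP => _; case: ifP => _; nc cW cP.
Qed.

Lemma rtt_statementP (a b c d : 'I_3) :
  (forall m n : int,
     \sum_(x < 3) \sum_(y < 3)
        pevalW (Rpoly F a b x y) (coef2 (fun p q => T x c p * T y d q)) m n
   = \sum_(x < 3) \sum_(y < 3)
        pevalW (Rpoly F x y c d) (coef2 (fun p q => T b y q * T a x p)) m n)
  <-> rtt_defect W P (fun a c => iu (T a c)) (fun a c => iv (T a c)) a b c d = 0.
Proof.
have E1 x y m n : pevalW (Rpoly F a b x y) (coef2 (fun p q => T x c p * T y d q)) m n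
    = bigc (homog A (Rpoly F a b x y) * G x c y d) (m - 1 - 1) (n - 1 - 1).
  rewrite -pevalW_bigc ?size_Rpoly // /bigc; congr (pevalW _ (coef2 _) _ _).
  by apply: funext => p; apply: funext => q; rewrite uv_coef.
have E2 x y m n : pevalW (Rpoly F x y c d) (coef2 (fun p q => T b y q * T a x p)) m n
    = bigc (homog A (Rpoly F x y c d) * G' a x b y) (m - 1 - 1) (n - 1 - 1).
  rewrite -pevalW_bigc ?size_Rpoly // /bigc; congr (pevalW _ (coef2 _) _ _).
  by apply: funext => p; apply: funext => q; rewrite vu_coef.
rewrite -rtt_defectE.
set L := \sum_(x < 3) _; set R := \sum_(x < 3) _.
have EL m n : \sum_(x < 3) \sum_(y < 3)
    pevalW (Rpoly F a b x y) (coef2 (fun p q => T x c p * T y d q)) m n = bigc L (m - 1 - 1) (n - 1 - 1).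
  by rewrite bigc_sum; apply: eq_bigr => x _; rewrite bigc_sum; apply: eq_bigr => y _.
have ER m n : \sum_(x < 3) \sum_(y < 3)
    pevalW (Rpoly F x y c d) (coef2 (fun p q => T b y q * T a x p)) m n = bigc R (m - 1 - 1) (n - 1 - 1).
  by rewrite bigc_sum; apply: eq_bigr => x _; rewrite bigc_sum; apply: eq_bigr => y _.
split=> [H|H m n]; last by rewrite EL ER; move/eqP: H; rewrite subr_eq0 => /eqP ->.
apply/eqP; rewrite subr_eq0; apply/eqP/bigc_inj => m n.
by have := H (m + 1 + 1) (n + 1 + 1); rewrite EL ER !addrK.
Qed.
End RttRelation.

(** * From RTT to the Drinfeld relations *)

Lemma rreg_cst (F : fieldType) (A : algType F) (a : A) : GRing.rreg a -> GRing.rreg (cst a).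
Proof.
move=> ra; apply: mulIr0_rreg => x ax; apply: fpsP => n; apply: ra.
by have := congr1 (@^~ n) ax; rewrite Mcst_coef mul0r.
Qed.

Section YRSide.
Variables (F : fieldType) (A : algType F).
Hypothesis (charF0 : [pchar F] =i pred0) (two0 : (2%:R : F) != 0).
Local Notation W := (fW A).
Local Notation P := (fp A).
Local Notation hf := ((2%:R : F)^-1).
Let cW := @fW_central F A.
Let cP := @fp_central F A.
Variable T : 'I_3 -> 'I_3 -> fps A.
Local Notation Tu := (fun a c => iu (T a c)).
Local Notation Tv := (fun a c => iv (T a c)).
Definition Tplus : 'I_3 -> 'I_3 -> fps A := fun a c => fshift hf (T a c).
Hypothesis HD : forall a b c d, rtt_defect W P Tu Tv a b c d = 0.
Hypotheses (O1 : forall a c, prod3 T (transT Tplus) a c = (a == c)%:R)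
           (O2 : forall a c, prod3 (transT Tplus) T a c = (a == c)%:R).
Variables (k k2 k3 ki e e13 e23 f f31 f32 : fps A).
Hypotheses (k0 : k 0%N = 1) (k20 : k2 0%N = 1) (e0 : e 0%N = 0) (f0 : f 0%N = 0)
  (kki : k * ki = 1).
Hypotheses (T11 : T im1 im1 = k) (T12 : T im1 i0 = k * e) (T13 : T im1 ip1 = k * e13)
  (T21 : T i0 im1 = f * k) (T22 : T i0 i0 = f * (k * e) + k2)
  (T23 : T i0 ip1 = f * (k * e13) + k2 * e23)
  (T31 : T ip1 im1 = f31 * k) (T32 : T ip1 i0 = f31 * (k * e) + f32 * k2)
  (T33 : T ip1 ip1 = f31 * (k * e13) + f32 * (k2 * e23) + k3).

Variables (H G em fm : fps A).
Hypotheses (HE : H = ki * k2) (GE : G = fshift hf k).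
Hypotheses (emE : em = fshift (- hf) e) (fmE : fm = fshift (- hf) f).

Lemma r_k2E : k2 = k * H. Proof. by rewrite HE mulrA kki mul1r. Qed.

Lemma r_iuk_lreg : GRing.lreg (iu k). Proof. exact: lreg_cst (lreg_fps k0). Qed.
Lemma r_iuk_rreg : GRing.rreg (iu k). Proof. exact: rreg_cst (rreg_fps k0). Qed.
Lemma r_ivk0 : iv k 0%N = 1. Proof. by rewrite iv_coef0 k0 rmorph1. Qed.
Lemma r_ivk_lreg : GRing.lreg (iv k). Proof. exact: lreg_fps r_ivk0. Qed.
Lemma r_ivk_rreg : GRing.rreg (iv k). Proof. exact: rreg_fps r_ivk0. Qed.
Lemma r_sk0 c : fshift c k 0%N = 1. Proof. by rewrite fshift0. Qed.

Let Tm a c := fshift (-1 : F) (T a c).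
Let P1 := ev (-1 : F) P.
Let cP1 := @ev_fp_central F A (-1).
Let rP1 : GRing.lreg P1 := @ev_fp_lreg F A two0 (-1).
Let two := fps_two_reg two0 (A := A).

(** The specialization $v=u-1$, at which [fW] equals [P1 *+ 2]. *)
Lemma r_HD1 a b c d : rtt_defect (P1 *+ 2) P1 T Tm a b c d = 0.
Proof.
have := congr1 (ev (-1 : F)) (HD a b c d).
rewrite rtt_defect_morph rmorph0 /= ev1_fW // => <-.
congr (rtt_defect _ _ _ _ a b c d); apply: funext => x; apply: funext => y.
- by rewrite ev_iu.
- by rewrite ev_iv.
Qed.

Lemma r_cP1 : central (P1 *+ 2).
Proof. by move=> x; rewrite mulrnAl mulrnAr cP1. Qed.

Lemma r_e13 : e13 *+ 2 = - (e * e) /\ fshift (-1 : F) e * k = k * e.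
Proof.
apply: (@rtt_special_e13 _ (P1 *+ 2) _ cP1 T Tm k e (fshift (-1 : F) k) (fshift (-1 : F) e)
  T11 T12 _ _ e13 (fshift (-1 : F) e13) two rP1 _ _ erefl T13) => [||||| c d].
- by rewrite /Tm T11.
- by rewrite /Tm T12 rmorphM.
- exact: lreg_fps.
- exact: lreg_fps (r_sk0 (-1)).
- by rewrite /Tm T13 rmorphM.
- exact: r_HD1.
Qed.

Lemma r_f31 : f31 *+ 2 = - (f * f) /\ k * fshift (-1 : F) f = f * k.
Proof.
apply: (@rtt_special_e13 (fps A)^c (P1 *+ 2) _ (central_converse cP1) (opT T) (opT Tm)
  k f (fshift (-1 : F) k) (fshift (-1 : F) f) T11 T21 _ _ f31 (fshift (-1 : F) f31) two _ _ _ erefl) => //.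
- by rewrite /opT /Tm T11.
- by rewrite /opT /Tm T21 rmorphM.
- by move=> x y; rewrite !converseM -!cP1; apply: rP1.
- exact: rreg_fps.
- exact: rreg_fps (r_sk0 (-1)).
- by rewrite /opT /Tm T31 rmorphM.
- by move=> c d; rewrite (rtt_defect_converse r_cP1 cP1) r_HD1; exact: oppr0.
Qed.

Let rW := @fW_lreg F A.
Lemma r_WP_lreg : GRing.lreg (W - P). Proof. exact: (@fWpNn_lreg _ A 1). Qed.
Let rW2P := @fWpNn_lreg F A 2.

Lemma r_row1 : row1_rel W P (iu k) (iu e) (iv k) (iv e).
Proof.
have [e13E _] := r_e13.
apply: (row1_rel_of_rtt cW cP (T := Tu) (T' := Tv) _ _ _ _ rW r_WP_lreg rW2P r_iuk_lreg r_ivk_lreg) => //=.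
- by rewrite T11.
- by rewrite T12 iuM.
- by rewrite T11.
- by rewrite T12 ivM.
- by rewrite T13 iuM -mulrnAr -iuMn e13E iuN iuM mulrN mulrA.
- by rewrite T13 ivM -mulrnAr -ivMn e13E ivN ivM mulrN mulrA.
Qed.

Lemma central_lreg_converse (S : pzRingType) (x : S) : central x -> GRing.lreg x -> GRing.lreg (x : S^c).
Proof. by move=> cx rx y z; rewrite !converseM -!cx => /rx. Qed.
Lemma r_WP_central n : central (W - P *+ n).
Proof. by move=> x; rewrite mulrBl mulrBr mulrnAl mulrnAr cW cP. Qed.

Lemma r_col1 : row1_rel (W : (fps (fps A))^c) (P : (fps (fps A))^c) (iu k) (iu f) (iv k) (iv f).
Proof.
have [f31E _] := r_f31.
apply: (row1_rel_of_rtt (central_converse cW) (central_converse cP) (T := opT Tu) (T' := opT Tv)) => //.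
- by rewrite /opT T11.
- by rewrite /opT T21 iuM.
- by rewrite /opT T11.
- by rewrite /opT T21 ivM.
- exact: central_lreg_converse cW rW.
- exact: (central_lreg_converse (r_WP_central 1) r_WP_lreg).
- exact: (central_lreg_converse (r_WP_central 2) rW2P).
- exact: r_iuk_rreg.
- exact: r_ivk_rreg.
- have E : iu (T ip1 im1) *+ 2 = - (iu f * iu f * iu k).
    by rewrite T31 iuM -mulrnAl -iuMn f31E iuN iuM mulNr.
  by apply: etrans E _; rewrite !converseM mulrA.
- have E : iv (T ip1 im1) *+ 2 = - (iv f * iv f * iv k).
    by rewrite T31 ivM -mulrnAl -ivMn f31E ivN ivM mulNr.
  by apply: etrans E _; rewrite !converseM mulrA.
- by move=> c d; rewrite (rtt_defect_converse cW cP) HD; exact: oppr0.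
Qed.

Lemma r_kf : W * iu k * iv f = (W - P *+ 2) * iv f * iu k + P * iu f * iu k *+ 2.
Proof.
case: r_col1 => _ kf _ _; rewrite !converseM in kf.
nc_by cW cP (- nc_gap kf).
Qed.
Lemma r_ff : W * bracket f f = - (P * ((iu f - iv f) * (iu f - iv f))).
Proof.
case: r_col1 => _ _ _ ff; rewrite !converseM in ff; rewrite /bracket.
nc_by cW cP (- nc_gap ff).
Qed.

Lemma r_kHv : iu k * iv H = iv H * iu k.
Proof.
case: r_row1 => kk ke ke' _.
apply: (kH_of_rtt cW cP (T := Tu) (T' := Tv) (k := iu k) (e := iu e) (f := iu f) (k' := iv k)
  (e' := iv e) (f' := iv f) _ _ _ _ _ _ rW r_WP_lreg r_ivk_lreg kk ke r_kf (HD im1 i0 im1 i0)).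
- by rewrite T11.
- by rewrite T12 iuM.
- by rewrite T21 iuM.
- by rewrite T12 ivM.
- by rewrite T21 ivM.
- by rewrite T22 r_k2E !ivE mulrA.
Qed.

Lemma r_kH : k * H = H * k.
Proof. by have := congr1 (ev (0 : F)) r_kHv; rewrite !rmorphM /= ev_iu ev0_iv. Qed.

Lemma r_ef : W * bracket e f = P * (iu H - iv H) *+ 2.
Proof.
case: r_row1 => kk ke ke' _.
have kHv : iv k * iv H = iv H * iv k by rewrite -!ivM r_kH.
apply: (ef_of_rtt cW cP (T := Tu) (T' := Tv) (k := iu k) (e := iu e) (f := iu f) (k' := iv k)
  (e' := iv e) (f' := iv f) _ _ _ _ _ _ rW r_WP_lreg r_iuk_lreg r_ivk_rreg kk ke ke' r_kf r_kHv kHv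
  (HD im1 i0 i0 im1)).
- by rewrite T11.
- by rewrite T12 iuM.
- by rewrite T22 r_k2E !iuE mulrA.
- by rewrite T11.
- by rewrite T21 ivM.
- by rewrite T22 r_k2E !ivE mulrA.
Qed.
Lemma fshift_half_half (x : fps A) : fshift hf (fshift (-1 : F) x) = fshift (- hf) x.
Proof. by rewrite fshiftD half_half. Qed.

Lemma r_em_G : em * G = G * fshift hf e.
Proof.
case: r_e13 => _ /(congr1 (fshift hf)).
by rewrite !rmorphM /= fshift_half_half -emE -GE.
Qed.
Lemma r_G_fm : G * fm = fshift hf f * G.
Proof.
case: r_f31 => _ /(congr1 (fshift hf)).
by rewrite !rmorphM /= fshift_half_half -fmE -GE.
Qed.

Lemma r_G0 : G 0%N = 1. Proof. by rewrite GE r_sk0. Qed.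

(** If $r$ is the last row of $T^t(u+\frac12)$, then $rFKE=(0,0,1)$. Since $E$ is upper
    unitriangular, $rFK=(0,0,1)$ as well, and the three components are the claims. *)
Lemma r_last_row : [/\ f32 = - fm, G * k3 = 1
  & transT Tplus ip1 im1 + transT Tplus ip1 i0 * f + transT Tplus ip1 ip1 * f31 = 0].
Proof.
have c1 := @central1 (fps A).
have R3 : transT Tplus ip1 ip1 = G by rewrite /transT negI_p1 /Tplus T11 GE.
have R2 : transT Tplus ip1 i0 = fshift hf f * G by rewrite /transT !negIE /Tplus T21 rmorphM /= GE.
have E1 := O2 ip1 im1; have E2 := O2 ip1 i0; have E3 := O2 ip1 ip1.
move: E1 E2 E3; rewrite /prod3 R3 R2 T11 T12 T13 T21 T22 T23 T31 T32 T33 /=.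
move: (transT _ _ _) => r1 E1 E2 E3.
have A1 : r1 + fshift hf f * G * f + G * f31 = 0.
  by apply: (rreg_fps k0); rewrite mul0r -[RHS]E1 !mulrDl !mulrA.
have A2 : fshift hf f * G + G * f32 = 0.
  apply: (rreg_fps k20); rewrite mul0r -[RHS]E2.
  nc_by c1 c1 (- nc_gap A1 * k * e).
have A3 : G * k3 = 1.
  rewrite -[RHS]E3; nc_by c1 c1 (- nc_gap A1 * k * e13 - nc_gap A2 * k2 * e23).
split=> //; apply: (lreg_fps r_G0); rewrite mulrN r_G_fm.
by apply/eqP; rewrite -addr_eq0 addrC A2.
Qed.

(** Dually, the lower unitriangular factor $F$ is removed from the last column of
    $T(u)T^t(u+\frac12)=1$. *)
Lemma r_last_col : e23 = - em.
Proof.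
have c1 := @central1 (fps A).
have R3 : transT Tplus ip1 ip1 = G by rewrite /transT negI_p1 /Tplus T11 GE.
have R2 : transT Tplus i0 ip1 = G * fshift hf e by rewrite /transT !negIE /Tplus T12 rmorphM /= GE.
have E1 := O1 im1 ip1; have E2 := O1 i0 ip1.
move: E1 E2; rewrite /prod3 R3 R2 T11 T12 T13 T21 T22 T23 /=.
move: (transT _ _ _) => r1 E1 E2.
have A1 : r1 + e * (G * fshift hf e) + e13 * G = 0.
  by apply: (lreg_fps k0); rewrite mulr0 -[RHS]E1 !mulrDr !mulrA.
have A2 : G * fshift hf e + e23 * G = 0.
  apply: (lreg_fps k20); rewrite mulr0 -[RHS]E2.
  nc_by c1 c1 (- (f * k * nc_gap A1)).
apply: (rreg_fps r_G0); rewrite mulNr r_em_G.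
by apply/eqP; rewrite -addr_eq0 addrC A2.
Qed.

Lemma r_middle : (transT Tplus i0 i0 + transT Tplus i0 ip1 * f32) * k2 = 1.
Proof.
have c1 := @central1 (fps A).
have E1 := O2 i0 im1; have E2 := O2 i0 i0.
move: E1 E2; rewrite /prod3 T11 T12 T21 T22 T31 T32 /=.
move: (transT _ _ im1) (transT _ _ i0) (transT _ _ ip1) => r1 r2 r3 E1 E2.
have A1 : r1 + r2 * f + r3 * f31 = 0.
  by apply: (rreg_fps k0); rewrite mul0r -[RHS]E1 !mulrDl !mulrA.
rewrite -[RHS]E2; nc_by c1 c1 (- nc_gap A1 * k * e).
Qed.

(** The $e$-$f$ relation at $v=u+1$, where [fW] is minus twice [fp], followed by $u:=u-\frac12$. It
    reorders the factors in the middle entry used for [r_HG]. *)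
Lemma r_fp_em : em * fshift hf f - fshift hf f * em = fshift hf H - fshift (- hf) H.
Proof.
have E := congr1 (ev (1 : F)) r_ef; rewrite /bracket in E.
rewrite ?(rmorphD, rmorphN, rmorphM, rmorphMn) /= !ev_iu !ev_iv ev_fW // mulr1 scaleNr scaler_nat in E.
have cv := @ev_fp_central F A 1.
have {}E : e * fshift 1 f - fshift 1 f * e = fshift 1 H - H.
  apply: (ev_fp_lreg two0 (c := 1)); apply: (fps_two_inj two0).
  nc_by cv cv (- nc_gap E).
have := congr1 (fshift (- hf)) E; rewrite !rmorphB !rmorphM /= !fshiftD -emE.
have -> // : - hf + 1 = hf.
by apply: (addrI (- hf)); rewrite addrA -opprD -(mulr2n hf) -(mulr_natl hf 2) divff // !addNr.
Qed.

Lemma r_kG : k * G = G * k.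
Proof.
case: r_row1 => kk _ _ _; have := congr1 (ev hf) kk.
by rewrite !rmorphM /= !ev_iu !ev_iv -GE.
Qed.
Lemma r_GH : G * H = H * G.
Proof.
have E : k * fshift (- hf) H = fshift (- hf) H * k.
  by have := congr1 (ev (- hf)) r_kHv; rewrite !rmorphM /= !ev_iu !ev_iv.
by have := congr1 (fshift hf) E; rewrite !rmorphM /= fshiftD subrr fshift_0 -GE.
Qed.
Lemma r_Gplus_H : G * fshift hf H = fshift hf H * G.
Proof. by have := congr1 (fshift hf) r_kH; rewrite !rmorphM /= -GE. Qed.

Lemma r_H0 : H 0%N = 1.
Proof.
have := congr1 (fun x : fps A => x 0%N) kki; rewrite fpsM0 k0 mul1r fps1 => ki0.
by rewrite HE fpsM0 ki0 k20 mulr1.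
Qed.

(* With [J(u) = H(u) k(u + 1/2)] the middle entry of [T^t(u + 1/2) T(u) = 1] reads *)
(* [J(u - 1/2) J(u) = 1]; hence [J] is invariant under [u := u - 1], so constant.  *)
Lemma r_HG : H * G = 1.
Proof.
have c1 := @central1 (fps A).
have [f32E _ _] := r_last_row.
have R2 : transT Tplus i0 i0 = fshift hf f * G * fshift hf e + G * fshift hf H.
  by rewrite /transT negI_0 /Tplus T22 r_k2E !rmorphD !rmorphM /= -GE mulrA.
have R3 : transT Tplus i0 ip1 = G * fshift hf e.
  by rewrite /transT !negIE /Tplus T12 rmorphM /= GE.
have M := r_middle; rewrite R2 R3 f32E r_k2E in M.
have E1 := r_em_G; have E2 := r_G_fm; have E3 := r_fp_em; have E4 := r_Gplus_H.
have E5 := r_kG; have E6 := r_GH; have E7 := r_kH.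
have JJ : fshift (- hf) (H * G) * (H * G) = 1.
  rewrite rmorphM /= GE fshiftD addNr fshift_0 -GE.
  rewrite -[RHS]M.
  nc_by c1 c1 (fshift hf f * nc_gap E1 * k * H - nc_gap E1 * fm * k * H + em * nc_gap E2 * k * H
    + nc_gap E3 * G * k * H - nc_gap E4 * k * H
    + fshift (- hf) H * nc_gap E5 * H - fshift (- hf) H * k * nc_gap E6).
have JJ2 : fshift (-1 : F) (H * G) * fshift (- hf) (H * G) = 1.
  have := congr1 (fshift (- hf)) JJ; rewrite rmorphM rmorph1 /= fshiftD.
  by rewrite -opprD -mulr2n -(mulr_natl hf 2) divff.
have : fshift (-1 : F) (H * G) = H * G.
  by rewrite -[LHS]mulr1 -JJ mulrA JJ2 mul1r.
move/(fshift_fix charF0) => ->; last by rewrite oppr_eq0 oner_eq0.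
by rewrite fpsM0 r_H0 r_G0 mulr1 rmorph1.
Qed.
Lemma r_iu_HG : iu H * iu G = 1. Proof. by rewrite -iuM r_HG iu1. Qed.
Lemma r_iu_GH : iu G * iu H = 1. Proof. by rewrite -iuM r_GH r_HG iu1. Qed.

Let qu := iu (1 + hf *: fX A).
Lemma r_quW_plus : qu * fmap (fshift hf) W = W + P.
Proof. by rewrite shu_fW // two_hf // scale1r. Qed.
Lemma r_quP_plus : qu * fmap (fshift hf) P = P.
Proof. exact: shu_fp. Qed.

(** The reverse of [y_ke_pre]: $u:=u+\frac12$ turns $k$ into $G$, and multiplying by $H=G^{-1}$ on
    both sides returns to $H$. *)
Lemma r_eH : (W - P) * iv e * iu H = (W + P) * iu H * iv e - P * iu (fshift hf e * H) *+ 2.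
Proof.
case: r_row1 => _ ke _ _.
have := congr1 (fmap (fshift hf)) ke.
rewrite ?(rmorphD, rmorphN, rmorphM, rmorphMn) /= !shu_iu !shu_iv -GE => E.
have E1 := r_quW_plus; have E2 := r_quP_plus; have E3 := r_iu_HG; have E4 := r_iu_GH; rewrite ?iuM.
have {}E : (W - P) * iu G * iv e = (W + P) * iv e * iu G - P * iu G * iu (fshift hf e) *+ 2.
  nc_by cW cP (qu * nc_gap E - nc_gap E1 * (iu G * iv e - iv e * iu G)
    + nc_gap E2 * (iu G * iv e - iu G * iu (fshift hf e)) *+ 2).
nc_by cW cP (iu H * nc_gap E * iu H - (W - P) * nc_gap E3 * iv e * iu H
  + (W + P) * iu H * iv e * nc_gap E4 - P * nc_gap E3 * iu (fshift hf e) * iu H *+ 2).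
Qed.

Lemma r_fH : (W + P) * iv f * iu H = (W - P) * iu H * iv f + P * iu (H * fshift hf f) *+ 2.
Proof.
have := congr1 (fmap (fshift hf)) r_kf.
rewrite ?(rmorphD, rmorphN, rmorphM, rmorphMn) /= !shu_iu !shu_iv -GE => E.
have E1 := r_quW_plus; have E2 := r_quP_plus; have E3 := r_iu_HG; have E4 := r_iu_GH; rewrite ?iuM.
have {}E : (W + P) * iu G * iv f = (W - P) * iv f * iu G + P * iu (fshift hf f) * iu G *+ 2.
  nc_by cW cP (qu * nc_gap E - nc_gap E1 * (iu G * iv f - iv f * iu G)
    - nc_gap E2 * (iv f * iu G - iu (fshift hf f) * iu G) *+ 2).
nc_by cW cP (iu H * nc_gap E * iu H - (W + P) * nc_gap E3 * iv f * iu H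
  + (W - P) * iu H * iv f * nc_gap E4 + P * iu H * iu (fshift hf f) * nc_gap E4 *+ 2).
Qed.

Let c0 := @ev_fp_central F A 0.
Lemma r_epH : fshift hf e * H *+ 2 = H * e + e * H.
Proof.
have := congr1 (ev (0 : F)) r_eH.
rewrite ?(rmorphD, rmorphN, rmorphM, rmorphMn) /= ?ev_iu ?ev0_iv ev0_fW // => E.
apply: (ev0_fp_inj two0); nc_by c0 c0 (nc_gap E).
Qed.
Lemma r_Hfp : H * fshift hf f *+ 2 = H * f + f * H.
Proof.
have := congr1 (ev (0 : F)) r_fH.
rewrite ?(rmorphD, rmorphN, rmorphM, rmorphMn) /= ?ev_iu ?ev0_iv ev0_fW // => E.
apply: (ev0_fp_inj two0); nc_by c0 c0 (- nc_gap E).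
Qed.

Theorem r_dseries : dseries H e f.
Proof.
case: r_row1 => kk ke _ ee; split=> //.
- exact: r_H0.
- have E : iu G * iv H = iv H * iu G.
    by have := congr1 (fmap (fshift hf)) r_kHv; rewrite !rmorphM /= !shu_iu !shu_iv -GE.
  exact: commr_inv E r_iu_HG r_iu_GH.
- exact: r_ef.
- have E := r_eH; rewrite -mulrnAr -iuMn r_epH in E.
  rewrite /bracket /abracket; nc_by cW cP (- nc_gap E).
- have E := r_fH; rewrite -mulrnAr -iuMn r_Hfp in E.
  rewrite /bracket /abracket; nc_by cW cP (- nc_gap E).
- rewrite /bracket; nc_by cW cP (nc_gap ee).
- exact: r_ff.
Qed.

Theorem r_T : T = yT H e f G.
Proof.
have [f32E Gk3 _] := r_last_row; have e23E := r_last_col.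
have k3E : k3 = H by rewrite -[k3]mul1r -r_HG -mulrA Gk3 mulr1.
have kE : yk G = k by rewrite /yk GE fshiftK.
have half (x y : fps A) : x *+ 2 = - y -> x = - (hf *: y).
  by move=> xy; apply: (fps_two_inj two0); rewrite xy mulNrn -scaler_nat scalerA divff // scale1r.
have e13E : e13 = ye13 e by apply: half; case: r_e13.
have f31E : f31 = yf31 f by apply: half; case: r_f31.
have emE' : yem e = em by rewrite emE.
have fmE' : yfm f = fm by rewrite fmE.
have c1 := @central1 (fps A).
apply: funext => a; apply: funext => c; rewrite /yT /gaussT kE emE' fmE' -e13E -f31E.
case_I3 a; case_I3 c => //=.
- by rewrite T22 r_k2E mulrA.
- by rewrite T23 r_k2E e23E mulrN !mulrA.
- by rewrite T32 r_k2E f32E mulNr !mulrA.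
- by rewrite T33 r_k2E f32E e23E k3E mulrN mulNr mulrN opprK !mulrA.
Qed.
End YRSide.

(** * The isomorphism *)

Section AlgHom.
Variables (F : fieldType) (A B : algType F) (phi : A -> B) (Hphi : is_alg_hom phi).

(** A bare function tagged with the proof that it is a morphism, so that a canonical ring-morphism
    structure can be attached to it. *)
Definition alg_hom of is_alg_hom phi : A -> B := phi.
Local Notation g := (alg_hom Hphi).

Fact alg_hom_zmod : zmod_morphism g.
Proof.
have [D Z _ _] := Hphi; move=> x y; rewrite /alg_hom D; congr (_ + _).
by rewrite -scaleN1r Z scaleN1r.
Qed.
Fact alg_hom_monoid : monoid_morphism g.
Proof. by have [_ _ M one] := Hphi. Qed.
HB.instance Definition _ := GRing.isZmodMorphism.Build A B g alg_hom_zmod.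
HB.instance Definition _ := GRing.isMonoidMorphism.Build A B g alg_hom_monoid.

Lemma alg_homZ (c : F) x : g (c *: x) = c *: g x. Proof. by have [_ Z _ _] := Hphi; apply: Z. Qed.

Lemma fmap_scale (c : F) (x : fps A) : fmap g (c *: x) = c *: fmap g x.
Proof. by apply: fpsP => n; rewrite /fmap !fpsZ alg_homZ. Qed.

Lemma fmap_fshift (c : F) (x : fps A) : fmap g (fshift c x) = fshift c (fmap g x).
Proof.
apply: fpsP => n; rewrite /fmap /fshift /sshift [LHS]raddf_sum.
by apply: eq_bigr => r _; rewrite /= alg_homZ.
Qed.

Lemma fmap_yT (H e f G : fps A) a c :
  fmap g (yT H e f G a c) = yT (fmap g H) (fmap g e) (fmap g f) (fmap g G) a c.
Proof.
rewrite /yT gaussT_morph /= /yk /yem /yfm /ye13 /yf31 !fmap_fshift.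
by rewrite !rmorphN /= !fmap_scale !rmorphM.
Qed.
End AlgHom.

Lemma alg_hom_comp (F : fieldType) (A B C : algType F) (phi : A -> B) (psi : B -> C) :
  is_alg_hom phi -> is_alg_hom psi -> is_alg_hom (psi \o phi).
Proof.
case=> D1 Z1 M1 o1 [D2 Z2 M2 o2]; split=> [x y|a x|x y|] /=.
- by rewrite D1 D2.
- by rewrite Z1 Z2.
- by rewrite M1 M2.
- by rewrite o1 o2.
Qed.

(** * The relations of the statement in terms of series *)

Section StatementForms.
Variables (F : fieldType) (A : algType F).
Hypothesis two0 : (2%:R : F) != 0.
Local Notation hf := ((2%:R : F)^-1).

Lemma rtt_relP (t : 'I_3 -> 'I_3 -> nat -> A) (T : 'I_3 -> 'I_3 -> fps A) :
  (forall i j, T i j = tser t i j) ->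
  rtt_rel t <->
  [/\ forall a b c d, rtt_defect (fW A) (fp A) (fun a c => iu (T a c)) (fun a c => iv (T a c)) a b c d = 0,
      forall a c, prod3 T (transT (Tplus T)) a c = (a == c)%:R
    & forall a c, prod3 (transT (Tplus T)) T a c = (a == c)%:R].
Proof.
move=> tT; have {T tT}-> : T = fun i j => tser t i j by do 2!apply: funext => ?.
pose T : 'I_3 -> 'I_3 -> fps A := fun i j => tser t i j; rewrite -/T.
have delta a c n : ((a == c :> 'I_3) && (n == 0%N))%:R = ((a == c)%:R : fps A) n.
  by case: (a == c); rewrite ?fps1 ?fps0.
have S1 a c n : \sum_(b < 3) smul (tser t a b) (sshift hf (tser t (negI c) (negI b))) n
   = prod3 T (transT (Tplus T)) a c n.
  by rewrite sum3 /prod3 !fpsD.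
have S2 a c n : \sum_(b < 3) smul (sshift hf (tser t (negI b) (negI a))) (tser t b c) n
   = prod3 (transT (Tplus T)) T a c n.
  by rewrite sum3 /prod3 !fpsD.
split=> [[H O]|[H O1 O2]]; split.
- by move=> a b c d; apply/(rtt_statementP two0) => m n; apply: H.
- by move=> a c; apply: fpsP => n; rewrite -delta -S1; case: (O a c n).
- by move=> a c; apply: fpsP => n; rewrite -delta -S2; case: (O a c n).
- by move=> a b c d m n; move: (H a b c d) => /(rtt_statementP two0) /(_ m n).
- by move=> a c n; rewrite S1 S2 O1 O2 delta.
Qed.

Lemma gauss_decompE (t : 'I_3 -> 'I_3 -> nat -> A) k (e f : 'I_3 -> 'I_3 -> fps A) (i j : 'I_3) :
  gauss_decomp t k e f ->
  (tser t i j : fps A) = \sum_(p < 3) (if (p <= i)%N && (p <= j)%N then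
     (if p == i then 1 else f i p) * ((k p : fps A) * (if p == j then 1 else e p j)) else 0).
Proof.
case=> _ _ H; apply: fpsP => n; rewrite H fps_sum [LHS]big_mkcond.
apply: eq_bigr => p _; case: ifP => _; last by rewrite fps0.
by case: eqP => _; case: eqP => _.
Qed.
End StatementForms.

Section YRModel.
Variables (F : fieldType) (charF0 : [pchar F] =i pred0) (A : algType F).
Variables (t : 'I_3 -> 'I_3 -> nat -> A) (k : 'I_3 -> fps A) (e f : 'I_3 -> 'I_3 -> fps A)
  (ki : fps A).
Hypotheses (Ht : rtt_rel t) (Hg : gauss_decomp t k e f) (kki : k im1 * ki = 1).
Local Notation hf := ((2%:R : F)^-1).

Lemma char0_two : (2%:R : F) != 0.
Proof. by apply/negP => /natf0_pchar -/(_ isT) [p]; rewrite charF0. Qed.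

Let T : 'I_3 -> 'I_3 -> fps A := fun i j => tser t i j.
Let k0 i : k i 0%N = 1. Proof. by case: Hg. Qed.

Lemma gauss_T : [/\ tser t im1 im1 = k im1, tser t im1 i0 = k im1 * e im1 i0,
    tser t i0 im1 = f i0 im1 * k im1
  & tser t i0 i0 = f i0 im1 * (k im1 * e im1 i0) + k i0].
Proof.
by split; rewrite (gauss_decompE _ _ Hg) sum3 /= ?mul1r ?mulr1 ?addr0.
Qed.

Lemma yr_dseries : dseries (ki * k i0) (e im1 i0) (f i0 im1)
  /\ T = yT (ki * k i0) (e im1 i0) (f i0 im1) (fshift hf (k im1))
  /\ (ki * k i0) * fshift hf (k im1) = 1.
Proof.
have two0 := char0_two.
have [HD O1 O2] := iffLR (rtt_relP two0 (T := T) (fun _ _ => erefl)) Ht.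
have [_ ef0 _] := Hg.
have [T11 T12 T21 T22] := gauss_T.
have T13 : T im1 ip1 = k im1 * e im1 ip1 by rewrite /T (gauss_decompE _ _ Hg) sum3 /= ?mul1r ?addr0.
have T23 : T i0 ip1 = f i0 im1 * (k im1 * e im1 ip1) + k i0 * e i0 ip1.
  by rewrite /T (gauss_decompE _ _ Hg) sum3 /= ?mul1r ?addr0.
have T31 : T ip1 im1 = f ip1 im1 * k im1.
  by rewrite /T (gauss_decompE _ _ Hg) sum3 /= ?mulr1 ?addr0.
have T32 : T ip1 i0 = f ip1 im1 * (k im1 * e im1 i0) + f ip1 i0 * k i0.
  by rewrite /T (gauss_decompE _ _ Hg) sum3 /= ?mulr1 ?addr0.
have T33 : T ip1 ip1 = f ip1 im1 * (k im1 * e im1 ip1) + f ip1 i0 * (k i0 * e i0 ip1) + k ip1.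
  by rewrite /T (gauss_decompE _ _ Hg) sum3 /= ?mul1r ?mulr1.
have e0 : e im1 i0 0%N = 0 by case: (ef0 im1 i0 isT).
have f0 : f i0 im1 0%N = 0 by case: (ef0 im1 i0 isT).
split; [|split].
- exact: (r_dseries charF0 two0 HD O2 (k0 im1) (k0 i0) e0 f0 kki T11 T12 T13 T21 T22 T23 T31 T32 T33
    erefl erefl erefl erefl).
- exact: (r_T charF0 two0 HD O1 O2 (k0 im1) (k0 i0) kki T11 T12 T13 T21 T22 T23 T31 T32 T33
    erefl erefl erefl erefl).
- exact: (r_HG charF0 two0 HD O2 (k0 im1) (k0 i0) kki T11 T12 T13 T21 T22 T23 T31 T32 T33
    erefl erefl erefl erefl).
Qed.
End YRModel.

Section YModel.
Variables (F : fieldType) (A : algType F) (H e f G : fps A).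
Hypotheses (two0 : (2%:R : F) != 0) (ds : dseries H e f) (HG : H * G = 1).

Definition yt (i j : 'I_3) (r : nat) : A := yT H e f G i j r.+1.

Lemma yT_tser i j : yT H e f G i j = tser yt i j.
Proof.
apply: fpsP => [[|r]] //=.
have kz : yk G 0%N = 1.
  have := congr1 (fun x : fps A => x 0%N) HG; rewrite fpsM0 (ds_H0 ds) mul1r fps1 => G0.
  by rewrite /yk fshift0 G0.
have e13z : ye13 e 0%N = 0 by rewrite /ye13 fpsN fpsZ fpsM0 (ds_e0 ds) mul0r scaler0 oppr0.
have f31z : yf31 f 0%N = 0 by rewrite /yf31 fpsN fpsZ fpsM0 (ds_f0 ds) mul0r scaler0 oppr0.
have fmz : yfm f 0%N = 0 by rewrite /yfm fshift0 (ds_f0 ds).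
have emz : yem e 0%N = 0 by rewrite /yem fshift0 (ds_e0 ds).
rewrite /yT /gaussT; case_I3 i; case_I3 j => /=;
  rewrite ?fpsD ?fpsN ?fpsM0 ?kz ?e13z ?f31z ?fmz ?emz ?(ds_H0 ds) ?(ds_e0 ds) ?(ds_f0 ds);
  by rewrite ?mul0r ?mulr0 ?mul0r ?mulr1 ?mul1r ?oppr0 ?addr0 ?add0r.
Qed.

Lemma yt_rtt : rtt_rel yt.
Proof.
apply/(rtt_relP two0 yT_tser); split.
- exact: yT_rtt.
- exact: yT_orth.
- exact: yT_orth'.
Qed.
End YModel.

Theorem mainTheorem16 (F : fieldType) (charF0 : [pchar F] =i pred0)
    (Y : algType F) (h xp xm : nat -> Y) (HY : is_Yso3 h xp xm)
    (YR : algType F) (t : 'I_3 -> 'I_3 -> nat -> YR) (HYR : is_YRso3 t)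
    (k : 'I_3 -> nat -> YR) (e f : 'I_3 -> 'I_3 -> nat -> YR)
    (Hgauss : gauss_decomp t k e f)
    (kinv : nat -> YR) (Hkinv : smul (k im1) kinv = sone YR)
    (Hinv : nat -> Y) (HHinv : smul (Hser h) Hinv = sone Y) :
  exists (Phi : Y -> YR) (Psi : YR -> Y),
    [/\ is_alg_hom Phi, is_alg_hom Psi, cancel Phi Psi & cancel Psi Phi]
    /\ [/\ forall l, Phi (xm l) = e im1 i0 l.+1,
           forall l, Phi (xp l) = f i0 im1 l.+1
         & forall l, Phi (h l) = smul kinv (k i0) l.+1]
    /\ [/\ forall r, Psi (e im1 i0 r) = Xser xm r,
           forall r, Psi (f i0 im1 r) = Xser xp r
         & forall r, Psi (k im1 r) = sshift (- (2%:R : F)^-1) Hinv r].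
Proof.
have two0 := char0_two charF0.
case: HY => Yrel Yuniv; case: HYR => Rrel Runiv.
pose K i : fps YR := k i; pose E : fps YR := e im1 i0; pose Fs : fps YR := f i0 im1.
pose HR : fps YR := (kinv : fps YR) * K i0.
have [dsR [TR HGR]] := yr_dseries charF0 Rrel Hgauss Hkinv.
have [T11 T12 T21 T22] := gauss_T Hgauss.
have [Phi [PhiH Phih Phixp Phixm _]] := Yuniv _ _ _ _ (drinfeld_of_dseries two0 dsR).
have dsY := dseries_of_drinfeld two0 Yrel.
pose HY : fps Y := Hser h; pose eY : fps Y := Xser xm; pose fY : fps Y := Xser xp.
pose GY : fps Y := Hinv.
have HGY : HY * GY = 1 by exact: HHinv.
have [Psi [PsiH Psit _]] := Runiv _ _ (yt_rtt two0 dsY HGY).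
have PsiT i j : fmap (alg_hom PsiH) (tser t i j) = yT HY eY fY GY i j.
  rewrite (yT_tser dsY HGY); apply: fpsP => [[|r]]; rewrite /fmap /=; last exact: Psit.
  exact: rmorph_nat.
have kz : yk GY 0%N = 1.
  have H0 : HY 0%N = 1 := ds_H0 dsY.
  have := congr1 (fun x : fps Y => x 0%N) HGY; rewrite fpsM0 H0 mul1r fps1 => G0.
  by rewrite /yk fshift0 G0.
have PsiK : fmap (alg_hom PsiH) (K im1) = yk GY by rewrite /K -T11 PsiT.
have PsiE : fmap (alg_hom PsiH) E = eY.
  have : fmap (alg_hom PsiH) (K im1 * E) = yk GY * eY by rewrite /E /K -T12 PsiT.
  by rewrite rmorphM /= PsiK; apply: lreg_fps kz _ _.
have PsiF : fmap (alg_hom PsiH) Fs = fY.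
  have : fmap (alg_hom PsiH) (Fs * K im1) = fY * yk GY by rewrite /Fs /K -T21 PsiT.
  by rewrite rmorphM /= PsiK; apply: rreg_fps kz _ _.
(* The middle entry of $T$ is $fke+kH$; its first term is already known on both sides, and $k$
   cancels in the second. *)
have PsiHR : fmap (alg_hom PsiH) HR = HY.
  have k2 : K i0 = K im1 * HR by rewrite /HR mulrA [K im1 * _]Hkinv mul1r.
  have : fmap (alg_hom PsiH) (Fs * (K im1 * E) + K i0) = fY * yk GY * eY + yk GY * HY.
    by rewrite /Fs /E /K -T22 PsiT.
  rewrite k2 rmorphD !rmorphM /= PsiF PsiE PsiK mulrA => /addrI.
  exact: lreg_fps kz _ _.
have HR0 : HR 0%N = 1 := ds_H0 dsR.
have E0 : E 0%N = 0 := ds_e0 dsR.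
have F0 : Fs 0%N = 0 := ds_f0 dsR.
have PhiHY : fmap (alg_hom PhiH) HY = HR.
  by apply: fpsP => [[|r]]; [rewrite HR0; apply: rmorph1 | apply: Phih].
have PhieY : fmap (alg_hom PhiH) eY = E.
  by apply: fpsP => [[|r]]; [rewrite E0; apply: rmorph0 | apply: Phixm].
have PhifY : fmap (alg_hom PhiH) fY = Fs.
  by apply: fpsP => [[|r]]; [rewrite F0; apply: rmorph0 | apply: Phixp].
(* Both sides are right inverses of the regular series [HR], the right-hand one by [yr_dseries]. *)
have PhiGY : fmap (alg_hom PhiH) GY = fshift (2%:R : F)^-1 (K im1).
  have PG : HR * fmap (alg_hom PhiH) GY = 1 by rewrite -PhiHY -rmorphM HGY rmorph1.
  by apply: (lreg_fps HR0); apply: etrans PG _; rewrite -HGR.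
have PsiPhi : Psi \o Phi = id.
  have [phi0 [_ _ _ _ U]] := Yuniv _ _ _ _ Yrel.
  transitivity phi0; last by apply/esym; apply: U.
  apply: U; first exact: alg_hom_comp PhiH PsiH.
  - by move=> l /=; rewrite Phih; exact: (congr1 (fun x : fps Y => x l.+1) PsiHR).
  - by move=> l /=; rewrite Phixp; exact: (congr1 (fun x : fps Y => x l.+1) PsiF).
  - by move=> l /=; rewrite Phixm; exact: (congr1 (fun x : fps Y => x l.+1) PsiE).
(* [Psi] sends $t_{ij}$ to the entries of [yT] over [Y], and [Phi] carries these to [yT] over [YR],
   which is $T$ itself by [TR]. *)
have PhiPsi : Phi \o Psi = id.
  have [psi0 [_ _ U]] := Runiv _ _ Rrel.
  transitivity psi0; last by apply/esym; apply: U.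
  apply: U; first exact: alg_hom_comp PsiH PhiH.
  move=> i j r /=; rewrite Psit.
  have E1 := congr1 (fun x : fps YR => x r.+1) (fmap_yT PhiH HY eY fY GY i j).
  rewrite PhiHY PhieY PhifY PhiGY in E1.
  apply: etrans E1 _.
  exact: (esym (congr1 (fun X : 'I_3 -> 'I_3 -> fps YR => X i j r.+1) TR)).
exists Phi, Psi; split; last split.
- split=> //.
  + by move=> x; rewrite -[LHS]/((Psi \o Phi) x) PsiPhi.
  + by move=> x; rewrite -[LHS]/((Phi \o Psi) x) PhiPsi.
- by split.
- split=> r.
  + by have := congr1 (fun x : fps Y => x r) PsiE.
  + by have := congr1 (fun x : fps Y => x r) PsiF.
  + by have := congr1 (fun x : fps Y => x r) PsiK.
Qed.
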